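(* Assume there exist $0<\kappa,\varepsilon<1$ such that $$\varepsilon<p^v(x,z^v)<\varepsilon^{-1},\qquad \kappa<g^v(x^v,y^v)<\kappa^{-1}\qquad\text{for all } v\in V,\ x,z\in\mathbb X,\ y\in\mathbb Y,$$ and such that $$\varepsilon>\varepsilon_0=\left(1-\frac1{6\Delta_{\overline{\mathcal K}}\Delta^2}\right)^{1/(2\Delta)}.$$ Let $\beta=-\log\left(6\Delta_{\overline{\mathcal K}}\Delta^2(1-\varepsilon^{2\Delta})\right)>0$. Then for every initial probability measure $\mu$ on $\mathbb X$, every $n\ge0$, every $K\in\mathcal K$ and every $I\subseteq K$, $$|||\tilde\pi_n^\mu-\hat\pi_n^\mu|||_I\ \le\ |I|\,\frac{64\Delta_{\mathcal K}}{1-e^{-\beta}}\,\frac{\varepsilon^{-4|\overline{\mathcal K}|_\infty}\,\kappa^{-4|\overline{\mathcal K}|_\infty\Delta_{\mathcal K}}}{\sqrt N}.$$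
   Context: **Model.** $G=(V,E)$ is a finite undirected graph with graph distance $d$ (number of edges of a shortest path); for sets, $d(I,J)=\inf_{v\in I,w\in J}d(v,w)$. For each $v\in V$, $\mathbb X^v,\mathbb Y^v$ are Polish spaces with reference measures $\psi^v,\varphi^v$; $\mathbb X=\prod_v\mathbb X^v$, $\mathbb Y=\prod_v\mathbb Y^v$, $\psi=\bigotimes_v\psi^v$, $\varphi=\bigotimes_v\varphi^v$. For $I\subseteq V$, $x^I=(x^i)_{i\in I}$ and $\mathbb X^I=\prod_{v\in I}\mathbb X^v$. $(X_n)_{n\ge0}$ is a Markov chain on $\mathbb X$ with transition density $p(x,z)=\prod_v p^v(x,z^v)$ with respect to $\psi$; $(Y_n)$ are $\mathbb Y$-valued observations, conditionally independent given $(X_n)$, with observation density $g(x,y)=\prod_v g^v(x^v,y^v)$ with respect to $\varphi$. Here $p^v:\mathbb X\times\mathbb X^v\to\mathbb R$ and $g^v:\mathbb X^v\times\mathbb Y^v\to\mathbb R$ are densities with respect to $\psi^v$ and $\varphi^v$. Fix an interaction range $r$ (a positive integer) and put $N(v)=\{v'\in V: d(v,v')\le r\}$; it is assumed that $p^v(x_1,z^v)=p^v(x_2,z^v)$ whenever $x_1^{N(v)}=x_2^{N(v)}$. The observation sequence $(Y_n)$ is held fixed. **Prediction.** For a probability measure $\rho$ on $\mathbb X$, $(\mathsf P\rho)(A)=\int \mathbf 1_A(x)p(x_0,x)\psi(dx)\rho(dx_0)$. **Blocks.** $\mathcal K$ is a partition of $V$ into non-overlapping blocks and $b\ge0$ is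 a fixed parameter. For $K\in\mathcal K$, $\overline K=\{v\in V: d(v,K)\le b\}$, and $\overline{\mathcal K}=\{\overline K:K\in\mathcal K\}$. Further, $$\Delta=\max_{v\in V}|N(v)|,\qquad |\overline{\mathcal K}|_\infty=\max_{K\in\mathcal K}|\overline K|,$$ $$\Delta_{\mathcal K}=\max_{K\in\mathcal K}|\{K'\in\mathcal K:d(K,K')\le r\}|,\qquad \Delta_{\overline{\mathcal K}}=\max_{K\in\mathcal K}|\{K'\in\mathcal K:d(K',\overline K)\le r\}|.$$ **Enlarged blocked filters.** Let $\mathbb X^E=\prod_{K\in\mathcal K}\prod_{v\in\overline K}\mathbb X^v$ (each enlarged block has its own copy of its coordinates). For $J\subseteq V$, $\mathsf B^J\rho$ denotes the marginal of $\rho$ on $\mathbb X^J$. The operators are: - $\mathsf B^E\rho=\bigotimes_{K\in\mathcal K}\mathsf B^{\overline K}\rho$, a measure on $\mathbb X^E$; - $\mathsf C_n^E$, which reweights a probability measure on $\mathbb X^E$ by $\prod_{K\in\mathcal K}\prod_{v\in\overline K}g^v(x^v,Y_n^v)$ (each factor evaluated at the copy of coordinate $v$ in the block $\overline K$) and normalizes; - $\mathsf B^{-1}$, which maps a measure on $\mathbb X^E$ to the measure on $\mathbb X$ that is the product over $K\in\mathcal K$ of its marginals on the coordinates $v\in K$ belonging to the copy associated with $\overline K$; - $\mathsf S^N\rho=\frac1N\sum_{i=1}^N\delta_{x(i)}$ with $x(1),\dots,x(N)$ i.i.d. $\sim\rho$ (freshly sampled at each step, conditionally on the past). The ideal enlarged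 blocked filter is $\tilde\pi_0^\mu=\mu$, $\tilde\pi_n^\mu=\mathsf B^{-1}\mathsf C_n^E\mathsf B^E\mathsf P\,\tilde\pi_{n-1}^\mu$ for $n\ge1$. The enlarged blocked particle filter is $\hat\pi_0^\mu=\mu$, $\hat\pi_n^\mu=\mathsf B^{-1}\mathsf C_n^E\mathsf B^E\mathsf S^N\mathsf P\,\hat\pi_{n-1}^\mu$ for $n\ge1$. **Distance.** For (possibly random) probability measures $\rho,\nu$ on $\mathbb X$ and $I\subseteq V$, $|||\rho-\nu|||_I=\sup_f\mathbf E[|\rho(f)-\nu(f)|^2]^{1/2}$, where the supremum is over measurable $f:\mathbb X\to\mathbb R$ with $|f|\le1$ depending only on $x^I$, and the expectation is over the random sampling. *)

(* Defs.v *)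
From HB Require Import structures.
From mathcomp Require Import all_boot all_order all_algebra.
From mathcomp Require Import all_classical all_reals all_analysis.
From mathcomp Require Import measurable_realfun.

Set Implicit Arguments.
Unset Strict Implicit.
Unset Printing Implicit Defensive.

Import Order.TTheory GRing.Theory Num.Theory.
Import numFieldNormedType.Exports.

Local Open Scope classical_set_scope.
Local Open Scope ring_scope.

Definition borel (T : ptopologicalType) : measurableType (@open T).-sigma :=
  g_sigma_algebraType (@open T).

(* Separable and homeomorphic to a complete metric space *)
Definition polish (R : realType) (T : topologicalType) : Prop :=
  (exists2 D : set T, countable D & dense D) /\
  exists (M : metricType R) (f : T -> M) (g : M -> T),
    [/\ cancel f g, cancel g f, continuous f, continuous g &
        forall F : set_system M, ProperFilter F -> cauchy F ->
          exists l : M, F --> l].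

Definition prod_space (I : Type) (T : I -> Type) : Type := forall i, T i.

Definition prod_gen (I : Type) (d : I -> measure_display)
    (T : forall i, measurableType (d i)) : set (set (prod_space T)) :=
  \bigcup_i preimage_set_system setT (fun x : prod_space T => x i) measurable.

Definition prod_space_display (I : Type) (d : I -> measure_display)
  (T : forall i, measurableType (d i)) : measure_display.
Proof. exact: default_measure_display. Qed.

Section prod_space_measurable.
Context (I : Type) (d : I -> measure_display)
  (T : forall i, measurableType (d i)).

HB.instance Definition _ := gen_eqMixin (prod_space T).
HB.instance Definition _ := gen_choiceMixin (prod_space T).
HB.instance Definition _ :=
  isPointed.Build (prod_space T) (fun i => point : T i).

Let prod_set0 : <<s @prod_gen I d T >> set0.
Proof. exact: sigma_algebra0. Qed.

Let prod_setC A : <<s @prod_gen I d T >> A -> <<s @prod_gen I d T >> (~` A).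
Proof. exact: sigma_algebraC. Qed.

Let prod_bigcup (F : _^nat) : (forall k, <<s @prod_gen I d T >> (F k)) ->
  <<s @prod_gen I d T >> (\bigcup_k (F k)).
Proof. exact: sigma_algebra_bigcup. Qed.

HB.instance Definition _ := @isMeasurable.Build (prod_space_display T)
  (prod_space T) <<s @prod_gen I d T >> prod_set0 prod_setC prod_bigcup.

Lemma measurable_coord (i : I) :
  measurable_fun [set: prod_space T] (fun x => x i).
Proof.
move=> _ B mB; rewrite setTI; apply: sub_sigma_algebra.
by exists i => //; exists B => //; rewrite setTI.
Qed.

Lemma measurable_prod_spaceP d0 (S : measurableType d0)
    (f : S -> prod_space T) :
  (forall i, measurable_fun [set: S] (fun s => f s i)) ->
  measurable_fun [set: S] f.
Proof.
move=> mf; apply: (@measurability _ _ _ _ _ _ (@prod_gen I d T)) => //.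
move=> _ [_ [i _ [B mB <-]] <-]; rewrite !setTI.
by have := mf i measurableT B mB; rewrite setTI.
Qed.

End prod_space_measurable.

Section image_measure.
Context d d' (S : measurableType d) (T : measurableType d') (R : realType).
Variables (m : {measure set S -> \bar R}) (f : {mfun S >-> T}).

Definition image_measure : set T -> \bar R := pushforward m f.

Let image_measure0 : image_measure set0 = 0%E.
Proof. exact: measure0. Qed.

Let image_measure_ge0 A : (0 <= image_measure A)%E.
Proof. exact: measure_ge0. Qed.

Let image_measure_sigma_additive : semi_sigma_additive image_measure.
Proof. exact: measure_semi_sigma_additive. Qed.

HB.instance Definition _ := isMeasure.Build _ _ _ image_measure
  image_measure0 image_measure_ge0 image_measure_sigma_additive.

End image_measure.

Section sigma_finite_of.
Context d (T : measurableType d) (R : realType).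
Variables (m : {measure set T -> \bar R}) (m_sf : sigma_finite setT m).

Definition sigma_finite_of of sigma_finite setT m : set T -> \bar R := m.

HB.instance Definition _ := Measure.on (sigma_finite_of m_sf).
HB.instance Definition _ :=
  Measure_isSigmaFinite.Build _ _ _ (sigma_finite_of m_sf) m_sf.

End sigma_finite_of.

Section prod_measure.
Context (R : realType) (I : finType) (d : I -> measure_display)
  (T : forall i, measurableType (d i)).

Definition update (i : I) (xt : prod_space T * T i) : prod_space T :=
  dfwith xt.1 i xt.2.

Lemma measurable_update i : measurable_fun setT (@update i).
Proof.
apply: measurable_prod_spaceP => j.
have [<-|ij] := eqVneq i j.
  rewrite (_ : (fun _ => _) = snd); first exact: measurable_snd.
  by apply/funext => -[x t]; rewrite /update /= dfwithin.
rewrite (_ : (fun _ => _) = (fun x : prod_space T => x j) \o fst).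
  by apply: measurableT_comp; [exact: measurable_coord|exact: measurable_fst].
by apply/funext => -[x t]; rewrite /update /= dfwithout.
Qed.

HB.instance Definition _ i :=
  isMeasurableFun.Build _ _ _ _ (@update i) (@measurable_update i).

Variable mu : forall i, {sigma_finite_measure set (T i) -> \bar R}.

(* The product of the [mu i] for [i] in [s], the remaining coordinates being
   frozen at [point]. *)
Fixpoint prod_measure_seq (s : seq I) :
    {measure set (prod_space T) -> \bar R} :=
  if s is i :: s' then image_measure (prod_measure_seq s' \x mu i)%E (@update i)
  else \d_point.

Definition prod_measure : set (prod_space T) -> \bar R :=
  prod_measure_seq (enum I).

HB.instance Definition _ := Measure.on prod_measure.

Definition box (A : forall i, set (T i)) : set (prod_space T) :=
  [set x | forall i, A i (x i)].

Lemma measurable_box (A : forall i, set (T i)) :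
  (forall i, measurable (A i)) -> measurable (box A).
Proof.
move=> mA; rewrite (_ : box A =
    \bigcap_(i in [set: I]) ((fun x : prod_space T => x i) @^-1` A i)).
  apply: fin_bigcap_measurable; first exact: finite_finset.
  by move=> i _; rewrite -[X in measurable X]setTI; exact: measurable_coord.
by apply/seteqP; split => [x Ax i _|x Ax i]; [exact: Ax|exact: (Ax i)].
Qed.

Lemma prod_measure_seq_box (s : seq I) (A : forall i, set (T i)) :
  uniq s -> (forall i, measurable (A i)) ->
  (forall i, i \notin s -> A i = setT) ->
  prod_measure_seq s (box A) = (\prod_(i <- s) mu i (A i))%E.
Proof.
elim: s A => [|i s IHs] A /=; first move=> _ mA AT.
  rewrite big_nil diracE mem_set// => i.
  by rewrite AT.
move=> /andP[is_ us] mA AT.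
pose A' := dfwith A i (setT : set (T i)).
have mA' j : measurable (A' j).
  by rewrite /A'; case: dfwithP.
rewrite /image_measure /pushforward.
rewrite (_ : _ @^-1` _ = box A' `*` A i); last first.
  apply/seteqP; split => -[x t] /= => [xA|[xA' tA] j].
    split; last by have := xA i; rewrite /update/= dfwithin.
    move=> j; rewrite /A'; have [<-|ij] := eqVneq i j.
      by rewrite dfwithin.
    by rewrite dfwithout//; have := xA j; rewrite /update/= dfwithout.
  rewrite /update/=; have [<-|ij] := eqVneq i j; first by rewrite dfwithin.
  by rewrite dfwithout//; have := xA' j; rewrite /A' dfwithout.
rewrite product_measure1E//; last exact: measurable_box.
rewrite IHs//; last first.
  move=> j js; rewrite /A'; have [<-|ij] := eqVneq i j.
    by rewrite dfwithin.
  by rewrite dfwithout// AT// inE negb_or eq_sym ij.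
rewrite big_cons muleC; congr (_ * _)%E.
rewrite !big_seq; apply: eq_bigr => j js; rewrite /A' dfwithout//.
by apply: contraNneq is_ => ->.
Qed.

Lemma prod_measure_box (A : forall i, set (T i)) :
  (forall i, measurable (A i)) ->
  prod_measure (box A) = (\prod_(i : I) mu i (A i))%E.
Proof.
move=> mA; rewrite /prod_measure prod_measure_seq_box ?enum_uniq ?big_enum//.
by move=> i; rewrite mem_enum.
Qed.

Lemma prod_measure_seq_sigma_finite (s : seq I) : uniq s ->
  sigma_finite setT (prod_measure_seq s).
Proof.
move=> us.
have F_ i : {F : nat -> set (T i) |
    [/\ setT = \bigcup_n F n, {homo F : n m / (n <= m)%N >-> (n <= m)%O}
      & forall n, measurable (F n) /\ (mu i (F n) < +oo)%E]}.
  by apply: cid; apply/sigma_finiteP; exact: sigma_finiteT.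
pose F i := sval (F_ i).
have FT i : setT = \bigcup_n F i n by rewrite /F; case: (F_ i) => ? [].
have Fnd i : {homo F i : n m / (n <= m)%N >-> (n <= m)%O}.
  by rewrite /F; case: (F_ i) => ? [].
have mF i n : measurable (F i n).
  by rewrite /F; case: (F_ i) => f [? ? h]; case: (h n).
have muF i n : (mu i (F i n) < +oo)%E.
  by rewrite /F; case: (F_ i) => f [? ? h]; case: (h n).
pose G n i := if i \in s then F i n else setT.
have mG n i : measurable (G n i) by rewrite /G; case: ifP.
exists (fun n => box (G n)).
  apply/seteqP; split => // x _.
  have /boolp.choice[n nP] : forall i, exists n, F i n (x i).
    move=> i.
    by have : [set: T i] (x i) by []; rewrite FT => -[n _ ?]; exists n.
  exists (\max_i n i)%N => // i; rewrite /G; case: ifPn => // _.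
  have le_n : (n i <= \max_j n j)%N by exact: leq_bigmax.
  by have /subsetPset sF := Fnd i _ _ le_n; exact/sF/nP.
move=> n; split; first exact: measurable_box.
rewrite prod_measure_seq_box//; last by move=> i /negbTE iNs; rewrite /G iNs.
rewrite -ge0_fin_numE; last by apply: prode_ge0.
rewrite big_seq; apply: prode_fin_num => i si.
by rewrite /G si ge0_fin_numE.
Qed.

HB.instance Definition _ := Measure_isSigmaFinite.Build _ _ _ prod_measure
  (prod_measure_seq_sigma_finite (enum_uniq I)).

Lemma prod_measure_seq_integral (s : seq I) (f : forall i, T i -> \bar R) :
  uniq s -> (forall i, measurable_fun [set: T i] (f i)) ->
  (forall i t, (0 <= f i t)%E) ->
  (\int[prod_measure_seq s]_x \prod_(i <- s) f i (x i) =
   \prod_(i <- s) \int[mu i]_t f i t)%E.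
Proof.
move=> us mf f0; elim: s us => [_|i s IHs /andP[is_ us]] /=.
  under eq_integral do rewrite big_nil.
  by rewrite integral_cst//= diracT mule1 big_nil.
have mprod (r : seq I) :
    measurable_fun [set: prod_space T]
      (fun x => \prod_(j <- r) f j (x j))%E.
  elim: r => [|j r IHr].
    rewrite [X in measurable_fun _ X](_ : _ = cst 1%E); first by [].
    by apply/funext => x; rewrite big_nil.
  rewrite [X in measurable_fun _ X](_ : _ = ((fun x : prod_space T =>
      f j (x j)) \* (fun x => \prod_(j <- r) f j (x j)))%E).
    apply: emeasurable_funM; last exact: IHr.
    apply: (measurableT_comp (mf j)); exact: measurable_coord.
  by apply/funext => x; rewrite big_cons.
have mcoord : measurable_fun [set: prod_space T * T i]%type (f i \o snd).
  by apply: measurableT_comp => //; exact: mf.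
rewrite /image_measure ge0_integral_pushforward//; last first.
  by move=> x _; apply: prode_ge0.
pose m : {sigma_finite_measure set (prod_space T) -> \bar R} :=
  sigma_finite_of (prod_measure_seq_sigma_finite us).
rewrite preimage_setT [LHS](_ : _ = \int[m \x mu i]_(xt in setT)
    ((\prod_(j <- s) f j (xt.1 j)) * f i xt.2))%E; last first.
  apply: eq_integral => -[x t] _ /=; rewrite big_cons muleC.
  rewrite /update/= dfwithin; congr (_ * _)%E.
  rewrite !big_seq; apply: eq_bigr => j js; rewrite dfwithout//.
  by apply: contraNneq is_ => ->.
rewrite (@fubini_tonelli1 _ _ _ _ _ m (mu i)); last 2 first.
- apply: emeasurable_funM => //.
  by apply: (measurableT_comp (mprod s)); exact: measurable_fst.
- by move=> x; rewrite mule_ge0// prode_ge0.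
rewrite [LHS](_ : _ = \int[m]_x
    ((\prod_(j <- s) f j (x j)) * \int[mu i]_t f i t))%E; last first.
  apply: eq_integral => x _; rewrite /fubini_F/= ge0_integralZl//.
  - by apply: prode_ge0.
rewrite ge0_integralZr//; last 2 first.
  by move=> x _; apply: prode_ge0.
  by apply: integral_ge0.
by rewrite (IHs us) big_cons muleC.
Qed.

Lemma prod_measure_integral (f : forall i, T i -> \bar R) :
  (forall i, measurable_fun [set: T i] (f i)) ->
  (forall i t, (0 <= f i t)%E) ->
  (\int[prod_measure]_x \prod_(i : I) f i (x i) =
   \prod_(i : I) \int[mu i]_t f i t)%E.
Proof.
move=> mf f0; have := prod_measure_seq_integral (enum_uniq I) mf f0.
rewrite big_enum => <-; apply: eq_integral => x _.
by rewrite big_enum.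
Qed.

End prod_measure.

Section prod_probability.
Context (R : realType) (I : finType) (d : I -> measure_display)
  (T : forall i, measurableType (d i)).
Variable P : forall i, probability (T i) R.

Definition prod_probability : set (prod_space T) -> \bar R :=
  prod_measure (fun i => P i).

HB.instance Definition _ := Measure.on prod_probability.

Let prod_probability_setT : prod_probability setT = 1%E.
Proof.
rewrite [X in prod_probability X](_ : _ = box (fun i => [set: T i]));
  last first.
  by apply/seteqP; split.
rewrite /prod_probability prod_measure_box//.
by rewrite big1// => i _; exact: probability_setT.
Qed.

HB.instance Definition _ := Measure_isProbability.Build _ _ _
  prod_probability prod_probability_setT.

End prod_probability.

Section reweight.
Context d (T : measurableType d) (R : realType).
Variables (m : {measure set T -> \bar R}) (h : T -> R).
Hypotheses (mh : measurable_fun setT h) (h0 : forall x, 0 <= h x).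

Definition density_measure of measurable_fun setT h & (forall x, 0 <= h x) :
  set T -> \bar R := fun A => (\int[m]_(x in A) (h x)%:E)%E.

Let dm := density_measure mh h0.

Let density_measure0 : dm set0 = 0%E.
Proof. by rewrite /dm /density_measure integral_set0. Qed.

Let density_measure_ge0 A : (0 <= dm A)%E.
Proof. by apply: integral_ge0 => x _; rewrite lee_fin. Qed.

Let density_measure_sigma_additive : semi_sigma_additive dm.
Proof.
apply: semi_sigma_additive_nng_induced => [|x]; first exact/measurable_EFinP.
by rewrite lee_fin.
Qed.

HB.instance Definition _ := isMeasure.Build _ _ _ (density_measure mh h0)
  density_measure0 density_measure_ge0 density_measure_sigma_additive.

End reweight.

(* [m] is only the fallback of [mnormalize], used when the integral of [h]
   vanishes or is infinite. *)
Definition reweight d (T : measurableType d) (R : realType)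
    (m : probability T R) (h : T -> R) (mh : measurable_fun setT h)
    (h0 : forall x, 0 <= h x) : probability T R :=
  mnormalize (density_measure m mh h0) m.

Section empirical.
Context d (T : measurableType d) (R : realType).
Variables (N : nat) (N_gt0 : (0 < N)%N) (x : 'I_N -> T).

Definition empirical_measure of (0 < N)%N : set T -> \bar R :=
  fun A => ((N%:R^-1)%:E * \sum_(i < N) \d_(x i) A)%E.

Let em := empirical_measure N_gt0.

Let empirical0 : em set0 = 0%E.
Proof. by rewrite /em /empirical_measure big1 ?mule0. Qed.

Let empirical_ge0 A : (0 <= em A)%E.
Proof. by rewrite mule_ge0 ?lee_fin ?invr_ge0// sume_ge0. Qed.

Let empirical_sigma_additive : semi_sigma_additive em.
Proof.
pose i0 := Ordinal N_gt0.
pose m : nat -> {measure set T -> \bar R} := fun k => \d_(x (insubd i0 k)).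
have N_ge0 : 0 <= N%:R^-1 :> R by rewrite invr_ge0.
rewrite (_ : em = mscale (NngNum N_ge0) (msum m N)).
  exact: measure_semi_sigma_additive.
apply/funext => A; rewrite /em /empirical_measure /mscale /msum/=.
by congr (_ * _)%E; apply: eq_bigr => i _; rewrite /m /insubd valK.
Qed.

HB.instance Definition _ := isMeasure.Build _ _ _ (empirical_measure N_gt0)
  empirical0 empirical_ge0 empirical_sigma_additive.

Let empirical_setT : em setT = 1%E.
Proof.
rewrite /em /empirical_measure (eq_bigr (fun=> 1%:E)) => [|i _]; last first.
  by rewrite diracT.
rewrite sumEFin -EFinM big_const_ord iter_addr addr0 mulVf//.
by rewrite pnatr_eq0 -lt0n.
Qed.

HB.instance Definition _ := Measure_isProbability.Build _ _ _
  (empirical_measure N_gt0) empirical_setT.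

End empirical.

Section graph.
Context (R : realType) (V : finType).
Variables (e : rel V) (r : nat) (b : {nonneg R}).

(* [+oo] for vertices in distinct connected components *)
Definition graph_dist (v w : V) : \bar R :=
  ereal_inf [set (size p)%:R%:E | p in [set p | path e v p /\ last v p = w]].

Definition set_dist (I J : {set V}) : \bar R :=
  ereal_inf [set graph_dist v w | v in [set` I] & w in [set` J]].

Definition nbhd (v : V) : {set V} :=
  [set w | (graph_dist v w <= r%:R%:E)%E]%SET.

Definition enlarge (K : {set V}) : {set V} :=
  [set v | (set_dist [set v]%SET K <= (b%:num)%:E)%E]%SET.

(* Delta, |\overline K|_oo, Delta_K and Delta_{\overline K}, in this order *)
Definition max_nbhd : nat := (\max_(v : V) #|nbhd v|)%N.

Definition max_enlarged (KK : {set {set V}}) : nat :=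
  (\max_(K in KK) #|enlarge K|)%N.

Definition block_degree (KK : {set {set V}}) : nat :=
  (\max_(K in KK)
     #|[set K' in KK | (set_dist K K' <= r%:R%:E)%E]%SET|)%N.

Definition enlarged_degree (KK : {set {set V}}) : nat :=
  (\max_(K in KK)
     #|[set K' in KK | (set_dist K' (enlarge K) <= r%:R%:E)%E]%SET|)%N.

Lemma sub_enlarge (K : {set V}) : {subset K <= enlarge K}.
Proof.
move=> v vK; rewrite inE (@le_trans _ _ 0%E) ?lee_fin//.
apply: (@le_trans _ _ (graph_dist v v)).
  by apply: ereal_inf_lbound; exists v; rewrite /= ?inE//; exists v.
by apply: ereal_inf_lbound; exists [::].
Qed.

End graph.

Section blocks.
Context (R : realType) (V : finType) (d : V -> measure_display)
  (X : forall v, measurableType (d v)).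

Definition sub_space (J : {set V}) : Type :=
  prod_space (fun u : {v | v \in J} => X (val u)).

HB.instance Definition _ J := Measurable.on (sub_space J).

Definition restrict (J : {set V}) (x : prod_space X) : sub_space J :=
  fun u => x (val u).

Lemma measurable_restrict J : measurable_fun setT (@restrict J).
Proof. by apply: measurable_prod_spaceP => u; exact: measurable_coord. Qed.

HB.instance Definition _ J :=
  isMeasurableFun.Build _ _ _ _ (@restrict J) (@measurable_restrict J).

Definition marginal (J : {set V}) (rho : probability (prod_space X) R) :
  probability (sub_space J) R := distribution rho (@restrict J).

Variables (e : rel V) (b : {nonneg R}) (KK : {set {set V}}).

Definition block : Type := {K : {set V} | K \in KK}.
HB.instance Definition _ := Finite.on block.

Definition enlarged_space : Type :=
  prod_space (fun K : block => sub_space (enlarge e b (val K))).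

HB.instance Definition _ := Measurable.on enlarged_space.

(* B^E *)
Definition block_enlarge (rho : probability (prod_space X) R) :
    probability enlarged_space R :=
  prod_probability (fun K : block => marginal (enlarge e b (val K)) rho).

(* The coordinates in [K] of the copy associated with the enlarged block. *)
Definition core (K : block) (x : enlarged_space) : sub_space (val K) :=
  fun u => x K (exist _ (val u) (sub_enlarge e b (valP u))).

Lemma measurable_core K : measurable_fun setT (@core K).
Proof.
apply: measurable_prod_spaceP => u.
pose w : {v | v \in enlarge e b (val K)} :=
  exist _ (val u) (sub_enlarge e b (valP u)).
apply: (@measurableT_comp _ _ _ _ _ _ (fun z : sub_space _ => z w) _
  (fun x : enlarged_space => x K)); exact: measurable_coord.
Qed.

HB.instance Definition _ K :=
  isMeasurableFun.Build _ _ _ _ (@core K) (@measurable_core K).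

Hypothesis KK_part : finset.partition KK [set: V]%SET.

Lemma pblock_block (v : V) : finset.pblock KK v \in KK.
Proof. by rewrite finset.pblock_mem// (finset.cover_partition KK_part) inE. Qed.

Lemma mem_own_block (v : V) : v \in finset.pblock KK v.
Proof. by rewrite finset.mem_pblock (finset.cover_partition KK_part) inE. Qed.

(* The identification of the product over the blocks with [prod_space X] *)
Definition glue of finset.partition KK [set: V]%SET :
    prod_space (fun K : block => sub_space (val K)) -> prod_space X :=
  fun z v => z (exist _ (finset.pblock KK v) (pblock_block v))
               (exist _ v (mem_own_block v)).

Lemma measurable_glue : measurable_fun setT (glue KK_part).
Proof.
apply: measurable_prod_spaceP => v.
pose K : block := exist _ (finset.pblock KK v) (pblock_block v).
pose w : {w | w \in val K} := exist _ v (mem_own_block v).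
apply: (@measurableT_comp _ _ _ _ _ _ (fun z : sub_space (val K) => z w) _
  (fun x : prod_space (fun K : block => sub_space (val K)) => x K));
  exact: measurable_coord.
Qed.

HB.instance Definition _ :=
  isMeasurableFun.Build _ _ _ _ (glue KK_part) measurable_glue.

(* B^{-1} *)
Definition block_restore (nu : probability enlarged_space R) :
    probability (prod_space X) R :=
  distribution (prod_probability (fun K : block => distribution nu (@core K)))
    (glue KK_part).

End blocks.

(* [trans v] and [obs v] are the local densities p^v and g^v. *)
Unset Implicit Arguments.

Record hmm (R : realType) (V : finType) (dX dY : V -> measure_display)
    (X : forall v, measurableType (dX v)) (Y : forall v, measurableType (dY v))
    (psi : forall v, {sigma_finite_measure set (X v) -> \bar R})
    (phi : forall v, {sigma_finite_measure set (Y v) -> \bar R}) := Hmm {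
  trans : forall v, prod_space X -> X v -> R ;
  obs : forall v, X v -> Y v -> R ;
  trans_ge0 : forall v x z, 0 <= trans v x z ;
  obs_ge0 : forall v x y, 0 <= obs v x y ;
  measurable_trans : forall v,
    measurable_fun [set: prod_space X * X v]%type
      (fun xz => trans v xz.1 xz.2) ;
  measurable_obs : forall v,
    measurable_fun [set: X v * Y v]%type (fun xy => obs v xy.1 xy.2) ;
  trans_density : forall v x, (\int[psi v]_z (trans v x z)%:E = 1)%E ;
  obs_density : forall v x, (\int[phi v]_y (obs v x y)%:E = 1)%E }.

Set Implicit Arguments.

Arguments hmm {R V dX dY X Y} psi phi.
Arguments trans {R V dX dY X Y psi phi} h v x z.
Arguments obs {R V dX dY X Y psi phi} h v x y.
Arguments trans_ge0 {R V dX dY X Y psi phi} h v x z.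
Arguments obs_ge0 {R V dX dY X Y psi phi} h v x y.
Arguments measurable_trans {R V dX dY X Y psi phi} h v.
Arguments measurable_obs {R V dX dY X Y psi phi} h v.
Arguments trans_density {R V dX dY X Y psi phi} h v x.
Arguments obs_density {R V dX dY X Y psi phi} h v x.

Section predict.
Context (R : realType) (V : finType) (dX dY : V -> measure_display)
  (X : forall v, measurableType (dX v)) (Y : forall v, measurableType (dY v))
  (psi : forall v, {sigma_finite_measure set (X v) -> \bar R})
  (phi : forall v, {sigma_finite_measure set (Y v) -> \bar R}).
Variable M : hmm psi phi.

Definition joint_trans (x z : prod_space X) : R := \prod_v trans M v x (z v).

Lemma joint_trans_ge0 x z : 0 <= joint_trans x z.
Proof. by apply: prodr_ge0 => v _; exact: trans_ge0. Qed.

Lemma measurable_joint_trans :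
  measurable_fun [set: prod_space X * prod_space X]%type
    (fun xz => joint_trans xz.1 xz.2).
Proof.
apply: measurable_prod => v _.
apply: (@measurableT_comp _ _ _ _ _ _
  (fun xz : prod_space X * X v => trans M v xz.1 xz.2) _
  (fun xz : prod_space X * prod_space X => (xz.1, xz.2 v))).
  exact: measurable_trans.
apply: measurable_fun_pair; first exact: measurable_fst.
apply: (@measurableT_comp _ _ _ _ _ _ (fun z : prod_space X => z v) _ snd).
  exact: measurable_coord.
exact: measurable_snd.
Qed.

Variable rho : probability (prod_space X) R.

Definition predict : set (prod_space X) -> \bar R :=
  fun A => (\int[rho]_x0 \int[prod_measure psi]_x
              ((\1_A x)%:E * (joint_trans x0 x)%:E))%E.

Let kernel_density (x0 : prod_space X) A :
  (\int[prod_measure psi]_x ((\1_A x)%:E * (joint_trans x0 x)%:E) =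
   \int[prod_measure psi]_(x in A) (joint_trans x0 x)%:E)%E.
Proof.
rewrite [RHS]integral_mkcond; apply: eq_integral => x _.
rewrite patchE indicE; case: ifP => _; first by rewrite mul1e.
by rewrite mul0e.
Qed.

Let measurable_section (x0 : prod_space X) :
  measurable_fun [set: prod_space X] (joint_trans x0).
Proof.
apply: (@measurableT_comp _ _ _ _ _ _
  (fun xz : prod_space X * prod_space X => joint_trans xz.1 xz.2) _
  (fun z => (x0, z))); first exact: measurable_joint_trans.
exact: measurable_fun_pair.
Qed.

Let predict0 : predict set0 = 0%E.
Proof.
rewrite /predict integral0_eq// => x0 _.
by rewrite kernel_density integral_set0.
Qed.

Let predict_ge0 A : (0 <= predict A)%E.
Proof.
apply: integral_ge0 => x0 _; apply: integral_ge0 => x _.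
by rewrite mule_ge0 ?lee_fin// joint_trans_ge0.
Qed.

Let predict_sigma_additive : semi_sigma_additive predict.
Proof.
move=> F mF tF mUF.
rewrite [X in _ --> X](_ : _ = \sum_(n <oo) predict (F n))%E.
  by apply/cvg_closeP; split; [exact: is_cvg_nneseries|rewrite closeE].
rewrite /predict -integral_nneseries//.
- apply: eq_integral => x0 _; rewrite kernel_density.
  have h := @semi_sigma_additive_nng_induced _ _ _ (prod_measure psi)
    (fun x => (joint_trans x0 x)%:E).
  rewrite -(cvg_lim _ (h _ _ _ mF tF mUF))//.
  + congr (limn _); apply/funext => n; apply: eq_bigr => k _.
    by rewrite kernel_density.
  + exact/measurable_EFinP.
  + by move=> x; rewrite lee_fin joint_trans_ge0.
- move=> n.
  apply: (@measurable_fun_fubini_tonelli_F _ _ (prod_space X) (prod_space X) R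
    (prod_measure psi)
    (fun xz => (\1_(F n) xz.2)%:E * (joint_trans xz.1 xz.2)%:E)%E).
  + apply: emeasurable_funM.
      have m1 : measurable_fun [set: prod_space X * prod_space X]%type
          ((\1_(F n) : prod_space X -> R) \o snd).
        apply: measurableT_comp; first exact: measurable_indic.
        exact: measurable_snd.
      exact/measurable_EFinP.
    by apply/measurable_EFinP; exact: measurable_joint_trans.
  + by move=> xz; rewrite mule_ge0 ?lee_fin// joint_trans_ge0.
- move=> n x0 _; apply: integral_ge0 => x _.
  by rewrite mule_ge0 ?lee_fin// joint_trans_ge0.
Qed.

HB.instance Definition _ := isMeasure.Build _ _ _ predict
  predict0 predict_ge0 predict_sigma_additive.

Let predict_setT : predict setT = 1%E.
Proof.
rewrite /predict (eq_integral (cst 1%E)) => [|x0 _].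
  by rewrite integral_cst//= probability_setT mule1.
rewrite kernel_density.
rewrite (eq_integral
  (fun x : prod_space X => (\prod_v (trans M v x0 (x v))%:E)%E)); last first.
  by move=> x _; rewrite /joint_trans prodEFin.
rewrite (@prod_measure_integral _ _ _ _ psi (fun v z => (trans M v x0 z)%:E)).
- by rewrite big1// => v _; exact: trans_density.
- move=> v; apply/measurable_EFinP.
  apply: (@measurableT_comp _ _ _ _ _ _
    (fun xz : prod_space X * X v => trans M v xz.1 xz.2) _
    (fun z => (x0, z))); first exact: measurable_trans.
  exact: measurable_fun_pair.
- by move=> v z; rewrite lee_fin trans_ge0.
Qed.

HB.instance Definition _ := Measure_isProbability.Build _ _ _
  predict predict_setT.

End predict.

Section filters.
Context (R : realType) (V : finType) (dX dY : V -> measure_display)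
  (X : forall v, measurableType (dX v)) (Y : forall v, measurableType (dY v))
  (psi : forall v, {sigma_finite_measure set (X v) -> \bar R})
  (phi : forall v, {sigma_finite_measure set (Y v) -> \bar R}).
Variables (M : hmm psi phi) (e : rel V) (b : {nonneg R}).
Variables (KK : {set {set V}}) (KK_part : finset.partition KK [set: V]%SET).

Local Notation XE := (enlarged_space X e b KK).

Definition enlarged_likelihood (y : prod_space Y) (x : XE) : R :=
  \prod_(K : block KK) \prod_(u : {v | v \in enlarge e b (val K)})
    obs M (val u) (x K u) (y (val u)).

Lemma enlarged_likelihood_ge0 y x : 0 <= enlarged_likelihood y x.
Proof.
by apply: prodr_ge0 => K _; apply: prodr_ge0 => u _; exact: obs_ge0.
Qed.

Lemma measurable_enlarged_likelihood y :
  measurable_fun setT (enlarged_likelihood y).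
Proof.
apply: measurable_prod => K _; apply: measurable_prod => u _.
apply: (@measurableT_comp _ _ _ _ _ _
  (fun z : X (val u) => obs M (val u) z (y (val u))) _
  (fun x : XE => x K u)).
  apply: (@measurableT_comp _ _ _ _ _ _
    (fun zy : X (val u) * Y (val u) => obs M (val u) zy.1 zy.2) _
    (fun z => (z, y (val u)))); first exact: measurable_obs.
  exact: measurable_fun_pair.
apply: (@measurableT_comp _ _ _ _ _ _
  (fun z : sub_space X (enlarge e b (val K)) => z u) _ (fun x : XE => x K));
  exact: measurable_coord.
Qed.

(* C^E, for the observation [y] *)
Definition block_correct (y : prod_space Y) (nu : probability XE R) :
    probability XE R :=
  reweight nu (measurable_enlarged_likelihood y) (enlarged_likelihood_ge0 y).

Definition block_update (y : prod_space Y)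
    (rho : probability (prod_space X) R) :
    probability (prod_space X) R :=
  block_restore KK_part (block_correct y (block_enlarge e b KK rho)).

Variables (y : nat -> prod_space Y) (mu : probability (prod_space X) R).

Fixpoint ideal_filter (n : nat) : probability (prod_space X) R :=
  if n is n'.+1 then block_update (y n) (predict M (ideal_filter n')) else mu.

Context (dO : measure_display) (Omega : measurableType dO)
  (Pr : probability Omega R).
Variables (N : nat) (N_gt0 : (0 < N)%N)
  (xi : nat -> 'I_N -> {mfun Omega >-> prod_space X}).

(* [xi n i] is the i-th particle drawn at time n >= 1, and [xi 0] is unused.
   The sampling operator turns the prediction of the filter at time n-1 into
   the empirical measure of the [xi n i]; their law, hence the dependence on
   the filter at time n-1, is prescribed by [conditionally_sampled]. *)
Definition particle_filter (n : nat) (w : Omega) :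
    probability (prod_space X) R :=
  if n is _.+1 then
    block_update (y n) (empirical_measure R (fun i => xi n i w) N_gt0)
  else mu.

(* The sigma-algebra generated by the particles drawn at times 1, .., n *)
Definition past (n : nat) : set (set Omega) :=
  <<s [set A | exists k (i : 'I_N) B,
    [/\ (0 < k <= n)%N, measurable B & A = xi k i @^-1` B] ] >>.

(* Given the past, the particles at time n+1 are i.i.d. with law the prediction
   from the current filter. *)
Definition conditionally_sampled : Prop :=
  forall n (A : set Omega) (B : 'I_N -> set (prod_space X)),
    past n A -> (forall i, measurable (B i)) ->
    Pr (A `&` [set w | forall i, B i (xi n.+1 i w)]) =
    (\int[Pr]_(w in A)
       \prod_(i < N) predict M (particle_filter n w) (B i))%E.

End filters.

Section local_distance.
Context (R : realType) (V : finType) (d : V -> measure_display)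
  (X : forall v, measurableType (d v)).

Definition depends_on (I : {set V}) (f : prod_space X -> R) : Prop :=
  forall x x', (forall v, v \in I -> x v = x' v) -> f x = f x'.

Definition local_dist (dO : measure_display) (Omega : measurableType dO)
    (Pr : probability Omega R) (I : {set V})
    (rho nu : Omega -> probability (prod_space X) R) : \bar R :=
  ereal_sup [set ((\int[Pr]_w
      (`|Rintegral (rho w) setT f - Rintegral (nu w) setT f| ^+ 2)%:E)
        `^ 2^-1)%E
    | f in [set f : prod_space X -> R |
        [/\ measurable_fun setT f, (forall x, `|f x| <= 1) & depends_on I f]]].

End local_distance.

(* Main.v *)
Require Import Defs.
From HB Require Import structures.
From mathcomp Require Import all_boot all_order all_algebra.
From mathcomp Require Import all_classical all_reals all_analysis.
From mathcomp Require Import measurable_realfun.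
From mathcomp Require Import ring lra.
Set Implicit Arguments.
Unset Strict Implicit.
Unset Printing Implicit Defensive.
Import Order.TTheory GRing.Theory Num.Theory.
Import numFieldNormedType.Exports.
Local Open Scope classical_set_scope.
Local Open Scope ring_scope.

(** Both filters alternate a prediction, a correction on enlarged blocks and a
projection to a product over blocks; the particle filter in addition replaces the
prediction by an empirical measure. Restart the ideal filter from the particle
filter at every time: the difference of the two filters at time [n] telescopes
into the contributions of the single sampling steps ([filter_error_telescopes]),
and the theorem follows from a geometric bound on these contributions in mean
square, conditionally on the past.

For a single sampling step, the reweighted empirical measures of the different
blocks are built from the same particles, hence dependent. Still, the bias of a
self-normalised sample is O(1/N), even for test functions that depend weakly on
the sample ([weighted_sample_bias]), and the mean square of the error is the bias
for the test function multiplied by the error itself. Replacing the blocks one at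
a time gives an error proportional to the number of blocks that the test function
depends on ([sampling_second_moment]). For a product of transition densities in
[[a, 1]], with [a = eps ^+ 2], each factor counts only with the weight [1 - a]
([sampling_factors]).

For the propagation of errors, the ideal dynamics is unrolled in space and time.
A block of the filter at time [n] reads the blocks near its enlarged block one
step earlier, where the blocks are independent; so its law is the law at the root of a
Gibbs measure on a tree of blocks whose leaves carry the block laws of an earlier
time ([tree_root_ex]). The local factors are close to one, so Dobrushin's
comparison theorem applies: by heat-bath updates along a potential that decays by
the factor [2 * Delta ^+ 2 * (1 - eps ^+ 2)] per generation, an observable at the
root is nearly insensitive to the law of any given leaf ([dobrushin_comparison],
[root_observable_stable]). The error sits at the leaves only after one more
prediction, where the sampled and the exact law have densities; the Cauchy-Schwarz
inequality bounds the effect of changing one leaf by the mean square distance of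
these densities ([single_law_change]), which the first part controls. Each
generation multiplies the number of leaves by at most the degree of the enlarged
blocks, and the threshold on [eps] makes the decay of the potential win
([sampled_forgetting], [contraction_factor]).

What remains is to identify the operators of the model. Transition densities
integrate to one, so sites outside an enlarged block drop out of its correction
([ex_predict_hood], [posterior_step]), and the correction on the enlarged product
acts on every copy separately ([ex_block_update]). The conditional law of the new
particles, prescribed on rectangles, determines their joint law with the old ones
([ex_sampled]). *)

(** * Expectations of bounded functions *)

Section bounded_measurable.
Context d (T : measurableType d) (R : realType).
Implicit Types f g : T -> R.

Definition bmeas f : Prop :=
  measurable_fun setT f /\ exists C, forall x, `|f x| <= C.

Lemma bmeasP f C : measurable_fun setT f -> (forall x, `|f x| <= C) -> bmeas f.
Proof. by move=> mf fC; split=> //; exists C. Qed.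

Lemma bmeas_measurable f : bmeas f -> measurable_fun setT f.
Proof. by case. Qed.

Lemma eq_bmeas f g : f =1 g -> bmeas f -> bmeas g.
Proof. by move=> /funext ->. Qed.

Lemma bmeas_cst c : bmeas (fun=> c).
Proof. by apply: (@bmeasP _ `|c|). Qed.

Lemma bmeasD f g : bmeas f -> bmeas g -> bmeas (fun x => f x + g x).
Proof.
move=> [mf [C fC]] [mg [C' gC]]; apply: (@bmeasP _ (C + C')).
  exact: measurable_funD.
by move=> x; rewrite (le_trans (ler_normD _ _))// lerD.
Qed.

Lemma bmeasN f : bmeas f -> bmeas (fun x => - f x).
Proof.
move=> [mf [C fC]]; apply: (@bmeasP _ C); last by move=> x; rewrite normrN.
exact: measurableT_comp.
Qed.

Lemma bmeasB f g : bmeas f -> bmeas g -> bmeas (fun x => f x - g x).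
Proof. by move=> bf bg; apply: bmeasD => //; exact: bmeasN. Qed.

Lemma bmeasM f g : bmeas f -> bmeas g -> bmeas (fun x => f x * g x).
Proof.
move=> [mf [C fC]] [mg [C' gC]]; apply: (@bmeasP _ (C * C')).
  exact: measurable_funM.
by move=> x; rewrite normrM ler_pM.
Qed.

Lemma bmeasZ c f : bmeas f -> bmeas (fun x => c * f x).
Proof. by move=> bf; apply: bmeasM => //; exact: bmeas_cst. Qed.

Lemma bmeas_norm f : bmeas f -> bmeas (fun x => `|f x|).
Proof.
move=> [mf [C fC]]; apply: (@bmeasP _ C); last by move=> x; rewrite normr_id.
exact: measurableT_comp.
Qed.

Lemma bmeasX f n : bmeas f -> bmeas (fun x => f x ^+ n).
Proof.
move=> bf; elim: n => [|n IHn]; first exact: bmeas_cst.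
apply: (@eq_bmeas (fun x => f x * f x ^+ n)); last exact: bmeasM.
by move=> x; rewrite exprS.
Qed.

Lemma bmeas_sum (I : Type) (s : seq I) (P : pred I) (h : I -> T -> R) :
  (forall i, P i -> bmeas (h i)) -> bmeas (fun x => \sum_(i <- s | P i) h i x).
Proof.
move=> bh; elim: s => [|i s IHs].
  by apply: (eq_bmeas _ (bmeas_cst 0)) => x; rewrite big_nil.
have [Pi|Pi] := boolP (P i).
  apply: (eq_bmeas _ (bmeasD (bh _ Pi) IHs)) => x.
  by rewrite big_cons Pi.
by apply: (eq_bmeas _ IHs) => x; rewrite big_cons (negbTE Pi).
Qed.

Lemma bmeas_prod (I : Type) (s : seq I) (P : pred I) (h : I -> T -> R) :
  (forall i, P i -> bmeas (h i)) -> bmeas (fun x => \prod_(i <- s | P i) h i x).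
Proof.
move=> bh; elim: s => [|i s IHs].
  by apply: (eq_bmeas _ (bmeas_cst 1)) => x; rewrite big_nil.
have [Pi|Pi] := boolP (P i).
  apply: (eq_bmeas _ (bmeasM (bh _ Pi) IHs)) => x.
  by rewrite big_cons Pi.
by apply: (eq_bmeas _ IHs) => x; rewrite big_cons (negbTE Pi).
Qed.

Lemma bmeas_indic (A : set T) : measurable A -> bmeas (\1_A : T -> R).
Proof.
move=> mA; apply: (@bmeasP _ 1); first exact: measurable_indic.
by move=> x; rewrite indicE; case: (_ \in _); rewrite ?normr1 ?normr0.
Qed.

Lemma measurable_inv f : measurable_fun setT f -> (forall x, 0 < f x) ->
  measurable_fun setT (fun x => (f x)^-1).
Proof.
move=> mf f0; rewrite (_ : (fun _ => _) = (fun x => f x `^ (-1))).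
  exact: (@measurableT_comp _ _ _ _ _ _ (fun y : R => y `^ (-1)) _ f).
by apply/funext => x; rewrite powR_inv1// ltW.
Qed.

Lemma bmeasV f c : 0 < c -> bmeas f -> (forall x, c <= f x) ->
  bmeas (fun x => (f x)^-1).
Proof.
move=> c0 [mf _] fc; have f0 x : 0 < f x by apply: lt_le_trans (fc x).
apply: (@bmeasP _ c^-1); first exact: measurable_inv.
by move=> x; rewrite normfV gtr0_norm// lef_pV2// posrE.
Qed.

End bounded_measurable.

Lemma bmeas_comp d d' (T : measurableType d) (T' : measurableType d')
    (R : realType) (f : T' -> R) (g : T -> T') :
  bmeas f -> measurable_fun setT g -> bmeas (fun x => f (g x)).
Proof.
move=> [mf [C fC]] mg; apply: (@bmeasP _ _ _ _ C) => //.
exact: measurableT_comp mf mg.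
Qed.

Section expectation.
Context d (T : measurableType d) (R : realType) (P : probability T R).
Implicit Types f g : T -> R.

Lemma bmeas_integrable f : bmeas f -> P.-integrable setT (EFin \o f).
Proof.
move=> [mf [C fC]]; apply: measurable_bounded_integrable => //.
  by rewrite (le_lt_trans (probability_le1 _ _)) ?ltry.
exists C; split; first exact: num_real.
by move=> M CM x _; apply: (le_trans (fC x)); exact: ltW.
Qed.

Lemma EFin_ex f : bmeas f -> (\int[P]_x f x)%:E = (\int[P]_x (f x)%:E)%E.
Proof.
by move=> bf; rewrite /Rintegral fineK//; exact/integrable_fin_num/bmeas_integrable.
Qed.

Lemma ex_cst c : \int[P]_x c = c.
Proof. by rewrite Rintegral_cst//= probability_setT mulr1. Qed.

Lemma exD f g : bmeas f -> bmeas g ->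
  \int[P]_x (f x + g x) = \int[P]_x f x + \int[P]_x g x.
Proof. by move=> bf bg; rewrite RintegralD//; exact: bmeas_integrable. Qed.

Lemma exB f g : bmeas f -> bmeas g ->
  \int[P]_x (f x - g x) = \int[P]_x f x - \int[P]_x g x.
Proof. by move=> bf bg; rewrite RintegralB//; exact: bmeas_integrable. Qed.

Lemma exZl c f : bmeas f -> \int[P]_x (c * f x) = c * \int[P]_x f x.
Proof. by move=> bf; rewrite RintegralZl//; exact: bmeas_integrable. Qed.

Lemma exZr c f : bmeas f -> \int[P]_x (f x * c) = \int[P]_x f x * c.
Proof. by move=> bf; rewrite RintegralZr//; exact: bmeas_integrable. Qed.

Lemma ex_sum (I : Type) (s : seq I) (Q : pred I) (h : I -> T -> R) :
  (forall i, Q i -> bmeas (h i)) ->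
  \int[P]_x (\sum_(i <- s | Q i) h i x) = \sum_(i <- s | Q i) \int[P]_x h i x.
Proof.
move=> bh; elim: s => [|i s IHs].
  by under eq_Rintegral do rewrite big_nil; rewrite ex_cst big_nil.
under eq_Rintegral do rewrite big_cons.
rewrite big_cons; case: ifPn => // Qi; rewrite exD ?IHs//; try exact: bh.
exact: bmeas_sum.
Qed.

Lemma eq_ex f g : f =1 g -> \int[P]_x f x = \int[P]_x g x.
Proof. by move=> /funext ->. Qed.

Lemma ler_ex f g : bmeas f -> bmeas g -> (forall x, f x <= g x) ->
  \int[P]_x f x <= \int[P]_x g x.
Proof.
by move=> bf bg fg; apply: le_Rintegral => //; exact: bmeas_integrable.
Qed.

Lemma ex_ge c f : bmeas f -> (forall x, c <= f x) -> c <= \int[P]_x f x.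
Proof. by move=> bf cf; rewrite -[leLHS]ex_cst ler_ex//; exact: bmeas_cst. Qed.

Lemma ex_le c f : bmeas f -> (forall x, f x <= c) -> \int[P]_x f x <= c.
Proof. by move=> bf cf; rewrite -[leRHS]ex_cst ler_ex//; exact: bmeas_cst. Qed.

Lemma ler_norm_ex f : bmeas f -> `|\int[P]_x f x| <= \int[P]_x `|f x|.
Proof. by move=> bf; apply: le_normr_Rintegral => //; exact: bmeas_integrable. Qed.

Lemma norm_ex_le c f : bmeas f -> (forall x, `|f x| <= c) ->
  `|\int[P]_x f x| <= c.
Proof.
move=> bf fc; rewrite (le_trans (ler_norm_ex bf))// ex_le//.
exact: bmeas_norm.
Qed.

Lemma ex_indic (A : set T) : measurable A -> \int[P]_x \1_A x = fine (P A).
Proof. by move=> mA; rewrite /Rintegral integral_indic// setIT. Qed.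

(** Minkowski's inequality in mean square, with bounds in place of the norms so
that no square root occurs. *)
Lemma ex_sqrD (a b : R) f g : bmeas f -> bmeas g -> 0 <= a -> 0 <= b ->
  \int[P]_x f x ^+ 2 <= a ^+ 2 -> \int[P]_x g x ^+ 2 <= b ^+ 2 ->
  \int[P]_x (f x + g x) ^+ 2 <= (a + b) ^+ 2.
Proof.
move=> bf bg a0 b0 fa gb.
(* Shifting both bounds by a positive amount makes the weights a and b
   of the pointwise inequality invertible. *)
suff H t : 0 < t -> \int[P]_x (f x + g x) ^+ 2 <= (a + t + (b + t)) ^+ 2.
  have c0 : 0 <= \int[P]_x (f x + g x) ^+ 2.
    by apply: Rintegral_ge0 => x _; exact: sqr_ge0.
  rewrite -(sqr_sqrtr c0) lerXn2r ?nnegrE ?addr_ge0 ?sqrtr_ge0//.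
  apply/ler_addgt0Pr => t t0.
  have t20 : 0 < t / 2 by rewrite divr_gt0.
  have := H _ t20; rewrite -{1}(sqr_sqrtr c0) ler_sqr ?nnegrE ?sqrtr_ge0//.
    by move/le_trans; apply; rewrite le_eqVlt; apply/orP; left; apply/eqP; field.
  by rewrite !addr_ge0// ltW.
move=> t0; set a' := a + t; set b' := b + t.
have a'0 : 0 < a' by rewrite ltr_wpDl.
have b'0 : 0 < b' by rewrite ltr_wpDl.
have fa' : \int[P]_x f x ^+ 2 <= a' ^+ 2.
  by rewrite (le_trans fa)// lerXn2r ?nnegrE ?(ltW a'0)// lerDl ltW.
have gb' : \int[P]_x g x ^+ 2 <= b' ^+ 2.
  by rewrite (le_trans gb)// lerXn2r ?nnegrE ?(ltW b'0)// lerDl ltW.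
have bf2 := bmeasX 2 bf; have bg2 := bmeasX 2 bg.
apply: (@le_trans _ _ (\int[P]_x
    ((1 + b' / a') * f x ^+ 2 + (1 + a' / b') * g x ^+ 2))).
  apply: ler_ex => [||x].
  - by apply: bmeasX; exact: bmeasD.
  - by apply: bmeasD; exact: bmeasZ.
  - rewrite -subr_ge0 [leRHS](_ : _ = (b' * f x - a' * g x) ^+ 2 / (a' * b')).
      by rewrite divr_ge0 ?sqr_ge0// mulr_ge0 ?ltW.
    by field; rewrite !gt_eqF.
rewrite exD ?exZl//; try exact: bmeasZ.
apply: (@le_trans _ _ ((1 + b' / a') * a' ^+ 2 + (1 + a' / b') * b' ^+ 2)).
  by apply: lerD; rewrite ler_wpM2l// addr_ge0// divr_ge0 ?ltW.
by rewrite le_eqVlt; apply/orP; left; apply/eqP; field; rewrite !gt_eqF.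
Qed.

Lemma ex_sqr_sum (I : Type) (s : seq I) (h : I -> T -> R) (a : I -> R) :
  (forall i, bmeas (h i)) -> (forall i, 0 <= a i) ->
  (forall i, \int[P]_x h i x ^+ 2 <= a i ^+ 2) ->
  \int[P]_x (\sum_(i <- s) h i x) ^+ 2 <= (\sum_(i <- s) a i) ^+ 2.
Proof.
move=> bh a0 ha; elim: s => [|i s IHs].
  by under eq_Rintegral do rewrite big_nil expr0n/=; rewrite ex_cst big_nil expr0n.
under eq_Rintegral do rewrite big_cons; rewrite big_cons.
apply: ex_sqrD => //; last exact: sumr_ge0.
by apply: bmeas_sum.
Qed.

Lemma ex_sqrZ (c a : R) f : bmeas f -> \int[P]_x f x ^+ 2 <= a ^+ 2 ->
  \int[P]_x (c * f x) ^+ 2 <= (c * a) ^+ 2.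
Proof.
move=> bf fa; under eq_Rintegral do rewrite exprMn.
rewrite exZl; last exact: bmeasX.
by rewrite exprMn ler_wpM2l ?sqr_ge0.
Qed.

Lemma ex_cauchy_schwarz (w f : T -> R) : bmeas w -> bmeas f ->
  (forall x, 0 <= w x) -> 0 < \int[P]_x w x ->
  (\int[P]_x (w x * f x)) ^+ 2 <= \int[P]_x w x * \int[P]_x (w x * f x ^+ 2).
Proof.
move=> bw bf w0 Ew; have bf2 := bmeasX 2 bf.
have bwf : bmeas (fun x => w x * f x) by exact: bmeasM.
have bwf2 : bmeas (fun x => w x * f x ^+ 2) by exact: bmeasM.
set W := \int[P]_x w x in Ew *; pose t := (\int[P]_x (w x * f x)) / W.
have : 0 <= \int[P]_x (w x * f x ^+ 2 - 2 * t * (w x * f x) + t ^+ 2 * w x).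
  apply: Rintegral_ge0 => x _; rewrite [leRHS](_ : _ = w x * (f x - t) ^+ 2).
    by rewrite mulr_ge0// sqr_ge0.
  by ring.
rewrite exD; last 2 first.
- by apply: bmeasB => //; exact: bmeasZ.
- exact: bmeasZ.
rewrite exB//; last exact: bmeasZ.
rewrite !exZl// -/W /t.
move: (\int[P]_x (w x * f x)) (\int[P]_x (w x * f x ^+ 2)) => A B.
rewrite (_ : _ - _ + _ = B - A ^+ 2 / W); last by field; rewrite gt_eqF.
by rewrite subr_ge0 ler_pdivrMr// mulrC.
Qed.

End expectation.

Section eq_measures.
Context d (T : measurableType d) (R : realType).

Definition meq (P Q : probability T R) := forall A, measurable A -> P A = Q A.

Lemma meq_ex (P Q : probability T R) (f : T -> R) : meq P Q ->
  \int[P]_x f x = \int[Q]_x f x.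
Proof.
by move=> PQ; congr fine; apply: eq_measure_integral => A mA _; exact: PQ.
Qed.

Lemma ex_meq (P Q : probability T R) :
  (forall f, bmeas f -> \int[P]_x f x = \int[Q]_x f x) -> meq P Q.
Proof.
move=> PQ A mA; have := PQ _ (bmeas_indic R mA); rewrite !ex_indic// => H.
by rewrite -(fineK (fin_num_measure P A mA)) H fineK// fin_num_measure.
Qed.

End eq_measures.

Section transfer.
Context d d' (T : measurableType d) (T' : measurableType d') (R : realType).

Lemma ex_distribution (P : probability T R) (X : {mfun T >-> T'}) (f : T' -> R) :
  bmeas f -> \int[distribution P X]_y f y = \int[P]_x f (X x).
Proof.
move=> bf; rewrite /Rintegral integral_distribution//.
  by apply/measurable_EFinP; case: bf.
apply: (bmeas_integrable P (f := fun x => f (X x))).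
by apply: bmeas_comp bf _; exact: measurable_funPT.
Qed.

Lemma ex_distribution_set (P : probability T R) (X : T -> T')
    (mX : measurable_fun setT X) (Q : probability T' R) :
  (forall A, measurable A -> Q A = P (X @^-1` A)) ->
  forall f, bmeas f -> \int[Q]_y f y = \int[P]_x f (X x).
Proof.
move=> QP f bf.
pose X' : {mfun T >-> T'} := HB.pack X (isMeasurableFun.Build _ _ _ _ X mX).
rewrite -(ex_distribution P X' bf); apply: meq_ex => A mA.
by rewrite QP.
Qed.

End transfer.

Section fubini_expectation.
Context d1 d2 (T1 : measurableType d1) (T2 : measurableType d2) (R : realType).
Implicit Type F : T1 * T2 -> R.

Lemma bmeas_sec1 F x : bmeas F -> bmeas (fun y => F (x, y)).
Proof. by move=> bF; apply: bmeas_comp bF _; exact: measurable_fun_pair. Qed.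

Lemma bmeas_sec2 F y : bmeas F -> bmeas (fun x => F (x, y)).
Proof. by move=> bF; apply: bmeas_comp bF _; exact: measurable_fun_pair. Qed.

Lemma bmeas_ex2 (P2 : probability T2 R) F : bmeas F ->
  bmeas (fun x => \int[P2]_y F (x, y)).
Proof.
move=> bF; have [mF [C FC]] := bF.
have iF := bmeas_integrable (\d_(point : T1) \x P2)%E bF.
have := measurable_fubini_F iF; rewrite /fubini_F => mG.
apply: (@bmeasP _ _ _ _ C).
  apply/measurable_EFinP; rewrite [X in measurable_fun _ X](_ : _ =
    (fun x => \int[P2]_y (EFin \o F) (x, y))%E)//.
  by apply/funext => x; rewrite /= EFin_ex//; exact: bmeas_sec1.
by move=> x; apply: norm_ex_le => //; exact: bmeas_sec1.
Qed.

Lemma bmeas_ex1 (P1 : probability T1 R) F : bmeas F ->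
  bmeas (fun y => \int[P1]_x F (x, y)).
Proof.
move=> bF; have [mF [C FC]] := bF.
have iF := bmeas_integrable (P1 \x \d_(point : T2))%E bF.
have := measurable_fubini_G iF; rewrite /fubini_G => mG.
apply: (@bmeasP _ _ _ _ C).
  apply/measurable_EFinP; rewrite [X in measurable_fun _ X](_ : _ =
    (fun y => \int[P1]_x (EFin \o F) (x, y))%E)//.
  by apply/funext => x; rewrite /= EFin_ex//; exact: bmeas_sec2.
by move=> x; apply: norm_ex_le => //; exact: bmeas_sec2.
Qed.

Variables (P1 : probability T1 R) (P2 : probability T2 R).

Lemma ex_fubini1 F : bmeas F ->
  \int[(P1 \x P2)%E]_z F z = \int[P1]_x \int[P2]_y F (x, y).
Proof.
move=> bF; have iF := bmeas_integrable (P1 \x P2)%E bF.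
rewrite /Rintegral -[in LHS]/(EFin \o F).
rewrite -(integral12_prod_meas1 iF); congr fine; apply: eq_integral => x _.
by rewrite /fubini_F/= -EFin_ex//; exact: bmeas_sec1.
Qed.

Lemma ex_fubini F : bmeas F ->
  \int[P1]_x \int[P2]_y F (x, y) = \int[P2]_y \int[P1]_x F (x, y).
Proof.
move=> bF; have iF := bmeas_integrable (P1 \x P2)%E bF.
have := Fubini iF; rewrite /fubini_F /fubini_G /Rintegral => H.
rewrite (eq_integral (fun x => \int[P2]_y (EFin \o F) (x, y))%E); last first.
  by move=> x _; rewrite -EFin_ex//; exact: bmeas_sec1.
rewrite H; congr fine; apply: eq_integral => y _.
by rewrite -EFin_ex//; exact: bmeas_sec2.
Qed.

End fubini_expectation.

(** * Reweighted laws and empirical measures *)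

Section density_integral.
Context d (T : measurableType d) (R : realType).
Variables (m : {measure set T -> \bar R}) (h : T -> R).
Hypotheses (mh : measurable_fun setT h) (h0 : forall x, 0 <= h x).
Import HBNNSimple.

(** The usual climb from indicators through simple functions to nonnegative
functions by monotone convergence. *)
Lemma ge0_integral_density (f : T -> \bar R) : measurable_fun setT f ->
  (forall x, 0 <= f x)%E ->
  (\int[density_measure m mh h0]_x f x = \int[m]_x (f x * (h x)%:E))%E.
Proof.
move=> mf f0.
have mhE : measurable_fun setT (EFin \o h) by exact/measurable_EFinP.
pose f_ := nnsfun_approx measurableT mf.
transitivity (limn (fun n => \int[density_measure m mh h0]_x (f_ n x)%:E)%E).
  rewrite -monotone_convergence//.
  - apply: eq_integral => y _; apply/esym/cvg_lim => //.
    by apply: cvg_nnsfun_approx.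
  - by move=> n; exact/measurable_EFinP/measurable_funP.
  - by move=> n y _; rewrite lee_fin.
  - by move=> y _ k n kn; rewrite lee_fin; exact/lefP/nd_nnsfun_approx.
rewrite [X in limn X](_ : _ =
    (fun n => \int[m]_x ((f_ n x)%:E * (h x)%:E))%E).
  rewrite -monotone_convergence//; last 3 first.
  - by move=> n /=; apply: emeasurable_funM => //; exact/measurable_EFinP/measurable_funP.
  - by move=> n x _; rewrite mule_ge0 ?lee_fin.
  - move=> x _ k n kn; rewrite lee_wpmul2r ?lee_fin//.
    exact/lefP/nd_nnsfun_approx.
  apply: eq_integral => x _; apply/cvg_lim => //.
  apply: cvgeZr => //.
  by apply: cvg_nnsfun_approx.
apply/funext => n.
have mset (k : R) : measurable (f_ n @^-1` [set k]) by exact: measurable_sfunP.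
transitivity (\sum_(k \in range (f_ n))
    \int[m]_x ((k * \1_(f_ n @^-1` [set k]) x)%:E * (h x)%:E))%E.
  under eq_integral do rewrite fimfunE -fsumEFin//.
  rewrite ge0_integral_fsum//; last 2 first.
  - by move=> y; exact/measurable_EFinP/measurable_funM.
  - by move=> y x _; rewrite nnfun_muleindic_ge0.
  apply: eq_fsbigr => k _; rewrite integralZl_indic_nnsfun// integral_indic//=.
  rewrite setIT /density_measure.
  have [k0|k0] := leP 0 k; last first.
    rewrite preimage_nnfun0// integral_set0 mule0.
    by rewrite integral0_eq// => x _; rewrite indic0 mulr0 mul0e.
  rewrite -ge0_integralZl//; first last.
  - by move=> x _; rewrite lee_fin.
  - exact: measurable_funTS.
  rewrite integral_mkcond; apply: eq_integral => x _; rewrite patchE indicE.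
  by case: ifPn; rewrite ?mulr1 ?mulr0 ?mul0e.
rewrite -ge0_integral_fsum//.
- apply: eq_integral => x _.
  rewrite -ge0_mule_fsuml; last by move=> k; rewrite nnfun_muleindic_ge0.
  by rewrite fsumEFin// -fimfunE.
- move=> k; apply: emeasurable_funM => //.
  by apply/measurable_EFinP; exact: measurable_funM.
- by move=> k x _; rewrite mule_ge0 ?lee_fin// -lee_fin nnfun_muleindic_ge0.
Qed.

End density_integral.

Section reweight_expectation.
Context d (T : measurableType d) (R : realType).
Variables (m : probability T R) (h : T -> R).
Hypotheses (mh : measurable_fun setT h) (h0 : forall x, 0 <= h x).

Lemma reweightE A : bmeas h -> 0 < \int[m]_x h x -> measurable A ->
  reweight m mh h0 A = ((\int[m]_x (\1_A x * h x)) / \int[m]_x h x)%:E.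
Proof.
move=> bh mh0 mA.
have mT : (density_measure m mh h0 : {measure set T -> \bar R}) setT =
    (\int[m]_x h x)%:E.
  by rewrite /= /density_measure EFin_ex.
rewrite /reweight/= /mnormalize mT.
rewrite eqe gt_eqF//= /density_measure EFinM; congr (_ * _)%E.
rewrite EFin_ex; last by apply: bmeasM => //; exact: bmeas_indic.
rewrite integral_mkcond; apply: eq_integral => x _; rewrite patchE indicE.
by case: ifPn; rewrite ?mul1r ?mul0r.
Qed.

Lemma ex_reweight f : bmeas h -> 0 < \int[m]_x h x -> bmeas f ->
  \int[reweight m mh h0]_x f x = (\int[m]_x (f x * h x)) / \int[m]_x h x.
Proof.
move=> bh mh0 bf; set Z := \int[m]_x h x in mh0 *.
have Z0 : 0 <= Z^-1 by rewrite invr_ge0 ltW.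
wlog f0 : f bf / forall x, 0 <= f x.
  move=> wlg; have [mf [C fC]] := bf.
  have C0 x : 0 <= f x + C.
    by rewrite -lerBlDr sub0r; have := fC x; rewrite ler_norml => /andP[].
  have bC := bmeas_cst T C.
  have /wlg/(_ C0) : bmeas (fun x => f x + C) by exact: bmeasD.
  rewrite exD// ex_cst => H.
  have E1 : \int[m]_x ((f x + C) * h x) = \int[m]_x (f x * h x) + C * Z.
    rewrite -exZl// -exD//; [|exact: bmeasM|exact: bmeasZ].
    by apply: eq_ex => x; rewrite mulrDl.
  apply: (@addIr _ C); rewrite H E1 mulrDl mulfK// gt_eqF//.
have bfh : bmeas (fun x => f x * h x) by exact: bmeasM.
rewrite {1}/Rintegral.
have mscaleE : (\int[reweight m mh h0]_x (f x)%:E =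
    \int[mscale (NngNum Z0) (density_measure m mh h0)]_x (f x)%:E)%E.
  apply: eq_measure_integral => A mA _.
  transitivity ((\int[m]_x (\1_A x * h x)) / Z)%:E; first exact: reweightE.
  rewrite /= /mscale/= /density_measure muleC.
  rewrite EFinM; congr (_ * _)%E.
  rewrite EFin_ex; last by apply: bmeasM => //; exact: bmeas_indic.
  rewrite [RHS]integral_mkcond; apply: eq_integral => x _; rewrite patchE indicE.
  by case: ifPn; rewrite ?mul1r ?mul0r.
rewrite mscaleE ge0_integral_mscale//; last 2 first.
- by apply/measurable_EFinP; case: bf.
- by move=> x _; rewrite lee_fin.
rewrite ge0_integral_density//; last by apply/measurable_EFinP; case: bf.
rewrite -[(\int[m]_x _)%E]/(\int[m]_x ((f x * h x)%:E))%E -EFin_ex//=.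
by rewrite mulrC.
Qed.

End reweight_expectation.

Lemma ex_dirac d (T : measurableType d) (R : realType) (a : T) (f : T -> R) :
  bmeas f -> \int[(\d_a : probability T R)]_x f x = f a.
Proof.
move=> [mf _]; rewrite /Rintegral integral_dirac//=; last exact/measurable_EFinP.
by rewrite indicE in_setT mul1r.
Qed.

Lemma ex_empirical d (T : measurableType d) (R : realType) (N : nat)
    (x : 'I_N -> T) (N_gt0 : (0 < N)%N) (f : T -> R) : bmeas f ->
  \int[empirical_measure R x N_gt0]_t f t = N%:R^-1 * \sum_(i < N) f (x i).
Proof.
move=> bf.
wlog f0 : f bf / forall x, 0 <= f x.
  move=> wlg; have [mf [C fC]] := bf.
  have C0 t : 0 <= f t + C.
    by rewrite -lerBlDr sub0r; have := fC t; rewrite ler_norml => /andP[].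
  have bC := bmeas_cst T C.
  have /wlg/(_ C0) : bmeas (fun t => f t + C) by exact: bmeasD.
  rewrite exD// ex_cst big_split/= sumr_const card_ord mulrDr => H.
  apply: (@addIr _ C); rewrite H; congr (_ + _).
  rewrite -(mulr_natr C N) mulrCA mulVf ?mulr1//.
  by rewrite pnatr_eq0 -lt0n.
have mf : measurable_fun setT (EFin \o f) by apply/measurable_EFinP; case: bf.
pose i0 := Ordinal N_gt0.
pose m : nat -> {measure set T -> \bar R} := fun k => \d_(x (insubd i0 k)).
have N_ge0 : 0 <= N%:R^-1 :> R by rewrite invr_ge0.
rewrite /Rintegral.
have -> : (\int[empirical_measure R x N_gt0]_t (f t)%:E =
    \int[mscale (NngNum N_ge0) (msum m N)]_t (f t)%:E)%E.
  apply: eq_measure_integral => A mA _.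
  rewrite /empirical_measure /mscale /msum/=; congr (_ * _)%E.
  by apply: eq_bigr => i _; rewrite /m /insubd valK.
rewrite ge0_integral_mscale//; last by move=> t _; rewrite lee_fin.
rewrite ge0_integral_measure_sum//; last by move=> t _; rewrite lee_fin.
rewrite (eq_bigr (fun i : 'I_N => (f (x i))%:E)) => [|i _]; last first.
  by rewrite integral_dirac//= diracT mul1e /insubd valK.
by rewrite sumEFin.
Qed.

(** * Product measures and resampling *)

Section box_uniqueness.
Context (R : realType) (I : finType) (d : I -> measure_display)
  (T : forall i, measurableType (d i)).

(** Boxes are stable under intersection and generate the product sigma-algebra. *)
Lemma box_unique (m1 m2 : {measure set (prod_space T) -> \bar R}) :
  (m1 setT < +oo)%E ->
  (forall A, (forall i, measurable (A i)) -> m1 (box A) = m2 (box A)) ->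
  forall A, measurable A -> m1 A = m2 A.
Proof.
move=> m1oo m12 A mA.
pose G := [set B | exists2 C : forall i, set (T i),
  forall i, measurable (C i) & B = box C].
apply: (measure_unique G (fun=> setT)) => //.
- rewrite eqEsubset; split; apply: smallest_sub.
  + exact: smallest_sigma_algebra.
  + move=> _ [i _ [B mB <-]]; apply: sub_sigma_algebra.
    exists (dfwith (fun j => setT) i B) => [j|].
      by case: dfwithP.
    rewrite setTI; apply/seteqP; split => [x Bx j|x /(_ i)].
      by case: dfwithP.
    by rewrite dfwithin.
  + exact: sigma_algebra_measurable.
  + by move=> _ [C mC ->]; exact: measurable_box.
- move=> _ _ [B mB ->] [C mC ->]; exists (fun i => B i `&` C i).
    by move=> i; exact: measurableI.
  apply/seteqP; split=> [x [Bx Cx] i|x BCx]; first by split.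
  by split=> i; case: (BCx i).
- by move=> _; exists (fun=> setT) => //; apply/seteqP; split.
- by rewrite bigcup_const.
- by move=> _ [C mC ->]; exact: m12.
Qed.

End box_uniqueness.

Section mix.
Context (I : finType) (d : I -> measure_display)
  (T : forall i, measurableType (d i)).

Definition mix (J : {set I}) (x y : prod_space T) : prod_space T :=
  fun i => if i \in J then y i else x i.

Lemma measurable_mix J :
  measurable_fun setT (fun xy : prod_space T * prod_space T => mix J xy.1 xy.2).
Proof.
apply: measurable_prod_spaceP => i; rewrite /mix.
have [iJ|iJ] := boolP (i \in J).
  apply: (@measurableT_comp _ _ _ _ _ _ (fun x : prod_space T => x i)).
    exact: measurable_coord.
  exact: measurable_snd.
apply: (@measurableT_comp _ _ _ _ _ _ (fun x : prod_space T => x i)).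
  exact: measurable_coord.
exact: measurable_fst.
Qed.

Lemma measurable_mix_comp d' (S : measurableType d') J (f g : S -> prod_space T) :
  measurable_fun setT f -> measurable_fun setT g ->
  measurable_fun setT (fun s => mix J (f s) (g s)).
Proof.
move=> mf mg; apply: (measurableT_comp (measurable_mix J)
  (g := fun s => (f s, g s))).
exact: measurable_fun_pair.
Qed.

Lemma measurable_upd_comp d' (S : measurableType d') i (f : S -> prod_space T)
    (g : S -> T i) :
  measurable_fun setT f -> measurable_fun setT g ->
  measurable_fun setT (fun s => dfwith (f s) i (g s) : prod_space T).
Proof.
move=> mf mg.
apply: (@measurableT_comp _ _ _ _ _ _ (@update I d T i) _ (fun s => (f s, g s))).
  exact: measurable_update.
exact: measurable_fun_pair.
Qed.

End mix.

Section resampling.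
Context (R : realType) (I : finType) (d : I -> measure_display)
  (T : forall i, measurableType (d i)).
Implicit Types P : forall i, probability (T i) R.

Lemma prod_probability_box P (A : forall i, set (T i)) :
  (forall i, measurable (A i)) ->
  (prod_probability P : probability (prod_space T) R) (box A) =
    (\prod_i P i (A i))%E.
Proof. by move=> mA; rewrite /= /prod_probability prod_measure_box. Qed.

(** A family of coordinates of a product measure may be redrawn from any
sampler [f] whose coordinates in [J] have the right joint law. *)
Lemma prod_resample P d' (S : measurableType d') (Q : probability S R)
    (J : {set I}) (f : S -> prod_space T) (mf : measurable_fun setT f) :
  (forall A : forall i, set (T i), (forall i, measurable (A i)) ->
    Q [set s | forall i, i \in J -> A i (f s i)] =
      (\prod_(i in J) P i (A i))%E) ->
  forall F, bmeas F ->
  \int[prod_probability P]_x F x =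
  \int[prod_probability P]_x \int[Q]_s F (mix J x (f s)).
Proof.
move=> Qf F bF; pose PP := prod_probability P.
pose g (xs : prod_space T * S) := mix J xs.1 (f xs.2).
have mg : measurable_fun setT g.
  by apply: measurable_mix_comp => //; exact: measurableT_comp mf _.
rewrite (@ex_distribution_set _ _ _ _ _ (PP \x Q)%E g mg)//.
  rewrite (ex_fubini1 _ _ (F := fun xs => F (g xs)))//.
  exact: bmeas_comp bF mg.
pose g' : {mfun _ >-> _} := HB.pack g (isMeasurableFun.Build _ _ _ _ g mg).
move=> B mB; rewrite -[RHS]/(distribution (PP \x Q)%E g' B).
apply: box_unique => // [|A mA].
  by rewrite (le_lt_trans (probability_le1 _ _)) ?ltry.
rewrite /distribution/= /pushforward.
pose A1 i := if i \in J then setT else A i.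
have mA1 i : measurable (A1 i) by rewrite /A1; case: ifP.
rewrite (_ : g @^-1` _ = box A1 `*` [set s | forall i, i \in J -> A i (f s i)]).
  rewrite product_measure1E//; last 2 first.
  - exact: measurable_box.
  - rewrite (_ : mkset _ = f @^-1` (box (fun i => if i \in J then A i else setT))).
      rewrite -[X in measurable X]setTI; apply: mf => //.
      by apply: measurable_box => i; case: ifP.
    apply/seteqP; split=> s /= H i; first by case: ifPn => // /H.
    by move=> iJ; have := H i; rewrite iJ.
  transitivity ((prod_probability P : probability _ _) (box A1) *
    Q [set s | forall i, (i \in J)%B -> A i (f s i)])%E; last by [].
  rewrite Qf// !prod_probability_box// (bigID (mem J))/= muleC; congr (_ * _)%E.
  rewrite [RHS](bigID (mem J))/= [X in (X * _)%E]big1 ?mul1e.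
    by apply: eq_bigr => i /negbTE iJ; rewrite /A1 iJ.
  by move=> i iJ; rewrite /A1 iJ probability_setT.
apply/seteqP; split=> -[x s]/= => [H|[H1 H2] i].
  split=> i; have := H i; rewrite /g /mix /A1/=; first by case: ifP.
  by move=> + iJ; rewrite iJ.
rewrite /g /mix/=; case: ifPn => [/H2//|/negbTE iJ].
by have := H1 i; rewrite /A1 iJ.
Qed.

Lemma prod_marginal P d' (S : measurableType d') (Q : probability S R)
    (J : {set I}) (f : S -> prod_space T) (mf : measurable_fun setT f) :
  (forall A : forall i, set (T i), (forall i, measurable (A i)) ->
    Q [set s | forall i, i \in J -> A i (f s i)] =
      (\prod_(i in J) P i (A i))%E) ->
  forall F, bmeas F -> depends_on J F ->
  \int[prod_probability P]_x F x = \int[Q]_s F (f s).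
Proof.
move=> Qf F bF FJ; rewrite (prod_resample mf Qf bF).
transitivity (\int[prod_probability P]_x \int[Q]_s F (f s)).
  apply: eq_ex => x; apply: eq_ex => s; apply: FJ => i iJ.
  by rewrite /mix iJ.
by rewrite ex_cst.
Qed.

Lemma prod_resample1 P i F : bmeas F ->
  \int[prod_probability P]_x F x =
  \int[prod_probability P]_x \int[P i]_t F (dfwith x i t).
Proof.
move=> bF; pose f (t : T i) : prod_space T := dfwith point i t.
have mf : measurable_fun setT f by exact: measurable_upd_comp.
rewrite (@prod_resample P _ _ (P i) [set i]%SET f mf _ F bF).
  apply: eq_ex => x; apply: eq_ex => t; congr F; apply: functional_extensionality_dep => j.
  rewrite /mix /f inE; have [->|ji] := eqVneq j i; first by rewrite !dfwithin.
  by rewrite dfwithout// eq_sym.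
move=> A mA; rewrite big_set1; congr (P i _).
apply/seteqP; split=> [t /(_ i)|t Ait j].
  by rewrite inE eqxx /f dfwithin; exact.
by rewrite inE => /eqP ->; rewrite /f dfwithin.
Qed.

Lemma prod_coord P i (f : T i -> R) : bmeas f ->
  \int[prod_probability P]_x f (x i) = \int[P i]_t f t.
Proof.
move=> bf; rewrite (prod_resample1 P i); last first.
  by apply: (bmeas_comp bf); exact: measurable_coord.
transitivity (\int[prod_probability P]_x \int[P i]_t f t); last exact: ex_cst.
by apply: eq_ex => x; apply: eq_ex => t; rewrite dfwithin.
Qed.

Lemma prod_agree P P' (J : {set I}) F :
  (forall i, i \in J -> meq (P i) (P' i)) -> bmeas F -> depends_on J F ->
  \int[prod_probability P]_x F x = \int[prod_probability P']_x F x.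
Proof.
move=> PP' bF FJ; apply: (prod_marginal (J := J)) => // A mA.
pose A1 i := if i \in J then A i else setT.
have mA1 i : measurable (A1 i) by rewrite /A1; case: ifP.
rewrite (_ : mkset _ = box A1).
  rewrite prod_probability_box// [LHS](bigID (mem J))/=.
  rewrite [X in (_ * X)%E]big1 ?mule1.
    by apply: eq_bigr => i iJ; rewrite /A1 iJ PP'.
  by move=> i /negbTE iJ; rewrite /A1 iJ probability_setT.
apply/seteqP; split=> s /= H i.
  by rewrite /A1; case: ifPn => // /H.
by move=> iJ; have := H i; rewrite /A1 iJ.
Qed.

End resampling.

(** * Measurable families of laws and block products *)

Section measurable_families.
Context d (T : measurableType d) (R : realType).

(** A measurable family of laws, in the form that is used: integrating a
jointly measurable function against the family is measurable. The extra
parameter space makes the property stable under reparametrisation. *)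
Definition mfam d0 (S : measurableType d0) (m : S -> probability T R) : Prop :=
  forall d' (S' : measurableType d') (p : S' -> S) (F : S' * T -> R),
    measurable_fun setT p -> bmeas F ->
    measurable_fun setT (fun s => \int[m (p s)]_t F (s, t)).

Lemma mfam_bmeas d0 (S : measurableType d0) (m : S -> probability T R)
    d' (S' : measurableType d') (p : S' -> S) (F : S' * T -> R) :
  mfam m -> measurable_fun setT p -> bmeas F ->
  bmeas (fun s => \int[m (p s)]_t F (s, t)).
Proof.
move=> hm mp bF; have [_ [C FC]] := bF; apply: (@bmeasP _ _ _ _ C).
  exact: hm.
by move=> s; apply: norm_ex_le => //; exact: bmeas_sec1.
Qed.

Lemma mfam_cst d0 (S : measurableType d0) (P : probability T R) :
  mfam (fun _ : S => P).
Proof. by move=> d' S' p F _ bF; have [] := bmeas_ex2 P bF. Qed.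

Lemma mfam_ext d0 (S : measurableType d0) (m m' : S -> probability T R) :
  (forall s f, bmeas f -> \int[m s]_t f t = \int[m' s]_t f t) ->
  mfam m -> mfam m'.
Proof.
move=> mm' hm d' S' p F mp bF.
rewrite (_ : (fun _ => _) = fun s => \int[m (p s)]_t F (s, t)); first exact: hm.
by apply/funext => s; rewrite mm'//; exact: bmeas_sec1.
Qed.

End measurable_families.

Section block_products.
Context (R : realType) (V : finType) (d : V -> measure_display)
  (X : forall v, measurableType (d v)).
Context (KK : {set {set V}}) (KK_part : finset.partition KK [set: V]%SET).
Local Notation XX := (prod_space X).
Implicit Types (m : block KK -> probability XX R) (F : XX -> R) (K : block KK).

Definition own_block (v : V) : block KK :=
  exist _ (finset.pblock KK v) (pblock_block KK_part v).

Lemma mem_own (v : V) (K : block KK) : (v \in val K) = (own_block v == K).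
Proof.
apply/idP/eqP => [vK|<-]; last exact: mem_own_block.
apply/val_inj => /=; apply: finset.def_pblock => //; last exact: valP.
by case/and3P: KK_part.
Qed.

Definition block_prod m : probability XX R :=
  distribution (prod_probability (fun K => marginal (val K) (m K)))
    (Defs.glue KK_part KK_part).

Lemma glueE (z : prod_space (fun K : block KK => sub_space X (val K))) v
    (vK : v \in val (own_block v)) :
  Defs.glue KK_part KK_part z v = z (own_block v) (exist _ v vK).
Proof. by rewrite /Defs.glue; congr (z _ (exist _ v _)); exact: bool_irrelevance. Qed.

Lemma block_prod_resample m K F : bmeas F ->
  \int[block_prod m]_x F x =
  \int[block_prod m]_x \int[m K]_z F (mix (val K) x z).
Proof.
move=> bF; have mm := @measurable_mix V d X (val K).
have bFm : bmeas (fun xz : XX * XX => F (mix (val K) xz.1 xz.2)).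
  exact: bmeas_comp bF mm.
have mg : measurable_fun setT (Defs.glue (X := X) KK_part KK_part) by exact: measurable_glue.
rewrite ex_distribution// ex_distribution; last first.
  exact: (bmeas_ex2 (m K) bFm).
have bFg := bmeas_comp bF mg.
rewrite (prod_resample1 _ K bFg); apply: eq_ex => z.
rewrite ex_distribution; last first.
  apply: bmeas_comp bF _; apply: measurableT_comp mg _.
  by apply: measurable_upd_comp.
apply: eq_ex => x; congr F; apply: functional_extensionality_dep => v.
have vo : v \in val (own_block v) by exact: mem_own_block.
rewrite /mix (@glueE _ _ vo) mem_own; have [e|oK] := eqVneq (own_block v) K.
  by move: vo; rewrite e => vo; rewrite dfwithin.
by rewrite dfwithout 1?eq_sym// -(@glueE _ _ vo).
Qed.

(** Integrating out the blocks of a list one after the other. For a function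
that only depends on these blocks this computes the block product, and the
starting configuration is irrelevant. *)
Fixpoint iter_int m (s : seq (block KK)) F (x : XX) : R :=
  if s is K :: s' then
    \int[m K]_z iter_int m s' (fun x' => F (mix (val K) x' z)) x
  else F x.

Definition blocks_dep (s : seq (block KK)) F : Prop :=
  forall x y : XX, (forall v, own_block v \in s -> x v = y v) -> F x = F y.

Lemma blocks_dep_mix K s F z : blocks_dep (K :: s) F ->
  blocks_dep s (fun x => F (mix (val K) x z)).
Proof.
move=> FKs x y xy; apply: FKs => v; rewrite inE /mix mem_own.
by case: eqP => //= _ /xy.
Qed.

Lemma bmeas_mix1 K F z : bmeas F -> bmeas (fun x => F (mix (val K) x z)).
Proof.
by move=> bF; apply: bmeas_comp bF _; apply: measurable_mix_comp.
Qed.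

Lemma bmeas_mix2 K F x : bmeas F -> bmeas (fun z => F (mix (val K) x z)).
Proof.
move=> bF; apply: bmeas_comp bF _; apply: measurable_mix_comp => //.
exact: measurable_id.
Qed.

Lemma block_prod_iter m s F x : bmeas F -> blocks_dep s F ->
  \int[block_prod m]_x F x = iter_int m s F x.
Proof.
elim: s F => [|K s IHs] F bF Fs /=.
  by rewrite (eq_ex _ (g := fun=> F x)) ?ex_cst// => y; exact: Fs.
rewrite (block_prod_resample _ K bF) (ex_fubini _ _
  (F := fun xz : XX * XX => F (mix (val K) xz.1 xz.2))); last first.
  by apply: bmeas_comp bF _; exact: measurable_mix.
apply: eq_ex => z /=; apply: IHs; first exact: bmeas_mix1.
exact: blocks_dep_mix.
Qed.

Lemma iter_int_bmeas d0 (S : measurableType d0) (m : S -> block KK -> probability XX R) :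
  (forall K, mfam (m^~ K)) ->
  forall s d' (S' : measurableType d') (p : S' -> S) (G : S' * XX -> R),
  measurable_fun setT p -> bmeas G ->
  bmeas (fun sx : S' * XX => iter_int (m (p sx.1)) s (fun x => G (sx.1, x)) sx.2).
Proof.
move=> hm; elim=> [|K s IHs] d' S' p G mp bG /=.
  by apply: (eq_bmeas _ bG) => -[].
pose G1 (sz : (S' * XX) * XX) := G (sz.1.1, mix (val K) sz.2 sz.1.2).
have bG1 : bmeas G1.
  apply: bmeas_comp bG _; apply: measurable_fun_pair.
    exact: measurableT_comp measurable_fst measurable_fst.
  apply: measurable_mix_comp; first exact: measurable_snd.
  exact: measurableT_comp measurable_snd measurable_fst.
have mp1 : measurable_fun setT (fun sz : S' * XX => p sz.1).
  exact: measurableT_comp mp measurable_fst.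
have := IHs _ _ (fun sz : S' * XX => p sz.1) G1 mp1 bG1.
set H := (X in bmeas X) => bH.
apply: (@eq_bmeas _ _ _ (fun sx : S' * XX =>
  \int[m (p sx.1) K]_z H ((sx.1, z), sx.2))); first by [].
apply: (mfam_bmeas (F := fun sxz : (S' * XX) * XX => H ((sxz.1.1, sxz.2), sxz.1.2))
  (hm K) mp1).
apply: bmeas_comp bH _; apply: measurable_fun_pair; last first.
  exact: measurableT_comp measurable_snd measurable_fst.
apply: measurable_fun_pair; last exact: measurable_snd.
exact: measurableT_comp measurable_fst measurable_fst.
Qed.

Lemma iter_int_bmeas_mix m s K F x : bmeas F ->
  bmeas (fun z => iter_int m s (fun x' => F (mix (val K) x' z)) x).
Proof.
move=> bF; pose F2 (sx : XX * XX) := F (mix (val K) sx.2 sx.1).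
have bF2 : bmeas F2.
  apply: bmeas_comp bF _; apply: measurable_mix_comp.
    exact: measurable_snd.
  exact: measurable_fst.
have := @iter_int_bmeas _ _ (fun _ : XX => m) (fun K => mfam_cst (m K)) s
  _ _ id F2 (@measurable_id _ _ setT) bF2.
by move=> /(@bmeas_sec2 _ _ _ _ _ _ x).
Qed.

Lemma iter_int_norm_le m s F x C : bmeas F -> (forall x, `|F x| <= C) ->
  `|iter_int m s F x| <= C.
Proof.
elim: s F => [|K s IHs] F bF FC /=; first exact: FC.
apply: norm_ex_le; first exact: iter_int_bmeas_mix.
by move=> z; apply: IHs => //; exact: bmeas_mix1.
Qed.

Lemma blocks_depT F : blocks_dep (enum [set: block KK]%SET) F.
Proof.
move=> x y xy; congr F; apply: functional_extensionality_dep => v.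
by apply: xy; rewrite mem_enum inE.
Qed.

Lemma block_prod_mfam d0 (S : measurableType d0)
    (m : S -> block KK -> probability XX R) :
  (forall K, mfam (m^~ K)) -> mfam (fun s => block_prod (m s)).
Proof.
move=> hm d' S' p F mp bF.
have [+ _] := iter_int_bmeas hm (enum [set: block KK]%SET) mp bF.
move=> mi; rewrite (_ : (fun _ => _) = (fun s : S' =>
  iter_int (m (p s)) (enum [set: block KK]%SET) (fun x => F (s, x)) point)).
  apply: (measurableT_comp mi (g := fun s => (s, point))).
  exact: measurable_fun_pair.
apply/funext => s; apply: block_prod_iter; first exact: bmeas_sec1.
exact: blocks_depT.
Qed.

Lemma block_prod_block m K F : bmeas F -> depends_on (val K) F ->
  \int[block_prod m]_x F x = \int[m K]_x F x.
Proof.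
move=> bF FK; rewrite (@block_prod_iter _ [:: K] _ point)//=.
  apply: eq_ex => z; apply: FK => v vK.
  by rewrite /mix vK.
by move=> x y xy; apply: FK => v; rewrite mem_own => /eqP vK; apply: xy; rewrite vK inE.
Qed.

Lemma block_prod_congr m m' F :
  (forall K f, bmeas f -> depends_on (val K) f ->
    \int[m K]_x f x = \int[m' K]_x f x) ->
  bmeas F -> \int[block_prod m]_x F x = \int[block_prod m']_x F x.
Proof.
move=> mm' bF.
rewrite !(@block_prod_iter _ (enum [set: block KK]%SET) _ point)//; try exact: blocks_depT.
elim: (enum _) F bF (point : XX) => [//|K s IHs] F bF x /=.
transitivity (\int[m K]_z iter_int m' s (fun x' => F (mix (val K) x' z)) x).
  by apply: eq_ex => z; apply: IHs; exact: bmeas_mix1.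
apply: mm'; first exact: iter_int_bmeas_mix.
move=> z z' zz' /=; congr (iter_int m' s _ x); apply/funext => x'.
congr F; apply: functional_extensionality_dep => v; rewrite /mix.
by case: ifP => // /zz'.
Qed.

End block_products.

(** * Self-normalised importance sampling *)

Section self_normalised_sampling.
Context d (T : measurableType d) (R : realType) (rho : probability T R).
Variables (N : nat) (N_gt0 : (0 < N)%N).
Variables (h : T -> R) (mh : measurable_fun setT h) (h0 : forall x, 0 <= h x).
Variables (c y : R) (c0 : 0 < c) (hc : forall x, c <= h x)
  (hy : forall x x', h x <= y * h x').
Local Notation SN := (prod_space (fun _ : 'I_N => T)).
Implicit Types (s : SN) (f : T -> R).

Local Notation iid := (prod_probability (fun _ : 'I_N => rho)).

Definition weighted_sample s : probability T R :=
  reweight (empirical_measure R s N_gt0) mh h0.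

Definition weighted_law : probability T R := reweight rho mh h0.

Let h_gt0 x : 0 < h x. Proof. exact: lt_le_trans (hc x). Qed.

Let N0 : 0 < N%:R :> R. Proof. by rewrite ltr0n. Qed.

Let y0 : 0 <= y.
Proof.
by have := hy point point; rewrite -ler_pdivrMr// divff ?gt_eqF//; exact: le_trans.
Qed.

Let bh : bmeas h.
Proof.
by apply: (@bmeasP _ _ _ _ (y * h point)) => // x; rewrite ger0_norm.
Qed.

Definition total_weight s : R := \sum_(i < N) h (s i).

Let total_gt0 s : 0 < total_weight s.
Proof.
rewrite /total_weight; apply: (@lt_le_trans _ _ (\sum_(i < N) c)).
  by rewrite sumr_const card_ord pmulrn_lgt0.
by apply: ler_sum => i _.
Qed.

Lemma weight_le_total s z : h z <= y / N%:R * total_weight s.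
Proof.
rewrite mulrAC ler_pdivlMr// mulr_sumr mulr_natr.
rewrite -[X in _ *+ X](card_ord N) -sumr_const.
by apply: ler_sum => i _.
Qed.

Lemma ex_weighted_law f : bmeas f ->
  \int[weighted_law]_x f x = \int[rho]_x (f x * h x) / \int[rho]_x h x.
Proof.
move=> bf; rewrite ex_reweight//.
by apply: (lt_le_trans c0); exact: ex_ge.
Qed.

Lemma ex_weighted_sample s f : bmeas f ->
  \int[weighted_sample s]_x f x =
  (\sum_(i < N) h (s i) * f (s i)) / total_weight s.
Proof.
move=> bf.
have Z0 : 0 < \int[empirical_measure R s N_gt0]_x h x.
  by apply: (lt_le_trans c0); exact: ex_ge.
rewrite ex_reweight// !ex_empirical//; last exact: bmeasM.
rewrite -/(total_weight s).
under eq_bigr do rewrite mulrC.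
have := total_gt0 s => /lt0r_neq0 t0.
by field; rewrite t0/= gt_eqF.
Qed.

Let measurable_at i : measurable_fun setT (fun s : SN => s i).
Proof. exact: measurable_coord. Qed.

Lemma bmeas_total : bmeas total_weight.
Proof. by apply: bmeas_sum => i _; exact: bmeas_comp bh (measurable_at i). Qed.

Lemma bmeas_total_inv : bmeas (fun s => (total_weight s)^-1).
Proof.
apply: (@bmeasV _ _ _ _ (N%:R * c)); first by rewrite mulr_gt0.
  exact: bmeas_total.
move=> s; rewrite mulr_natl -[X in _ *+ X](card_ord N) -sumr_const.
by apply: ler_sum => i _.
Qed.

Lemma weighted_sample_mfam : mfam weighted_sample.
Proof.
move=> d' S' p F mp bF.
have mpi (i : 'I_N) : measurable_fun setT (fun w : S' => p w i).
  exact: measurableT_comp (measurable_at i) mp.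
rewrite (_ : (fun _ => _) = (fun w : S' => (\sum_(i < N) h (p w i) * F (w, p w i)) *
    (total_weight (p w))^-1)); last first.
  by apply/funext => w; rewrite ex_weighted_sample//; exact: bmeas_sec1.
suff [] : bmeas (fun w : S' => (\sum_(i < N) h (p w i) * F (w, p w i)) *
    (total_weight (p w))^-1) by [].
apply: bmeasM; last exact: bmeas_comp bmeas_total_inv mp.
apply: bmeas_sum => i _; apply: bmeasM; first exact: bmeas_comp bh _.
by apply: bmeas_comp bF _; exact: measurable_fun_pair.
Qed.

Local Notation upd s i t := (dfwith (s : SN) i t : SN).

Let sum_upd (F : T -> R) s i t :
  \sum_(l < N) F (upd s i t l) = \sum_(l < N) F (s l) + F t - F (s i).
Proof.
rewrite (bigD1 i)//= dfwithin [in RHS](bigD1 i)//=.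
rewrite (eq_bigr (fun l => F (s l))) => [|l li]; last by rewrite dfwithout// eq_sym.
ring.
Qed.

(** Replacing one particle moves the reweighted empirical measure by O(1/N). *)
Lemma weighted_sample_lip (delta : R) f f' s i t :
  bmeas f -> bmeas f' -> (forall x, `|f x| <= 1) ->
  (forall x, `|f' x - f x| <= delta) ->
  `|\int[weighted_sample (upd s i t)]_x f' x - \int[weighted_sample s]_x f x|
    <= 4 * y / N%:R + delta.
Proof.
move=> bf bf' f1 ff'; set s' := upd s i t.
rewrite (_ : _ - _ = \int[weighted_sample s']_x (f' x - f x) +
    (\int[weighted_sample s']_x f x - \int[weighted_sample s]_x f x)); last first.
  by rewrite exB// addrA subrK.
rewrite addrC (le_trans (ler_normD _ _))// lerD//; last first.
  by apply: norm_ex_le => //; exact: bmeasB.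
set e := \int[weighted_sample s]_x f x.
have e1 : `|e| <= 1 by exact: norm_ex_le.
(* The weighted deviations from e sum to zero over s, so only the particle
   that was removed and the one that was put in its place contribute. *)
have sum0 : \sum_(l < N) h (s l) * (f (s l) - e) = 0.
  under eq_bigr do rewrite mulrBr.
  rewrite sumrB -mulr_suml -/(total_weight s) /e ex_weighted_sample//.
  by rewrite mulrC divfK ?subrr// gt_eqF.
rewrite -[X in _ - X](@ex_cst _ _ _ (weighted_sample s') e) -exB//; last exact: bmeas_cst.
rewrite ex_weighted_sample; last by apply: bmeasB => //; exact: bmeas_cst.
rewrite (sum_upd (fun z => h z * (f z - e))) sum0 add0r normrM normfV.
rewrite (gtr0_norm (total_gt0 _)) ler_pdivrMr//.
have he z : `|h z * (f z - e)| <= 2 * h z.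
  rewrite normrM ger0_norm// mulrC ler_wpM2r//.
  by rewrite (le_trans (ler_normB _ _))// -[2]/(1 + 1) lerD.
rewrite (le_trans (ler_normB _ _))// (le_trans (lerD (he _) (he _)))//.
have := weight_le_total s' t; have := weight_le_total s' (s i); lra.
Qed.

(** The bias of self-normalised importance sampling is O(1/N), even for a test
function that depends on the sample, as long as this dependence is weak: once the
i-th particle is replaced by a fixed state everywhere except in its own weight
and as the argument of the test function, the i-th term of the bias has mean
zero, and the replacement moves that term by O(1/N) of its size, plus what the
test function moves. *)
Lemma weighted_sample_bias (delta : R) (F : SN * T -> R) : bmeas F ->
  (forall sx, `|F sx| <= 1) ->
  (forall s i t x, `|F (upd s i t, x) - F (s, x)| <= delta) ->
  `|\int[iid]_s \int[weighted_sample s]_x F (s, x) -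
    \int[iid]_s \int[weighted_law]_x F (s, x)|
    <= 2 * y ^+ 2 / N%:R + 2 * y * delta.
Proof.
move=> bF F1 Fdelta.
pose D (sx : SN * T) := F sx - \int[weighted_law]_z F (sx.1, z).
have bD : bmeas D.
  apply: bmeasB => //; apply: (bmeas_comp (f := fun s => \int[weighted_law]_z F (s, z))).
    exact: bmeas_ex2.
  exact: measurable_fst.
have D2 sx : `|D sx| <= 2.
  rewrite (le_trans (ler_normB _ _))// -[2]/(1 + 1) lerD//.
  by apply: norm_ex_le => //; exact: bmeas_sec1.
have Ddelta s i t x : `|D (s, x) - D (upd s i t, x)| <= 2 * delta.
  rewrite /D/= (_ : _ - _ = - (F (upd s i t, x) - F (s, x)) +
    \int[weighted_law]_z (F (upd s i t, z) - F (s, z))); last first.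
    by rewrite exB; [ring|exact: bmeas_sec1|exact: bmeas_sec1].
  rewrite (le_trans (ler_normD _ _))// normrN mulr_natl mulr2n lerD//.
  by apply: norm_ex_le => //; apply: bmeasB; exact: bmeas_sec1.
(* [A i] is the i-th term of the bias and [B i] its decoupled version. *)
pose A i s := h (s i) / total_weight s * D (s, s i).
pose S i s := upd s i point.
pose B i s := h (s i) / total_weight (S i s) * D (S i s, s i).
have mS i : measurable_fun setT (S i) by exact: measurable_upd_comp.
have bhi i : bmeas (fun s : SN => h (s i)) by exact: bmeas_comp bh (measurable_at i).
have bA i : bmeas (A i).
  apply: bmeasM; first by apply: bmeasM => //; exact: bmeas_total_inv.
  by apply: bmeas_comp bD _; exact: measurable_fun_pair.
have bB i : bmeas (B i).
  apply: bmeasM.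
    by apply: bmeasM => //; exact: bmeas_comp bmeas_total_inv (mS i).
  by apply: bmeas_comp bD _; exact: measurable_fun_pair.
have B0 i : \int[iid]_s B i s = 0.
  rewrite (prod_resample1 _ i (bB i)).
  rewrite (eq_ex _ (g := fun=> 0)) ?ex_cst// => s.
  have SS t : S i (upd s i t) = S i s.
    apply: functional_extensionality_dep => l; rewrite /S.
    by have [->|li] := eqVneq l i; rewrite ?dfwithin// !dfwithout// eq_sym.
  rewrite (eq_ex _ (g := fun t => (total_weight (S i s))^-1 *
      (F (S i s, t) * h t - (\int[weighted_law]_z F (S i s, z)) * h t))); last first.
    by move=> t; rewrite /B SS dfwithin /D/=; ring.
  have bFs := bmeas_sec1 (S i s) bF.
  rewrite exZl; last first.
    by apply: bmeasB; [exact: bmeasM|exact: bmeasZ].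
  rewrite exB; [|exact: bmeasM|exact: bmeasZ].
  rewrite exZl// ex_weighted_law// divfK ?subrr ?mulr0//.
  by rewrite gt_eqF// (lt_le_trans c0)//; exact: ex_ge.
have AB i s : `|A i s - B i s| <= N%:R^-1 * (2 * y ^+ 2 / N%:R + 2 * y * delta).
  have t0 := total_gt0 s; have t'0 := total_gt0 (S i s).
  rewrite (_ : A i s - B i s =
     (h (s i) / total_weight s) *
       ((total_weight (S i s) - total_weight s) / total_weight (S i s)) * D (s, s i) +
     h (s i) / total_weight (S i s) * (D (s, s i) - D (S i s, s i))); last first.
    by rewrite /A /B; field; rewrite !gt_eqF.
  have w1 : `|h (s i) / total_weight s| <= y / N%:R.
    by rewrite ger0_norm ?divr_ge0 ?(ltW t0)// ler_pdivrMr// weight_le_total.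
  have w2 : `|h (s i) / total_weight (S i s)| <= y / N%:R.
    by rewrite ger0_norm ?divr_ge0 ?(ltW t'0)// ler_pdivrMr// weight_le_total.
  have w3 : `|(total_weight (S i s) - total_weight s) / total_weight (S i s)| <= y / N%:R.
    rewrite normrM normfV (gtr0_norm t'0) ler_pdivrMr//.
    rewrite /total_weight [X in `|X - _|](sum_upd h) -/(total_weight _).
    rewrite -/(total_weight (S i s)).
    have := weight_le_total (S i s) point; have := weight_le_total (S i s) (s i).
    have := h0 point; have := h0 (s i).
    move: (h (s i)) (h point) (y / _ * _) => a b z ? ? ? ?.
    by rewrite ler_norml; apply/andP; split; lra.
  rewrite (le_trans (ler_normD _ _))// [leRHS]mulrDr lerD//.
    rewrite !normrM.
    apply: (@le_trans _ _ (y / N%:R * (y / N%:R) * 2)).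
      rewrite ler_pM ?mulr_ge0// -?normrM//.
      by rewrite normrM ler_pM.
    by rewrite le_eqVlt; apply/orP; left; apply/eqP; field; rewrite gt_eqF.
  rewrite normrM (@le_trans _ _ (y / N%:R * (2 * delta)))//.
    by rewrite ler_pM// Ddelta.
  by rewrite le_eqVlt; apply/orP; left; apply/eqP; field; rewrite gt_eqF.
have bws : bmeas (fun s => \int[weighted_sample s]_x F (s, x)).
  by apply: (mfam_bmeas (p := id)) => //; exact: weighted_sample_mfam.
have bwl : bmeas (fun s => \int[weighted_law]_x F (s, x)) by exact: bmeas_ex2.
rewrite -exB//.
rewrite (eq_ex _ (g := fun s => \sum_(i < N) ((A i s - B i s) + B i s))); last first.
  move=> s; under [RHS]eq_bigr do rewrite subrK.
  rewrite ex_weighted_sample; last exact: bmeas_sec1.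
  have t0 : total_weight s != 0 by rewrite gt_eqF.
  apply: (@mulIf _ (total_weight s)) => //.
  rewrite mulrBl divfK// mulr_suml.
  under [in RHS]eq_bigr do rewrite /A mulrAC divfK// /D/= mulrBr.
  by rewrite sumrB -mulr_suml -/(total_weight s); congr (_ - _); rewrite mulrC.
rewrite ex_sum => [|i _]; last by apply: bmeasD => //; exact: bmeasB.
apply: (le_trans (ler_norm_sum _ _ _)).
apply: (@le_trans _ _ (\sum_(i < N) N%:R^-1 * (2 * y ^+ 2 / N%:R + 2 * y * delta))).
  apply: ler_sum => i _; rewrite exD//; last exact: bmeasB.
  rewrite B0 addr0; apply: norm_ex_le => //; exact: bmeasB.
rewrite sumr_const card_ord -mulrnAl -[_ *+ N]mulr_natl divff ?mul1r// gt_eqF//.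
Qed.

End self_normalised_sampling.

(** * Sampling all blocks from the same particles *)

Section blocked_sampling.
Context (R : realType) (V : finType) (d : V -> measure_display)
  (X : forall v, measurableType (d v)).
Context (KK : {set {set V}}) (KK_part : finset.partition KK [set: V]%SET).
Local Notation XX := (prod_space X).
Variables (rho : probability XX R) (N : nat) (N_gt0 : (0 < N)%N).
Variables (g : block KK -> XX -> R)
  (mg : forall K, measurable_fun setT (g K)) (g0 : forall K x, 0 <= g K x).
Variables (c y : R) (c0 : 0 < c) (gc : forall K x, c <= g K x)
  (gy : forall K x x', g K x <= y * g K x').
Local Notation SN := (prod_space (fun _ : 'I_N => XX)).
Local Notation iid := (prod_probability (fun _ : 'I_N => rho)).
Local Notation own := (own_block KK_part).
Local Notation bprod := (block_prod KK_part).
Local Notation iint := iter_int.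
Local Notation bdep := (blocks_dep KK_part).
Implicit Types (F : XX -> R) (K : block KK).

Definition sample_blocks (w : SN) K : probability XX R :=
  weighted_sample N_gt0 (mg K) (g0 K) w.

Definition law_blocks K : probability XX R := weighted_law rho (mg K) (g0 K).

Let N0 : 0 < N%:R :> R. Proof. by rewrite ltr0n. Qed.

Let y_ge0 K : 0 <= y.
Proof.
have := gy K point point; rewrite -ler_pdivrMr ?divff ?gt_eqF//; last 2 first.
- by rewrite (lt_le_trans c0).
- by rewrite (lt_le_trans c0).
exact: le_trans.
Qed.

Lemma sample_blocks_mfam K : mfam (sample_blocks^~ K).
Proof. exact: (weighted_sample_mfam _ _ _ c0 (gc K) (gy K)). Qed.

Local Notation upd w i t := (dfwith (w : SN) i t : SN).

Lemma iter_sample_lip (delta : R) (l : seq (block KK)) (G : SN * XX -> R) w i t x :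
  bmeas G -> (forall wx, `|G wx| <= 1) ->
  (forall w i t x, `|G (upd w i t, x) - G (w, x)| <= delta) ->
  `|iint (sample_blocks (upd w i t)) l (fun x => G (upd w i t, x)) x -
    iint (sample_blocks w) l (fun x => G (w, x)) x|
    <= (size l)%:R * (4 * y / N%:R) + delta.
Proof.
elim: l G => [|K l IHl] G bG G1 Gd /=; first by rewrite mul0r add0r.
rewrite [_.+1%:R]mulrS mulrDl mul1r -addrA.
apply: (weighted_sample_lip N_gt0 (mg K) (g0 K) c0 (gc K) (gy K)).
- exact: (iter_int_bmeas_mix _ _ _ _ (bmeas_sec1 w bG)).
- exact: (iter_int_bmeas_mix _ _ _ _ (bmeas_sec1 (upd w i t) bG)).
- move=> z; apply: iter_int_norm_le => //.
  exact: (bmeas_mix1 _ _ (bmeas_sec1 w bG)).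
- move=> z; apply: (IHl (fun wx => G (wx.1, mix (val K) wx.2 z))) => //.
  apply: bmeas_comp bG _; apply: measurable_fun_pair; first exact: measurable_fst.
    by apply: measurable_mix_comp.
  by move=> *; exact: Gd.
Qed.

(** The blocks are replaced one at a time; each replacement is a bias of a
single self-normalised sample whose test function depends weakly on the sample,
through the blocks that are still sampled. *)
Lemma iter_sample_bias (delta : R) (l : seq (block KK)) (G : SN * XX -> R) x :
  bmeas G -> (forall wx, `|G wx| <= 1) ->
  (forall w i t x, `|G (upd w i t, x) - G (w, x)| <= delta) ->
  `|\int[iid]_w iint (sample_blocks w) l (fun x => G (w, x)) x -
    \int[iid]_w iint law_blocks l (fun x => G (w, x)) x|
    <= (size l)%:R * (2 * y ^+ 2 / N%:R + 2 * y * delta) +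
       4 * (size l)%:R * ((size l)%:R - 1) * y ^+ 2 / N%:R.
Proof.
elim: l G => [|K l IHl] G bG G1 Gd /=.
  by rewrite subrr normr0 !mul0r mulr0 !mul0r addr0.
pose L : R := (size l)%:R.
pose H (wz : SN * XX) :=
  iint (sample_blocks wz.1) l (fun x' => G (wz.1, mix (val K) x' wz.2)) x.
have bH : bmeas H.
  pose G2 (wzx : (SN * XX) * XX) := G (wzx.1.1, mix (val K) wzx.2 wzx.1.2).
  have bG2 : bmeas G2.
    apply: bmeas_comp bG _; apply: measurable_fun_pair.
      exact: measurableT_comp measurable_fst measurable_fst.
    apply: measurable_mix_comp; first exact: measurable_snd.
    exact: measurableT_comp measurable_snd measurable_fst.
  have := iter_int_bmeas sample_blocks_mfam l
    (p := fun wz : SN * XX => wz.1) measurable_fst bG2.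
  by move=> /(@bmeas_sec2 _ _ _ _ _ _ x).
have bGz z : bmeas (fun wx : SN * XX => G (wx.1, mix (val K) wx.2 z)).
  apply: bmeas_comp bG _; apply: measurable_fun_pair; first exact: measurable_fst.
  by apply: measurable_mix_comp.
have H1 wz : `|H wz| <= 1.
  apply: iter_int_norm_le => //.
  exact: (bmeas_mix1 _ _ (bmeas_sec1 wz.1 bG)).
have Hd w i t z : `|H (upd w i t, z) - H (w, z)| <= L * (4 * y / N%:R) + delta.
  apply: (@iter_sample_lip delta l (fun wx => G (wx.1, mix (val K) wx.2 z))) => //.
  by move=> *; exact: Gd.
have step := weighted_sample_bias rho N_gt0 (mg K) (g0 K) c0 (gc K) (gy K) bH H1 Hd.
pose H' (wz : SN * XX) :=
  iint law_blocks l (fun x' => G (wz.1, mix (val K) x' wz.2)) x.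
have bH' : bmeas H'.
  pose G2 (wzx : (SN * XX) * XX) := G (wzx.1.1, mix (val K) wzx.2 wzx.1.2).
  have bG2 : bmeas G2.
    apply: bmeas_comp bG _; apply: measurable_fun_pair.
      exact: measurableT_comp measurable_fst measurable_fst.
    apply: measurable_mix_comp; first exact: measurable_snd.
    exact: measurableT_comp measurable_snd measurable_fst.
  have := iter_int_bmeas (m := fun _ : SN => law_blocks) (fun K => mfam_cst _) l
    (p := fun wz : SN * XX => wz.1) measurable_fst bG2.
  by move=> /(@bmeas_sec2 _ _ _ _ _ _ x).
have rec : `|\int[iid]_w \int[law_blocks K]_z H (w, z) -
    \int[iid]_w \int[law_blocks K]_z H' (w, z)| <=
    L * (2 * y ^+ 2 / N%:R + 2 * y * delta) + 4 * L * (L - 1) * y ^+ 2 / N%:R.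
  rewrite !(ex_fubini iid (law_blocks K))// -exB; last 2 first.
  - exact: bmeas_ex1.
  - exact: bmeas_ex1.
  apply: norm_ex_le; first by apply: bmeasB; exact: bmeas_ex1.
  move=> z; apply: (IHl (fun wx => G (wx.1, mix (val K) wx.2 z))) => //.
  by move=> *; exact: Gd.
rewrite -/(H' _).
have := le_trans (ler_normD _ _) (lerD step rec).
rewrite addrA subrK => /le_trans; apply.
rewrite [_.+1%:R]mulrS -/L le_eqVlt; apply/orP; left; apply/eqP.
by field; rewrite gt_eqF.
Qed.

Definition sampling_error F w : R :=
  \int[bprod (sample_blocks w)]_x F x - \int[bprod law_blocks]_x F x.

Lemma bmeas_sample_blocks F : bmeas F ->
  bmeas (fun w => \int[bprod (sample_blocks w)]_x F x).
Proof.
move=> bF; have bF2 : bmeas (fun wx : SN * XX => F wx.2).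
  exact: bmeas_comp bF measurable_snd.
exact: (mfam_bmeas (block_prod_mfam KK_part sample_blocks_mfam)
  (@measurable_id _ _ setT) bF2).
Qed.

Lemma bmeas_sampling_error F : bmeas F -> bmeas (sampling_error F).
Proof.
by move=> bF; apply: bmeasB; [exact: bmeas_sample_blocks|exact: bmeas_cst].
Qed.

(** All blocks are resampled from the same particles, so the block laws are
dependent. The square of the error is itself a bias: it is the bias for
the test function weighted by the error, which is a weakly dependent
function of the sample. *)
Lemma sampling_second_moment F l : bmeas F -> (forall x, `|F x| <= 1) ->
  bdep l F ->
  \int[iid]_w sampling_error F w ^+ 2 <= (4 * y / Num.sqrt N%:R * (size l)%:R) ^+ 2.
Proof.
move=> bF F1 Fl; pose L : R := (size l)%:R; pose x0 : XX := point.
have bF2 : bmeas (fun wx : SN * XX => F wx.2) by exact: bmeas_comp bF measurable_snd.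
have bC := bmeas_sampling_error bF.
have C2 w : `|sampling_error F w| <= 2.
  rewrite (le_trans (ler_normB _ _))// -[2]/(1 + 1) lerD//; exact: norm_ex_le.
have Cd w i t : `|sampling_error F (upd w i t) - sampling_error F w| <= L * (4 * y / N%:R).
  pose A w' := iint (sample_blocks w') l F x0; pose B := iint law_blocks l F x0.
  have E w' : sampling_error F w' = A w' - B.
    by rewrite /sampling_error; congr (_ - _); exact: block_prod_iter.
  rewrite !E opprB addrA subrK -[leRHS]addr0.
  apply: (@iter_sample_lip 0 l (fun wx => F wx.2)) => //.
  by move=> ? ? ? ?; rewrite subrr normr0.
(* The error is at most 2, so that half of it keeps the test function in [[-1, 1]]. *)
pose G (wx : SN * XX) := F wx.2 * (sampling_error F wx.1 / 2).
have bG : bmeas G.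
  apply: bmeasM => //; apply: bmeasM; last exact: bmeas_cst.
  exact: bmeas_comp bC measurable_fst.
have G1 wx : `|G wx| <= 1.
  rewrite /G normrM -[leRHS]mulr1 ler_pM//.
  by rewrite normrM normfV [X in _ / X]ger0_norm// ler_pdivrMr// mul1r.
have Gd w i t x : `|G (upd w i t, x) - G (w, x)| <= L * (4 * y / N%:R) / 2.
  rewrite /G/= -mulrBr -mulrBl normrM -[leRHS]mul1r ler_pM//.
  by rewrite normrM normfV [X in _ / X]ger0_norm// ler_pM2r ?invr_gt0.
have Gl w (m : block KK -> probability XX R) : iint m l (fun x => G (w, x)) x0 =
    \int[bprod m]_x F x * (sampling_error F w / 2).
  rewrite -(block_prod_iter (KK_part := KK_part) _ x0 (bmeas_sec1 w bG)).
    by rewrite /G/= exZr.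
  by move=> x x' xx'; rewrite /G/= (Fl _ _ xx').
have := iter_sample_bias l x0 bG G1 Gd.
rewrite (eq_ex _ (f := fun w => iint (sample_blocks w) l _ x0)
  (g := fun w => \int[bprod (sample_blocks w)]_x F x * (sampling_error F w / 2))) ?Gl//.
rewrite [X in _ - X](eq_ex _
  (g := fun w => \int[bprod law_blocks]_x F x * (sampling_error F w / 2))); last first.
  by move=> w; rewrite Gl.
have bC2 : bmeas (fun w => sampling_error F w / 2) by apply: bmeasM => //; exact: bmeas_cst.
rewrite -exB; last 2 first.
- by apply: bmeasM => //; exact: bmeas_sample_blocks.
- exact: bmeasZ.
rewrite (eq_ex _ (g := fun w => 2^-1 * sampling_error F w ^+ 2)); last first.
  by move=> w; rewrite -mulrBl -/(sampling_error F w); ring.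
rewrite exZl; last exact: bmeasX.
move=> /(le_trans (ler_norm _)).
rewrite mulrC ler_pdivrMr// => /le_trans; apply.
rewrite !exprMn exprVn sqr_sqrtr; last exact: ltW.
rewrite -/L -subr_ge0.
rewrite [leRHS](_ : _ = 4 * L * y ^+ 2 / N%:R); last by field; rewrite gt_eqF.
apply: divr_ge0; last exact: ltW.
by apply: mulr_ge0; [exact: mulr_ge0|exact: sqr_ge0].
Qed.

Section site_factors.
Variables (a : R) (a01 : 0 <= a < 1) (DK : nat).
Variables (I : Type) (p : I -> XX -> R) (bl : I -> seq (block KK)).
Hypotheses (mp : forall i, measurable_fun setT (p i))
  (ap : forall i x, a <= p i x <= 1)
  (pbl : forall i, bdep (bl i) (p i)) (blDK : forall i, (size (bl i) <= DK)%N).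

Let bp i : bmeas (p i).
Proof.
case/andP: a01 => a0 _; apply: (@bmeasP _ _ _ _ 1) => // x.
by case/andP: (ap i x) => apx p1; rewrite ger0_norm// (le_trans a0).
Qed.

(** Each factor splits as [a + (1 - a) r] with [r] in [[0, 1]]: only the
second summand depends on the configuration, so a factor adds its blocks to the
dependence of the product with weight [1 - a] only. A long product of factors
close to one is thus sampled with an error far below the number of blocks that
it depends on. *)
Lemma sampling_factors (q : R) (l : seq I) (B : XX -> R) s :
  q = 4 * y / Num.sqrt N%:R -> 0 <= q ->
  bmeas B -> (forall x, `|B x| <= 1) -> bdep s B ->
  \int[iid]_w sampling_error (fun x => B x * \prod_(i <- l) p i x) w ^+ 2
    <= (q * ((size s)%:R + DK%:R * ((1 - a) * (size l)%:R))) ^+ 2.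
Proof.
move=> qE q0; case/andP: a01 => a0 a1.
have ra1 : 0 < 1 - a by rewrite subr_gt0.
elim: l B s => [|i l IHl] B s bB B1 Bs.
  rewrite !mulr0 addr0 qE (_ : (fun x => _) = B); first exact: sampling_second_moment.
  by apply/funext => x; rewrite big_nil mulr1.
pose r x := (p i x - a) / (1 - a).
have r01 x : 0 <= r x <= 1.
  case/andP: (ap i x) => apx p1.
  by rewrite /r divr_ge0 ?subr_ge0 ?(ltW a1)//= ler_pdivrMr// mul1r lerB.
have br : bmeas r by apply: bmeasM; [apply: bmeasB => //|]; exact: bmeas_cst.
pose P x := \prod_(i <- l) p i x.
have bP : bmeas P by apply: bmeas_prod.
pose B' x := B x * r x.
have bB' : bmeas B' by exact: bmeasM.
have bBP : bmeas (fun x => B x * P x) by exact: bmeasM.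
have bBP' : bmeas (fun x => B' x * P x) by exact: bmeasM.
have splitE w : sampling_error (fun x => B x * \prod_(i <- i :: l) p i x) w =
    a * sampling_error (fun x => B x * P x) w +
    (1 - a) * sampling_error (fun x => B' x * P x) w.
  have E (m : probability XX R) : \int[m]_x (B x * \prod_(i <- i :: l) p i x) =
      a * \int[m]_x (B x * P x) + (1 - a) * \int[m]_x (B' x * P x).
    rewrite -!exZl// -exD; [|exact: bmeasZ|exact: bmeasZ].
    apply: eq_ex => x; rewrite big_cons -/(P x) /B' /r; field.
    by rewrite gt_eqF.
  have lin (b u v u' v' : R) :
      a * u + b * v - (a * u' + b * v') = a * (u - u') + b * (v - v') by ring.
  have e1 := E (bprod (sample_blocks w)); have e2 := E (bprod law_blocks).
  exact: (etrans (congr2 (fun u v : R => u - v) e1 e2) (lin _ _ _ _ _)).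
have B'1 x : `|B' x| <= 1.
  case/andP: (r01 x) => r0 r1.
  by rewrite normrM -[leRHS]mulr1 ler_pM// ger0_norm.
have B's : bdep (s ++ bl i) B'.
  move=> x x' xx'; rewrite /B' (Bs x x') => [|v vs]; last first.
    by apply: xx'; rewrite mem_cat vs.
  by rewrite /r (pbl (x := x) (y := x'))// => v vs; apply: xx'; rewrite mem_cat vs orbT.
under eq_Rintegral do rewrite splitE.
have I1 := ex_sqrZ a (bmeas_sampling_error bBP) (IHl B s bB B1 Bs).
have I2 := ex_sqrZ (1 - a) (bmeas_sampling_error bBP') (IHl B' (s ++ bl i) bB' B'1 B's).
have nn (n : nat) : 0 <= q * (n%:R + DK%:R * ((1 - a) * (size l)%:R)).
  by rewrite mulr_ge0// addr_ge0// mulr_ge0// mulr_ge0// ltW.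
have := ex_sqrD (bmeasZ a (bmeas_sampling_error bBP))
  (bmeasZ (1 - a) (bmeas_sampling_error bBP')) (mulr_ge0 a0 (nn _))
  (mulr_ge0 (ltW ra1) (nn _)) I1 I2.
move=> /le_trans; apply; apply: lerXn2r; rewrite ?nnegrE.
- by apply: addr_ge0; apply: mulr_ge0 => //; exact: ltW.
- by rewrite mulr_ge0// addr_ge0// mulr_ge0// mulr_ge0// ltW.
- rewrite size_cat natrD /= [_.+1%:R]mulrS -subr_ge0.
  rewrite [leRHS](_ : _ = q * ((1 - a) * (DK%:R - (size (bl i))%:R))); last by ring.
  by rewrite !mulr_ge0 ?(ltW ra1)// subr_ge0 ler_nat.
Qed.

End site_factors.
End blocked_sampling.

(** * Gibbs measures under heat-bath updates *)

Section heat_bath.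
Context (R : realType) (S : finType) (d : S -> measure_display)
  (T : forall i, measurableType (d i)).
Local Notation XS := (prod_space T).
Implicit Types (f : XS -> R) (x : XS).

Local Notation upd x i t := (dfwith (x : XS) i t : XS).

Variables (C : finType) (phi : C -> XS -> R) (supp : C -> {set S}).
Variables (a : R) (a0 : 0 < a) (a1 : a <= 1).
Hypotheses (mphi : forall c, measurable_fun setT (phi c))
  (phi_a1 : forall c x, a <= phi c x <= 1)
  (phi_supp : forall c, depends_on (supp c) (phi c)).

Definition gibbs x : R := \prod_c phi c x.

Let phi_gt0 c x : 0 < phi c x.
Proof. by case/andP: (phi_a1 c x) => /(lt_le_trans a0). Qed.

Lemma bmeas_factor c : bmeas (phi c).
Proof.
apply: (@bmeasP _ _ _ _ 1) => // x.
by case/andP: (phi_a1 c x) => ? ?; rewrite ger0_norm// ltW.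
Qed.

Lemma factors_prod_bounds (Q : pred C) x :
  a ^+ #|Q| <= \prod_(c | Q c) phi c x <= 1.
Proof.
apply/andP; split.
  rewrite -prodr_const; apply: ler_prod => c _; rewrite (ltW a0)/=.
  by case/andP: (phi_a1 c x).
by apply: prodr_ile1 => c; rewrite ltW//=; case/andP: (phi_a1 c x).
Qed.

Lemma gibbs_gt0 x : 0 < gibbs x.
Proof. by apply: prodr_gt0. Qed.

Lemma bmeas_gibbs : bmeas gibbs.
Proof. by apply: bmeas_prod => c _; exact: bmeas_factor. Qed.

Lemma gibbs_ge x : a ^+ #|C| <= gibbs x.
Proof. by case/andP: (factors_prod_bounds predT x). Qed.

Lemma ex_gibbs_gt0 (P : probability XS R) : 0 < \int[P]_x gibbs x.
Proof.
apply: (@lt_le_trans _ _ (a ^+ #|C|)); first exact: exprn_gt0.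
apply: ex_ge; [exact: bmeas_gibbs|exact: gibbs_ge].
Qed.

Definition gibbs_ex (P : forall i, probability (T i) R) f : R :=
  (\int[prod_probability P]_x (gibbs x * f x)) /
  \int[prod_probability P]_x gibbs x.

Lemma gibbs_ex_near (P : forall i, probability (T i) R) f (e O : R) :
  bmeas f -> (forall x, `|f x - e| <= O) -> `|gibbs_ex P f - e| <= O.
Proof.
move=> bf fe; have bg := bmeas_gibbs.
have Z0 := ex_gibbs_gt0 (prod_probability P).
have be : bmeas (fun _ : XS => e) by exact: bmeas_cst.
have bfe : bmeas (fun x => f x - e) by exact: bmeasB.
rewrite (_ : _ - e = (\int[prod_probability P]_x (gibbs x * (f x - e))) /
    \int[prod_probability P]_x gibbs x); last first.
  rewrite (eq_ex _ (f := fun x => gibbs x * (f x - e))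
    (g := fun x => gibbs x * f x - gibbs x * e)); last by move=> x; rewrite mulrBr.
  rewrite exB; [|exact: bmeasM|exact: bmeasM].
  by rewrite exZr// mulrBl mulrAC mulfV ?mul1r// gt_eqF.
rewrite normrM normfV (gtr0_norm Z0) ler_pdivrMr// mulrC -exZr//.
have bgfe : bmeas (fun x => gibbs x * (f x - e)) by exact: bmeasM.
apply: (le_trans (ler_norm_ex _ bgfe)); apply: ler_ex.
- exact: bmeas_norm.
- by apply: bmeasM => //; exact: bmeas_cst.
- by move=> x; rewrite normrM (gtr0_norm (gibbs_gt0 x)) ler_pM2l// gibbs_gt0.
Qed.

Definition osc_le (o : S -> R) f : Prop :=
  forall i x t, `|f (upd x i t) - f x| <= o i.

Lemma total_osc (o : S -> R) f x x' : osc_le o f ->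
  `|f x - f x'| <= \sum_i o i.
Proof.
move=> fo; pose m (l : seq S) := mix [set i in l] x' x.
suff H l : `|f (m l) - f x'| <= \sum_(i <- l) o i.
  have := H (enum S); rewrite big_enum /=; apply: le_trans.
  rewrite (_ : m (enum S) = x)//; apply: functional_extensionality_dep => i.
  by rewrite /m /mix inE mem_enum.
elim: l => [|i l IHl].
  rewrite (_ : m [::] = x') ?subrr ?normr0 ?big_nil//.
  by apply: functional_extensionality_dep => i; rewrite /m /mix inE.
rewrite big_cons (_ : m (i :: l) = upd (m l) i (x i)); last first.
  apply: functional_extensionality_dep => j; rewrite /m /mix !inE.
  have [->|ji] := eqVneq j i; first by rewrite dfwithin.
  by rewrite dfwithout 1?eq_sym//= inE.
rewrite (_ : _ - _ = (f (upd (m l) i (x i)) - f (m l)) + (f (m l) - f x')).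
  by rewrite (le_trans (ler_normD _ _))// lerD.
by rewrite addrA subrK.
Qed.

Section one_site.
Variables (i : S) (Pi : probability (T i) R).

Definition local_weight x : R := \prod_(c | i \in supp c) phi c x.

Definition resample f x : R :=
  (\int[Pi]_t (local_weight (upd x i t) * f (upd x i t))) /
  \int[Pi]_t local_weight (upd x i t).

Lemma bmeas_local : bmeas local_weight.
Proof. by apply: bmeas_prod => c _; exact: bmeas_factor. Qed.

Let local_ge x : a ^+ #|[pred c | i \in supp c]| <= local_weight x.
Proof. by case/andP: (factors_prod_bounds [pred c | i \in supp c] x). Qed.

Let local_gt0 x : 0 < local_weight x.
Proof. by apply: prodr_gt0. Qed.

Let bupd x f : bmeas f -> bmeas (fun t => f (upd x i t)).
Proof. by move=> bf; apply: bmeas_comp bf _; exact: measurable_upd_comp. Qed.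

Let updupd x t t' : upd (upd x i t) i t' = upd x i t'.
Proof.
apply: functional_extensionality_dep => j.
by have [->|ji] := eqVneq j i; rewrite ?dfwithin// !dfwithout// eq_sym.
Qed.

Lemma local_norm_ge x :
  a ^+ #|[pred c | i \in supp c]| <= \int[Pi]_t local_weight (upd x i t).
Proof. by apply: ex_ge => //; apply: bupd; exact: bmeas_local. Qed.

Let norm_gt0 x : 0 < \int[Pi]_t local_weight (upd x i t).
Proof. by apply: lt_le_trans (local_norm_ge x); exact: exprn_gt0. Qed.

Let bmeas_ex_upd f : bmeas f -> bmeas (fun x => \int[Pi]_t f (upd x i t)).
Proof.
move=> bf; apply: (bmeas_ex2 Pi (F := fun xt : XS * T i => f (upd xt.1 i xt.2))).
by apply: bmeas_comp bf _; exact: measurable_upd_comp.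
Qed.

Lemma bmeas_resample f : bmeas f -> bmeas (resample f).
Proof.
move=> bf; apply: bmeasM.
  apply: (bmeas_ex_upd (f := fun x => local_weight x * f x)).
  by apply: bmeasM => //; exact: bmeas_local.
apply: (bmeasV (c := a ^+ #|[pred c | i \in supp c]|)).
- exact: exprn_gt0.
- by apply: bmeas_ex_upd; exact: bmeas_local.
- exact: local_norm_ge.
Qed.

Lemma resample_upd f x t : resample f (upd x i t) = resample f x.
Proof.
rewrite /resample; congr (_ / _); apply: eq_ex => t'; by rewrite updupd.
Qed.

(** The heat-bath update is conditional expectation given all other sites, so
it leaves the Gibbs expectation unchanged. *)
Lemma gibbs_resample (P : forall j, probability (T j) R) f :
  P i = Pi -> bmeas f -> gibbs_ex P (resample f) = gibbs_ex P f.
Proof.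
move=> PPi bf; rewrite /gibbs_ex; congr (_ / _).
pose out x := \prod_(c | i \notin supp c) phi c x.
have gE x : gibbs x = out x * local_weight x.
  by rewrite /gibbs (bigID (fun c => i \in supp c))/= mulrC.
have outE x t : out (upd x i t) = out x.
  apply: eq_bigr => c ic; apply: phi_supp => j jc; rewrite dfwithout//.
  by apply: contraNneq ic => ->.
have bl := bmeas_local; have bg := bmeas_gibbs.
rewrite (prod_resample1 P i); last by apply: bmeasM => //; exact: bmeas_resample.
rewrite [RHS](prod_resample1 P i); last exact: bmeasM.
apply: eq_ex => x; rewrite PPi.
rewrite (eq_ex _ (g := fun t => (out x * resample f x) * local_weight (upd x i t))).
  rewrite exZl; last exact: bupd.
  rewrite /resample -mulrA divfK; last by rewrite gt_eqF.
  rewrite -exZl; last by apply: (bupd x (f := fun x => local_weight x * f x)); exact: bmeasM.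
  by apply: eq_ex => t; rewrite gE outE mulrA.
by move=> t; rewrite gE outE resample_upd; ring.
Qed.

(** The heat-bath update at [i] kills the oscillation at [i] and adds to the
oscillation at [j] a fraction of it. The two conditional laws at [i] dominate
a common measure of mass at least [a ^+ k], with [k] the number of factors that
touch both sites, which leaves a fraction [1 - a ^+ k <= k * (1 - a)]. *)
Lemma osc_resample (o : S -> R) f : bmeas f -> osc_le o f ->
  osc_le (fun j => if j == i then 0 else
    o j + (1 - a) * #|[pred c | (i \in supp c) && (j \in supp c)]|%:R * o i)
    (resample f).
Proof.
move=> bf fo j x s; case: eqVneq => [ji|ji].
  by subst j; rewrite resample_upd subrr normr0.
set k := #|_|; set x' := upd x j s.
have o0 : 0 <= o i by exact: le_trans (fo i point point).
have swap t : upd x' i t = upd (upd x i t) j s.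
  apply: functional_extensionality_dep => l; rewrite /x'.
  have [->|li] := eqVneq l i; first by rewrite dfwithin dfwithout// dfwithin.
  have [->|lj] := eqVneq l j; first by rewrite dfwithout ?dfwithin// eq_sym.
  by rewrite !dfwithout// eq_sym.
pose U t := \prod_(c | (i \in supp c) && (j \notin supp c)) phi c (upd x i t).
have UE t : U t = \prod_(c | (i \in supp c) && (j \notin supp c)) phi c (upd x' i t).
  apply: eq_bigr => c /andP[_ jc]; rewrite swap; apply: phi_supp => l lc.
  by rewrite [RHS]dfwithout//; apply: contraNneq jc => ->.
pose D z := \prod_(c | (i \in supp c) && (j \in supp c)) phi c z.
have WE z : local_weight z =
    D z * \prod_(c | (i \in supp c) && (j \notin supp c)) phi c z.
  by rewrite /local_weight (bigID (fun c => j \in supp c)).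
have D01 z : a ^+ k <= D z <= 1.
  exact: (factors_prod_bounds [pred c | (i \in supp c) && (j \in supp c)]).
have U0 t : 0 <= U t by apply: prodr_ge0 => c _; exact: ltW.
have bU : bmeas U.
  apply: bmeas_prod => c _; apply: bupd; exact: bmeas_factor.
have W1 t : a ^+ k * U t <= local_weight (upd x i t) <= U t.
  rewrite WE -/(U t); case/andP: (D01 (upd x i t)) => D0 D1.
  by rewrite ler_wpM2r//= ler_piMl.
have W2 t : a ^+ k * U t <= local_weight (upd x' i t) <= U t.
  rewrite WE -UE; case/andP: (D01 (upd x' i t)) => D0 D1.
  by rewrite ler_wpM2r//= ler_piMl.
pose m := f x'.
pose h t := f (upd x' i t).
have bh : bmeas h by exact: bupd.
have ak0 : 0 < a ^+ k by exact: exprn_gt0.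
have bw1 : bmeas (fun t => local_weight (upd x i t)) by apply: bupd; exact: bmeas_local.
have bw2 : bmeas (fun t => local_weight (upd x' i t)) by apply: bupd; exact: bmeas_local.
have hosc t t' : `|h t - h t'| <= o i.
  by rewrite /h -(updupd x' t' t); exact: fo.
have EU0 : 0 < \int[Pi]_t U t.
  apply: (lt_le_trans (norm_gt0 x)); apply: ler_ex => // t.
  by case/andP: (W1 t).
(* Shifted by its infimum, h takes values in [[0, o i]]. Both weights dominate
   [a ^+ k * U], whose share [u] of the two averages is the same. *)
pose lo := inf [set h t | t in setT].
have hinf : has_inf [set h t | t in setT].
  split; first by exists (h point); exists point.
  exists (h point - o i) => _ [t _ <-].
  by have := hosc point t; rewrite ler_norml => /andP[_]; lra.
have lo_le t : lo <= h t by apply: ge_inf; [case: hinf|exists t].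
have h_le t : h t <= lo + o i.
  rewrite -lerBlDr; apply: lb_le_inf; first by case: hinf.
  move=> _ [t' _ <-]; have := hosc t t'; rewrite ler_norml => /andP[_]; lra.
pose avg (w : T i -> R) := (\int[Pi]_t (w t * h t)) / \int[Pi]_t w t.
pose u := lo + a ^+ k * ((\int[Pi]_t (U t * (h t - lo))) / \int[Pi]_t U t).
have avgP (w : T i -> R) : bmeas w ->
    (forall t, a ^+ k * U t <= w t <= U t) ->
    u <= avg w <= u + (1 - a ^+ k) * o i.
  move=> bw wU.
  have bhl : bmeas (fun t => h t - lo) by apply: bmeasB => //; exact: bmeas_cst.
  have bUh : bmeas (fun t => U t * (h t - lo)) by exact: bmeasM.
  have w0 : 0 < \int[Pi]_t w t.
    apply: (@lt_le_trans _ _ (a ^+ k * \int[Pi]_t U t)); first exact: mulr_gt0.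
    rewrite -exZl//; apply: ler_ex => //; first exact: bmeasZ.
    by move=> t; case/andP: (wU t).
  have wEU : \int[Pi]_t w t <= \int[Pi]_t U t.
    by apply: ler_ex => // t; case/andP: (wU t).
  have AE : avg w = lo + (\int[Pi]_t (w t * (h t - lo))) / \int[Pi]_t w t.
    rewrite /avg (eq_ex _ (f := fun t => w t * (h t - lo)) (g := fun t => w t * h t - lo * w t)).
      rewrite exB ?exZl//; [|exact: bmeasM|exact: bmeasZ].
      by rewrite mulrBl mulfK ?gt_eqF// addrC subrK.
    by move=> t; ring.
  set Ew := \int[Pi]_t w t in w0 wEU AE *; set EU := \int[Pi]_t U t in EU0 wEU *.
  have Uh0 : 0 <= \int[Pi]_t (U t * (h t - lo)).
    by apply: ex_ge => // t; rewrite mulr_ge0// subr_ge0.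
  have lower : a ^+ k * (\int[Pi]_t (U t * (h t - lo))) <= \int[Pi]_t (w t * (h t - lo)).
    rewrite -exZl//; apply: ler_ex; [exact: bmeasZ|exact: bmeasM|move=> t].
    by rewrite mulrA ler_wpM2r ?subr_ge0//; case/andP: (wU t).
  have upper : \int[Pi]_t (w t * (h t - lo)) <=
      a ^+ k * Ew / EU * \int[Pi]_t (U t * (h t - lo)) + (1 - a ^+ k) * o i * Ew.
    (* the part of w above (a ^+ k * Ew / EU) U has mass (1 - a ^+ k) Ew *)
    pose r := a ^+ k * Ew / EU.
    have r0 : 0 <= r by rewrite /r divr_ge0 ?mulr_ge0 ?(ltW w0) ?(ltW EU0) ?(ltW ak0).
    have rak : r <= a ^+ k.
      by rewrite /r ler_pdivrMr// ler_pM2l.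
    apply: (@le_trans _ _ (\int[Pi]_t (r * (U t * (h t - lo)) + (w t - r * U t) * o i))).
      apply: ler_ex; first exact: bmeasM.
        apply: bmeasD; first exact: bmeasZ.
        by apply: bmeasM; [apply: bmeasB => //; exact: bmeasZ|exact: bmeas_cst].
      move=> t; rewrite -subr_ge0.
      rewrite [leRHS](_ : _ = (w t - r * U t) * (lo + o i - h t)); last by ring.
      rewrite mulr_ge0// ?subr_ge0//.
      apply: (@le_trans _ _ (a ^+ k * U t)); last by case/andP: (wU t).
      by rewrite ler_wpM2r.
    rewrite exD; last 2 first.
    - exact: bmeasZ.
    - by apply: bmeasM; [apply: bmeasB => //; exact: bmeasZ|exact: bmeas_cst].
    rewrite exZl// lerD2l exZr; last by apply: bmeasB => //; exact: bmeasZ.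
    rewrite exB//; last exact: bmeasZ.
    rewrite exZl// -/Ew -/EU le_eqVlt; apply/orP; left; apply/eqP.
    by rewrite /r; field; rewrite gt_eqF.
  rewrite AE /u; apply/andP; split.
    rewrite lerD2l ler_pdivlMr// (le_trans _ lower)//.
    rewrite mulrA mulrAC [leLHS](_ : _ = a ^+ k * (\int[Pi]_t (U t * (h t - lo))) * (Ew / EU)); last by ring.
    by rewrite ler_piMr ?mulr_ge0 ?(ltW ak0)// ler_pdivrMr// mul1r.
  rewrite -addrA lerD2l ler_pdivrMr// (le_trans upper)// [leRHS]mulrDl lerD2r.
  rewrite -/EU.
  by rewrite le_eqVlt; apply/orP; left; apply/eqP; field; rewrite gt_eqF.
have := avgP _ bw1 W1; have := avgP _ bw2 W2; rewrite /avg => A2 A1.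
have bfx : bmeas (fun t => f (upd x i t)) by exact: bupd.
have step1 : `|(\int[Pi]_t (local_weight (upd x i t) * h t)) / (\int[Pi]_t local_weight (upd x i t))
    - resample f x| <= o j.
  rewrite /resample -mulrBl -exB; [|exact: bmeasM|exact: bmeasM].
  rewrite normrM normfV (gtr0_norm (norm_gt0 x)) ler_pdivrMr// -exZl//.
  have bdiff : bmeas (fun t => local_weight (upd x i t) * h t -
      local_weight (upd x i t) * f (upd x i t)) by apply: bmeasB; exact: bmeasM.
  apply: (le_trans (ler_norm_ex _ bdiff)); apply: ler_ex; first exact: bmeas_norm.
    exact: bmeasZ.
  move=> t; rewrite -mulrBr normrM (gtr0_norm (local_gt0 _)) mulrC ler_wpM2r//.
    exact: ltW.
  by rewrite /h swap; exact: fo.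
rewrite -[resample f (upd x j s)]/((\int[Pi]_t (local_weight (upd x' i t) * h t)) /
  \int[Pi]_t local_weight (upd x' i t)).
have bern : 1 - a ^+ k <= (1 - a) * k%:R.
  elim: (k) => [|n IHn]; first by rewrite expr0 subrr mulr0.
  rewrite exprS mulrSr mulrDr mulr1 (_ : 1 - a * a ^+ n = a * (1 - a ^+ n) + (1 - a)).
    rewrite lerD2r (le_trans _ IHn)// ler_piMl// subr_ge0.
    by rewrite exprn_ile1// ltW.
  by ring.
have : (1 - a ^+ k) * o i <= (1 - a) * k%:R * o i by rewrite ler_wpM2r.
move: A1 A2 step1; move: (_ / _) (_ / _) (resample f x) => A1 A2 A3.
move: (u) ((1 - a ^+ k) * o i) ((1 - a) * k%:R * o i) => v e1 e2.
move=> /andP[? ?] /andP[? ?]; rewrite !ler_norml => /andP[? ?] ?.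
by apply/andP; split; lra.
Qed.

End one_site.

(** Dobrushin's comparison: a Gibbs measure forgets the reference laws of the
sites of [B]. A potential [u] that is a strict supersolution of the influence
matrix off [B] bounds what is left of the oscillation of [f] on [B] after
arbitrarily many heat-bath updates off [B]: each update at a site whose
weighted oscillation exceeds a threshold lowers the total weighted oscillation
by a fixed amount, so finitely many updates push it below the threshold. *)
Lemma dobrushin_comparison (B : {set S}) (P P' : forall i, probability (T i) R)
    (u : S -> R) (r : R) (o : S -> R) f :
  (forall i, i \notin B -> P i = P' i) ->
  (forall i, 0 < u i) -> (forall i, i \in B -> 1 <= u i) -> 0 <= r < 1 ->
  (forall i, i \notin B ->
    (1 - a) * \sum_(c | i \in supp c) \sum_(j in supp c | j != i) u j <= r * u i) ->
  bmeas f -> (forall i, 0 <= o i) -> osc_le o f ->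
  `|gibbs_ex P f - gibbs_ex P' f| <= \sum_i o i * u i.
Proof.
move=> PP' u0 uB /andP[r0 r1] ur bf o0 fo.
have bg := bmeas_gibbs; have near := gibbs_ex_near.
pose M := \sum_i (u i)^-1.
have oscillation_small eta o' f' : 0 < eta -> bmeas f' -> osc_le o' f' ->
    (forall i, 0 <= o' i) -> (forall i, i \notin B -> o' i * u i <= eta) ->
    `|gibbs_ex P f' - gibbs_ex P' f'| <= \sum_i o' i * u i + eta * M.
  move=> eta0 bf' fo' o'0 small.
  apply: (@le_trans _ _ (\sum_i o' i)).
    apply: (near P f' _ _ bf') => x; rewrite distrC.
    apply: (near P' f' _ _ bf') => x'.
    exact: total_osc.
  rewrite mulr_sumr -big_split/=; apply: ler_sum => i _.
  have [iB|/small oi] := boolP (i \in B).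
    rewrite -[leLHS]addr0 lerD//; first by rewrite ler_peMr// uB.
    by rewrite mulr_ge0 ?invr_ge0// ltW.
  rewrite -[leLHS]add0r lerD//; first by rewrite mulr_ge0// ltW.
  by rewrite ler_pdivlMr.
suff H eta : 0 < eta -> `|gibbs_ex P f - gibbs_ex P' f| <=
    \sum_i o i * u i + eta * M.
  have M0 : 0 <= M by apply: sumr_ge0 => i _; rewrite invr_ge0 ltW.
  apply/ler_addgt0Pr => e e0.
  have Mp : 0 < M + 1 by rewrite ltr_wpDl.
  have /H/le_trans : 0 < e / (M + 1) by rewrite divr_gt0.
  apply; rewrite lerD2l mulrAC ler_pdivrMr// ler_pM2l// lerDl//.
move=> eta0.
have rr : 0 < (1 - r) * eta by rewrite mulr_gt0// subr_gt0.
have [n] : exists n : nat, \sum_i o i * u i <= n%:R * ((1 - r) * eta).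
  exists (Num.bound ((\sum_i o i * u i) / ((1 - r) * eta))).
  rewrite -ler_pdivrMr//; apply/ltW/archi_boundP.
  by rewrite divr_ge0 ?(ltW rr)//; apply: sumr_ge0 => i _; rewrite mulr_ge0// ltW.
elim: n o f bf o0 fo => [|n IHn] o f bf o0 fo on;
  have [small|] := pselect (forall i, i \notin B -> o i * u i <= eta).
- exact: oscillation_small.
- move=> /existsNP[i /not_implyP[iB /negP]]; rewrite -ltNge => oi.
  move: on; rewrite mul0r (bigD1 i)//= leNgt => /negP[].
  rewrite ltr_wpDr ?(lt_trans eta0)//.
  by apply: sumr_ge0 => j _; rewrite mulr_ge0// ltW.
- exact: oscillation_small.
move=> /existsNP[i /not_implyP[iB /negP]]; rewrite -ltNge => oi.
have rf : bmeas (resample (P i) f) by exact: bmeas_resample.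
rewrite -(gibbs_resample (i := i) (Pi := P i) (P := P) erefl bf).
rewrite -(gibbs_resample (i := i) (Pi := P i) (P := P') (esym (PP' _ iB)) bf).
pose o' j := if j == i then 0 else
    o j + (1 - a) * #|[pred c | (i \in supp c) && (j \in supp c)]|%:R * o i.
have o'0 j : 0 <= o' j.
  by rewrite /o'; case: eqP => // _; rewrite addr_ge0// !mulr_ge0// subr_ge0.
have fo' : osc_le o' (resample (P i) f) by exact: osc_resample.
have o'u : \sum_j o' j * u j <= \sum_j o j * u j - (1 - r) * (o i * u i).
  rewrite (bigD1 i)//= {1}/o' eqxx mul0r add0r [in leRHS](bigD1 i)//=.
  rewrite (eq_bigr (fun j => o j * u j + o i * ((1 - a) *
    (#|[pred c | (i \in supp c) && (j \in supp c)]|%:R * u j)))); last first.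
    by move=> j /negbTE ji; rewrite /o' ji; ring.
  rewrite big_split/= -mulr_sumr -mulr_sumr.
  have -> : \sum_(j | j != i) #|[pred c | (i \in supp c) && (j \in supp c)]|%:R * u j
      = \sum_(c | i \in supp c) \sum_(j in supp c | j != i) u j.
    rewrite (eq_bigr (fun j => \sum_(c | (i \in supp c) && (j \in supp c)) u j)).
      rewrite (exchange_big_dep (fun c => i \in supp c))//=.
        apply: eq_bigr => c ic; apply: eq_bigl => j; by rewrite ic andbC.
      by move=> j c _ /andP[].
    by move=> j _; rewrite mulr_natl -sumr_const.
  have := ler_wpM2l (o0 i) (ur _ iB).
  move: (\sum_(_ | _) _) ((1 - a) * _) => z1 z2 ?.
  rewrite [leRHS](_ : _ = z1 + o i * (r * u i)); last by ring.
  by rewrite lerD2l.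
have oi' : (1 - r) * eta <= (1 - r) * (o i * u i).
  by rewrite ler_pM2l ?subr_gt0// ltW.
apply: (le_trans (IHn o' _ rf o'0 fo' _)).
  by apply: (le_trans o'u); move: on; rewrite [_.+1%:R]mulrS mulrDl mul1r; lra.
by rewrite lerD2r (le_trans o'u)//; lra.
Qed.

(** Changing a single reference law. Conditionally on the coordinate at [l] the
Gibbs expectation of [f] moves by at most [A], and the likelihood of that
coordinate varies by a factor of at most [a ^- n]; Cauchy-Schwarz brings in the
squared distance of the densities, a quantity that can be averaged over the
randomness of the laws. *)
Lemma single_law_change (l : S) (P P' : forall i, probability (T i) R)
    (Q : probability (T l) R) (u u' : T l -> R) (b A : R) (n : nat) f :
  (forall i, i != l -> P i = P' i) ->
  bmeas u -> bmeas u' -> 0 < b -> (forall z, b <= u z) -> (forall z, b <= u' z) ->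
  (forall h, bmeas h -> \int[P l]_z h z = (\int[Q]_z (u z * h z)) / \int[Q]_z u z) ->
  (forall h, bmeas h -> \int[P' l]_z h z = (\int[Q]_z (u' z * h z)) / \int[Q]_z u' z) ->
  (#|[pred c | l \in supp c]| <= n)%N -> bmeas f ->
  (forall P1 P2 : forall i, probability (T i) R, (forall i, i != l -> P1 i = P2 i) ->
    `|gibbs_ex P1 f - gibbs_ex P2 f| <= A) ->
  (gibbs_ex P f - gibbs_ex P' f) ^+ 2 <=
    A ^+ 2 * a ^- n * b ^- 2 * \int[Q]_z (u z - u' z) ^+ 2.
Proof.
move=> PP' bu bu' b0 ub u'b Pu P'u' ln bf fA.
have bg := bmeas_gibbs; have bgf : bmeas (fun x => gibbs x * f x) by exact: bmeasM.
pose N h z := \int[prod_probability P]_x h (upd x l z) : R.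
have bN h : bmeas h -> bmeas (N h).
  move=> bh; apply: (bmeas_ex1 _ (F := fun xt : XS * T l => h (upd xt.1 l xt.2))).
  by apply: bmeas_comp bh _; exact: measurable_upd_comp.
have bupd h z : bmeas h -> bmeas (fun x => h (upd x l z)).
  by move=> bh; apply: bmeas_comp bh _; exact: measurable_upd_comp.
have NE (P1 : forall i, probability (T i) R) h : (forall i, i != l -> P1 i = P i) ->
    bmeas h -> \int[prod_probability P1]_x h x = \int[P1 l]_z N h z.
  move=> P1P bh; rewrite (prod_resample1 P1 l bh).
  rewrite (ex_fubini _ _ (F := fun xt : XS * T l => h (upd xt.1 l xt.2))); last first.
    by apply: bmeas_comp bh _; exact: measurable_upd_comp.
  apply: eq_ex => z; rewrite /N/=; apply: (prod_agree (J := [set~ l])).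
  - by move=> i; rewrite !inE => il B mB; rewrite P1P.
  - exact: bupd.
  - move=> x y xy; congr h; apply: functional_extensionality_dep => i.
    have [->|il] := eqVneq i l; first by rewrite !dfwithin.
    by rewrite !dfwithout 1?eq_sym// xy// !inE.
pose h := N gibbs.
have bh : bmeas h by exact: bN.
have hge z : a ^+ #|C| <= h z.
  by apply: ex_ge; [exact: bupd|move=> x; exact: gibbs_ge].
have h0 z : 0 < h z by apply: lt_le_trans (hge z); exact: exprn_gt0.
pose c := gibbs_ex P' f.
have an0 : 0 < a ^+ n by exact: exprn_gt0.
have hratio z z' : a ^+ n * h z <= h z'.
  rewrite -exZl; last exact: bupd.
  apply: ler_ex; [by apply: bmeasZ; exact: bupd|exact: bupd|move=> x].
  rewrite /gibbs (bigID (fun c => l \in supp c))/=.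
  rewrite [leRHS](bigID (fun c => l \in supp c))/= mulrA.
  rewrite [X in _ * X](eq_bigr (fun c => phi c (upd x l z'))); last first.
    move=> c' lc; apply: phi_supp => j jc.
    by rewrite !dfwithout//; apply: contraNneq lc => ->.
  rewrite ler_wpM2r//; first by apply: prodr_ge0 => c' _; exact: ltW.
  have /andP[_ le1] := factors_prod_bounds [pred c | l \in supp c] (upd x l z).
  have /andP[ge _] := factors_prod_bounds [pred c | l \in supp c] (upd x l z').
  apply: le_trans ge; apply: (@le_trans _ _ (a ^+ n)).
    by rewrite ler_piMr// ltW.
  by rewrite ler_wiXn2l// ltW.
have GE z : N (fun x => gibbs x * f x) z / h z =
    gibbs_ex (dfwith P l (\d_z : probability (T l) R)) f.
  rewrite /gibbs_ex !NE//; last 2 first.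
  - by move=> i il; rewrite dfwithout// eq_sym.
  - by move=> i il; rewrite dfwithout// eq_sym.
  by rewrite dfwithin !ex_dirac//; exact: bN.
have GA z : `|N (fun x => gibbs x * f x) z - c * h z| <= A * h z.
  rewrite -[X in `|X - _|](divfK (lt0r_neq0 (h0 z))) -mulrBl normrM (gtr0_norm (h0 z)).
  rewrite ler_pM2r// GE; apply: fA => i il.
  by rewrite dfwithout 1?eq_sym// PP'.
pose k z := N (fun x => gibbs x * f x) z - c * h z.
have bk : bmeas k by apply: bmeasB; [exact: bN|exact: bmeasZ].
have ratioE (v : T l -> R) : bmeas v -> (forall z, b <= v z) ->
    forall e, e = (\int[Q]_z (v z * N (fun x => gibbs x * f x) z)) /
      \int[Q]_z (v z * h z) ->
    \int[Q]_z (v z * k z) = (e - c) * \int[Q]_z (v z * h z).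
  move=> bv vb e ->.
  have vh0 : 0 < \int[Q]_z (v z * h z).
    apply: (@lt_le_trans _ _ (b * a ^+ #|C|)); first by rewrite mulr_gt0// exprn_gt0.
    by apply: ex_ge => [|z]; [exact: bmeasM|rewrite ler_pM// ltW// exprn_gt0].
  rewrite mulrBl divfK ?gt_eqF// -exZl; last exact: bmeasM.
  rewrite -exB; [|by apply: bmeasM => //; exact: bN|by apply: bmeasZ; exact: bmeasM].
  by apply: eq_ex => z; rewrite /k mulrBr; congr (_ - _); ring.
have Q0 (v : T l -> R) : bmeas v -> (forall z, b <= v z) -> 0 < \int[Q]_z v z.
  by move=> bv vb; apply: (lt_le_trans b0); exact: ex_ge.
have gexE (P1 : forall i, probability (T i) R) v : (forall i, i != l -> P1 i = P i) ->
    bmeas v -> (forall z, b <= v z) ->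
    (forall h, bmeas h -> \int[P1 l]_z h z = (\int[Q]_z (v z * h z)) / \int[Q]_z v z) ->
    gibbs_ex P1 f = (\int[Q]_z (v z * N (fun x => gibbs x * f x) z)) /
      \int[Q]_z (v z * h z).
  move=> P1P bv vb P1v; rewrite /gibbs_ex !NE// !P1v//; last exact: bN.
  by rewrite invf_div mulrA divfK// gt_eqF// Q0.
have k1 := ratioE u bu ub _ (gexE P u (fun _ _ => erefl) bu ub Pu).
have k2 := ratioE u' bu' u'b _
  (gexE P' u' (fun i il => esym (PP' i il)) bu' u'b P'u').
rewrite -/c subrr mul0r in k2.
have uh0 : 0 < \int[Q]_z (u z * h z).
  apply: (@lt_le_trans _ _ (b * a ^+ #|C|)); first by rewrite mulr_gt0// exprn_gt0.
  by apply: ex_ge => [|z]; [exact: bmeasM|rewrite ler_pM// ltW// exprn_gt0].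
pose D z := `|u z - u' z|.
have bD : bmeas D by apply: bmeas_norm; exact: bmeasB.
have h_int : 0 < \int[Q]_z h z.
  by apply: (@lt_le_trans _ _ (a ^+ #|C|)); [exact: exprn_gt0|exact: ex_ge].
have A0 : 0 <= A by exact: le_trans (fA P P (fun _ _ => erefl)).
have bhD : bmeas (fun z => h z * D z) by exact: bmeasM.
have main : `|gibbs_ex P f - c| * \int[Q]_z (u z * h z) <= A * \int[Q]_z (h z * D z).
  rewrite -(gtr0_norm uh0) -normrM -k1 -[X in `|X|]subr0 -k2 -exB; last 2 first.
  - exact: bmeasM.
  - exact: bmeasM.
  rewrite -exZl//.
  have bd : bmeas (fun z => u z * k z - u' z * k z) by apply: bmeasB; exact: bmeasM.
  apply: (le_trans (ler_norm_ex _ bd)); apply: ler_ex; [exact: bmeas_norm|exact: bmeasZ|].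
  by move=> z; rewrite -mulrBl normrM mulrC mulrA ler_wpM2r//; exact: GA.
have low : b * \int[Q]_z h z <= \int[Q]_z (u z * h z).
  rewrite -exZl//; apply: ler_ex; [exact: bmeasZ|exact: bmeasM|move=> z].
  by rewrite ler_wpM2r// ltW.
have cs : (\int[Q]_z (h z * D z)) ^+ 2 <= \int[Q]_z h z * \int[Q]_z (h z * D z ^+ 2).
  by apply: ex_cauchy_schwarz => // z; exact: ltW.
have tilt : \int[Q]_z (h z * D z ^+ 2) <= a ^- n * \int[Q]_z h z * \int[Q]_z (u z - u' z) ^+ 2.
  have bd2 : bmeas (fun z => (u z - u' z) ^+ 2) by apply: bmeasX; exact: bmeasB.
  rewrite -exZl//; apply: ler_ex; first by apply: bmeasM => //; exact: bmeasX.
    exact: bmeasZ.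
  move=> z; rewrite real_normK ?num_real// ler_wpM2r ?sqr_ge0//.
  (* any value of the likelihood is at most [a ^- n] times its average *)
  rewrite [leRHS]mulrC ler_pdivlMr// mulrC.
  by apply: ex_ge => // z'; exact: hratio.
have -> : gibbs_ex P f - gibbs_ex P' f = gibbs_ex P f - c by [].
set e := gibbs_ex P f - c in main *.
have e1 : (`|e| * (b * \int[Q]_z h z)) ^+ 2 <= (A * \int[Q]_z (h z * D z)) ^+ 2.
  rewrite lerXn2r ?nnegrE//.
  - by rewrite !mulr_ge0// ltW.
  - apply: mulr_ge0 => //; apply: ex_ge => // z.
    by apply: mulr_ge0; [exact: ltW|exact: normr_ge0].
  - by rewrite (le_trans _ main)// ler_wpM2l.
rewrite exprMn real_normK ?num_real// exprMn in e1.
have e2 : (A * \int[Q]_z (h z * D z)) ^+ 2 <= A ^+ 2 * (\int[Q]_z h z *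
    (a ^- n * \int[Q]_z h z * \int[Q]_z (u z - u' z) ^+ 2)).
  rewrite exprMn ler_wpM2l ?sqr_ge0// (le_trans cs)// ler_wpM2l//; exact: ltW.
have := le_trans e1 e2.
move: (\int[Q]_z h z) (\int[Q]_z (u z - u' z) ^+ 2) h_int => H X H0.
rewrite -ler_pdivlMr; last by rewrite mulr_gt0// exprn_gt0.
move/le_trans; apply; rewrite le_eqVlt; apply/orP; left; apply/eqP.
by field; rewrite !gt_eqF.
Qed.

End heat_bath.

(** * The computation tree of the blocked filter *)

Section computation_tree.
Context (R : realType) (V : finType) (d : V -> measure_display)
  (X : forall v, measurableType (d v)).
Context (KK : {set {set V}}) (KK_part : finset.partition KK [set: V]%SET).
Local Notation XX := (prod_space X).
Local Notation own := (own_block KK_part).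
Local Notation blk := (block KK).

(** The law of one block after [j + 1] steps reads the laws of the nearby blocks
one step earlier, which are independent of each other, and so on: unrolled, the
recursion is a Gibbs measure on a tree in which every block owns a separate copy
of what it reads. An inner node carries a copy of [V] and one subtree for each
block; a leaf carries a whole configuration, whose law is left arbitrary. *)
Fixpoint site (j : nat) : finType :=
  if j is j'.+1 then (V + blk * site j')%type else unit.

Fixpoint site_disp (j : nat) : site j -> measure_display :=
  match j with
  | 0 => fun _ => prod_space_display X
  | j'.+1 => fun s =>
      match s with inl v => d v | inr Ks => site_disp Ks.2 end
  end.

Fixpoint site_space (j : nat) : forall s : site j, measurableType (site_disp s) :=
  match j return forall s : site j, measurableType (site_disp s) with
  | 0 => fun _ => prod_space X
  | j'.+1 => fun s =>
      match s return measurableType (@site_disp j'.+1 s) with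
      | inl v => X v
      | inr Ks => site_space Ks.2
      end
  end.

Local Notation tree j := (prod_space (@site_space j)).

Definition subtree (j : nat) (K : blk) (x : tree j.+1) : tree j :=
  fun s => x (inr (K, s)).

Definition top (j : nat) : tree j -> XX :=
  match j return tree j -> XX with
  | 0 => fun x => x tt
  | _.+1 => fun x v => x (inl v)
  end.

(** What the root reads from its children: the coordinates of each block come
from the copy attached to that block. *)
Definition below (j : nat) (x : tree j.+1) : XX :=
  fun w => top (subtree (own w) x) w.

Lemma measurable_subtree j K : measurable_fun setT (@subtree j K).
Proof.
apply: (@measurable_prod_spaceP _ _ (@site_space j)) => s.
exact: (@measurable_coord _ _ (@site_space j.+1) (inr (K, s))).
Qed.

Lemma measurable_top j : measurable_fun setT (@top j).
Proof.
case: j => [|j]; first exact: (@measurable_coord _ _ (@site_space 0) tt).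
apply: measurable_prod_spaceP => v.
exact: (@measurable_coord _ _ (@site_space j.+1) (inl v)).
Qed.

Lemma measurable_below j : measurable_fun setT (@below j).
Proof.
apply: measurable_prod_spaceP => w.
apply: (@measurableT_comp _ _ _ _ _ _ (fun z : XX => z w) _
  (fun x : tree j.+1 => top (subtree (own w) x))); first exact: measurable_coord.
exact: measurableT_comp (@measurable_top j) (@measurable_subtree j (own w)).
Qed.

Definition root_site (j : nat) (w : V) : site j :=
  match j with 0 => tt | _.+1 => inl w end.

Fixpoint is_leaf (j : nat) : pred (site j) :=
  match j with
  | 0 => fun _ => true
  | j'.+1 => fun s => match s with inl _ => false | inr Ks => @is_leaf j' Ks.2 end
  end.

Local Notation bprod := (block_prod KK_part).
Variables (nbr : V -> {set V}) (enl : blk -> {set V}) (a : R)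
  (p : forall v, XX -> X v -> R).
Arguments p : clear implicits.
Hypotheses (nbrC : forall v w, (w \in nbr v) = (v \in nbr w)).
Hypotheses (a0 : 0 < a) (a1 : a < 1).
Hypotheses (mp : forall v, measurable_fun setT (fun xz : XX * X v => p v xz.1 xz.2))
  (pa1 : forall v x z, a <= p v x z <= 1)
  (p_local : forall v x x' z, (forall w, w \in nbr v -> x w = x' w) ->
    p v x z = p v x' z).
Arguments pa1 : clear implicits.

Definition nb_blocks (K : blk) : {set blk} :=
  [set K' | [exists v in enl K, [exists w in nbr v, own w == K']]]%SET.

(** Each site of the tree carries one transition density, equal to one if the
site cannot be reached from the root, so that sites index factors as well. *)
Fixpoint tfactor (j : nat) : blk -> site j -> tree j -> R :=
  match j return blk -> site j -> tree j -> R with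
  | 0 => fun _ _ _ => 1
  | j'.+1 => fun K s x =>
      match s with
      | inl v => if v \in enl K then p v (below x) (top x v) else 1
      | inr Ks => if Ks.1 \in nb_blocks K then
                    @tfactor j' Ks.1 Ks.2 (subtree Ks.1 x) else 1
      end
  end.

Fixpoint tsupp (j : nat) : blk -> site j -> {set site j} :=
  match j return blk -> site j -> {set site j} with
  | 0 => fun _ _ => finset.set0
  | j'.+1 => fun K s =>
      match s with
      | inl v => if v \in enl K then
           (inl v |: [set (inr (own w, root_site j' w) : site j'.+1) | w in nbr v])%SET
           else finset.set0
      | inr Ks => if Ks.1 \in nb_blocks K then
           [set (inr (Ks.1, t) : site j'.+1) | t in @tsupp j' Ks.1 Ks.2]%SET
           else finset.set0
      end
  end.

Lemma measurable_tfactor j K s : measurable_fun setT (@tfactor j K s).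
Proof.
elim: j K s => [|j IHj] K s; first exact: measurable_cst.
case: s => [v|Ks].
  have [vK|vK] := boolP (v \in enl K).
    rewrite (_ : tfactor K _ = (fun x : tree j.+1 => p v (below x) (top x v))).
      apply: (@measurableT_comp _ _ _ _ _ _ (fun xz : XX * X v => p v xz.1 xz.2) _
        (fun x : tree j.+1 => (below x, top x v))) => //.
      apply: measurable_fun_pair; first exact: measurable_below.
      apply: (@measurableT_comp _ _ _ _ _ _ (fun z : XX => z v) _ (@top j.+1)).
        exact: measurable_coord.
      exact: measurable_top.
    by apply/funext => x /=; rewrite vK.
  rewrite (_ : tfactor K _ = cst 1); first exact: measurable_cst.
  by apply/funext => x /=; rewrite (negbTE vK).
have [KK'|KK'] := boolP (Ks.1 \in nb_blocks K).
  rewrite (_ : tfactor K _ = tfactor Ks.1 Ks.2 \o @subtree j Ks.1).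
    exact: measurableT_comp (IHj _ _) (@measurable_subtree _ _).
  by apply/funext => x /=; rewrite KK'.
rewrite (_ : tfactor K _ = cst 1); first exact: measurable_cst.
by apply/funext => x /=; rewrite (negbTE KK').
Qed.

Lemma tfactor_bounds j K s (x : tree j) : a <= tfactor K s x <= 1.
Proof.
elim: j K s x => [|j IHj] K s x /=; first by rewrite (ltW a1) lexx.
by case: s => [v|Ks]; case: ifP => // _; rewrite (ltW a1) lexx.
Qed.

Lemma tfactor_supp j K s : depends_on (@tsupp j K s) (@tfactor j K s).
Proof.
elim: j K s => [|j IHj] K s x x' //=.
case: s => [v|Ks]; case: ifP => // _ xx'.
  have -> : x (inl v) = x' (inl v) by apply: (xx' (inl v)); rewrite !inE eqxx.
  apply: p_local => w wv; rewrite /below.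
  have := xx' (inr (own w, root_site j w)).
  have -> : (inr (own w, root_site j w) : site j.+1) \in
      (inl v |: [set (inr (own w, root_site j w) : site j.+1) | w in nbr v])%SET.
    by rewrite !inE; apply/orP; right; apply/imsetP; exists w.
  move=> /(_ isT); rewrite /subtree.
  by case: j IHj x x' xx' => [|j] IHj x x' xx' /= ->.
apply: IHj => t ts; apply: (xx' (inr (Ks.1, t))).
by apply/imsetP; exists t.
Qed.

(** The leaves that the root reads through consecutive neighbouring blocks; the
Gibbs measure cannot tell the other leaves apart. *)
Fixpoint adm_leaf (j : nat) : blk -> pred (site j) :=
  match j with
  | 0 => fun _ _ => true
  | j'.+1 => fun K s =>
      match s with
      | inl _ => false
      | inr Ks => (Ks.1 \in nb_blocks K) && @adm_leaf j' Ks.1 Ks.2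
      end
  end.

Lemma adm_is_leaf j K s : @adm_leaf j K s -> is_leaf s.
Proof.
by elim: j K s => [|j IHj] K s //=; case: s => // Ks /andP[_ /IHj].
Qed.

Definition used_sites j K : {set site j} := [set s | ~~ is_leaf s || adm_leaf K s]%SET.

Lemma tsupp_used j K s : @tsupp j K s \subset used_sites j K.
Proof.
elim: j K s => [|j IHj] K s /=; first exact: finset.sub0set.
case: s => [v|Ks]; case: ifP => [H|_]; try exact: finset.sub0set.
  apply/fintype.subsetP => t; rewrite !inE => /orP[/eqP ->//|/imsetP[w wv ->{t}]] /=.
  have -> /= : own w \in nb_blocks K.
    by rewrite inE; apply/existsP; exists v; rewrite H/=; apply/existsP; exists w; rewrite wv/=.
  by case: j {IHj} => [|j] /=; rewrite ?orbT.
apply/fintype.subsetP => _ /imsetP[t /(fintype.subsetP (IHj _ _)) + ->].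
by rewrite !inE/= H.
Qed.

Lemma top_used j K I (f : XX -> R) : depends_on I f -> depends_on (used_sites j K) (fun x => f (@top j x)).
Proof.
move=> fI x x' xx'; apply: fI => v _; case: j x x' xx' => [|j] x x' xx' /=.
  by rewrite (xx' tt)// inE.
by rewrite (xx' (inl v))// inE.
Qed.

Definition block_factor (K : blk) (x z : XX) : R := \prod_(v in enl K) p v x (z v).

Lemma block_factor_bounds K x z : a ^+ #|enl K| <= block_factor K x z <= 1.
Proof.
apply/andP; split.
  rewrite -prodr_const; apply: ler_prod => v _; rewrite (ltW a0)/=.
  by case/andP: (pa1 v x (z v)).
apply: prodr_ile1 => v; case/andP: (pa1 v x (z v)) => pa ->.
by rewrite (le_trans (ltW a0)).
Qed.

Lemma bmeas_block_factor K : bmeas (fun xz : XX * XX => block_factor K xz.1 xz.2).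
Proof.
apply: bmeas_prod => v _; apply: (@bmeasP _ _ _ _ 1) => [|xz]; last first.
  by case/andP: (pa1 v xz.1 (xz.2 v)) => pa ?; rewrite ger0_norm// (le_trans (ltW a0)).
apply: (@measurableT_comp _ _ _ _ _ _ (fun xz : XX * X v => p v xz.1 xz.2) _
  (fun xz : XX * XX => (xz.1, xz.2 v))) => //.
apply: measurable_fun_pair; first exact: measurable_fst.
apply: (@measurableT_comp _ _ _ _ _ _ (fun z : XX => z v) _ snd).
  exact: measurable_coord.
exact: measurable_snd.
Qed.

Lemma block_factor_dep K z : blocks_dep KK_part (enum (nb_blocks K)) (block_factor K ^~ z).
Proof.
move=> x x' xx'; apply: eq_bigr => v vK; apply: p_local => w wv; apply: xx'.
rewrite mem_enum inE; apply/existsP; exists v; rewrite vK/=.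
by apply/existsP; exists w; rewrite wv/=.
Qed.

(** Predicting, then correcting on one enlarged block, has this density with
respect to the product of the corrected reference laws. It is an expectation
under the previous law, so it inherits the sampling error of that law. *)
Definition step_density (rho : probability XX R) K z : R := \int[rho]_x block_factor K x z.

Lemma bmeas_step_density rho K : bmeas (step_density rho K).
Proof. exact: (bmeas_ex1 rho (F := fun xz => block_factor K xz.1 xz.2) (bmeas_block_factor K)). Qed.

Lemma step_density_bounds rho K z : a ^+ #|enl K| <= step_density rho K z <= 1.
Proof.
have bF := bmeas_sec2 z (bmeas_block_factor K).
by apply/andP; split; [apply: ex_ge bF _|apply: ex_le bF _] => x;
  case/andP: (block_factor_bounds K x z).
Qed.

Lemma step_density_gt0 rho K z : 0 < step_density rho K z.
Proof.
by case/andP: (step_density_bounds rho K z) => + _; apply: lt_le_trans; exact: exprn_gt0.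
Qed.

Definition step (m : forall v, probability (X v) R) K rho : probability XX R :=
  reweight (prod_probability m) (bmeas_measurable (bmeas_step_density rho K))
    (fun z => ltW (step_density_gt0 rho K z)).

Lemma ex_step m K rho phi : bmeas phi ->
  \int[step m K rho]_z phi z =
  (\int[prod_probability m]_z (step_density rho K z * phi z)) /
  \int[prod_probability m]_z step_density rho K z.
Proof.
move=> bphi; rewrite ex_reweight//.
- by congr (_ / _); apply: eq_ex => z; rewrite mulrC.
- exact: bmeas_step_density.
- apply: (@lt_le_trans _ _ (a ^+ #|enl K|)); first exact: exprn_gt0.
  apply: ex_ge; first exact: bmeas_step_density.
  by move=> z; case/andP: (step_density_bounds rho K z).
Qed.

Let bfac j K (c : site j) : bmeas (tfactor K c).
Proof.
apply: (@bmeasP _ _ _ _ 1) => [|x]; first exact: measurable_tfactor.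
case/andP: (tfactor_bounds K c x) => ax ?.
by rewrite ger0_norm// (le_trans (ltW a0)).
Qed.

Let bgib j K : bmeas (gibbs (tfactor (j := j) K)).
Proof. by apply: bmeas_prod => c _. Qed.

Section tree_laws.
Variable m : nat -> forall v, probability (X v) R.

Fixpoint block_laws (lam : blk -> probability XX R) (j : nat) : blk -> probability XX R :=
  if j is j'.+1 then fun K => step (m j') K (bprod (block_laws lam j'))
  else lam.

Variable lam : bool -> blk -> probability XX R.

(** Reference laws of the tree: [sigma] selects which of two families the law
of each leaf is taken from. *)
Fixpoint ref (j : nat) : blk -> (site j -> bool) ->
    forall s : site j, probability (site_space s) R :=
  match j return blk -> (site j -> bool) -> forall s : site j, probability (site_space s) R with
  | 0 => fun K sigma s => lam (sigma s) K
  | j'.+1 => fun K sigma s =>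
      match s return probability (@site_space j'.+1 s) R with
      | inl v => m j' v
      | inr Ks => @ref j' Ks.1 (fun t => sigma (inr (Ks.1, t))) Ks.2
      end
  end.

Lemma ref_notin j K (sigma sigma' : site j -> bool) s :
  (is_leaf s -> sigma s = sigma' s) -> ref K sigma s = ref K sigma' s.
Proof.
elim: j K sigma sigma' s => [|j IHj] K sigma sigma' s sE /=; first by rewrite sE.
by case: s sE => // -[K' s] sE; apply: IHj => /sE.
Qed.

Lemma gibbs_fac0 K (x : tree 0) : gibbs (tfactor K) x = 1.
Proof. by rewrite /gibbs big1. Qed.

Lemma gibbs_facS j K (x : tree j.+1) : gibbs (tfactor K) x =
  block_factor K (below x) (top x) * \prod_(K' in nb_blocks K) gibbs (tfactor K') (subtree K' x).
Proof.
rewrite /gibbs big_sumType; congr (_ * _).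
  by rewrite /block_factor [RHS]big_mkcond.
rewrite -(pair_bigA _ (fun K' c => tfactor K (inr (K', c) : site j.+1) x)).
rewrite [RHS]big_mkcond; apply: eq_bigr => K' _.
have [KK'|KK'] := boolP (K' \in nb_blocks K).
  by apply: eq_bigr => c _; rewrite /tfactor KK'.
by rewrite big1// => c _; rewrite /tfactor (negbTE KK').
Qed.

Definition graft j K (x : tree j.+1) (t : tree j) : tree j.+1 :=
  fun s => match s return @site_space j.+1 s with
           | inl v => x (inl v)
           | inr Ks => if Ks.1 == K then t Ks.2 else x (inr Ks)
           end.

Lemma subtree_graft j K (x : tree j.+1) (t : tree j) : subtree K (graft K x t) = t.
Proof. by apply: functional_extensionality_dep => s; rewrite /subtree/= eqxx. Qed.

Lemma subtree_graft_neq j K K' (x : tree j.+1) (t : tree j) : K' != K ->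
  subtree K' (graft K x t) = subtree K' x.
Proof.
move=> /negbTE KK'; apply: functional_extensionality_dep => s.
by rewrite /subtree/= KK'.
Qed.

Lemma below_graft j K (x : tree j.+1) (t : tree j) :
  below (graft K x t) = mix (val K) (below x) (top t).
Proof.
apply: functional_extensionality_dep => w; rewrite /below /mix mem_own.
by have [<-|wK] := eqVneq (own w) K; rewrite ?subtree_graft ?subtree_graft_neq.
Qed.

Lemma measurable_unsub j K : measurable_fun setT (fun t : tree j => graft K point t).
Proof.
apply: (@measurable_prod_spaceP _ _ (@site_space j.+1)) => -[v|[K' s]].
  exact: measurable_cst.
case: (eqVneq K' K) => [->|KK']; last first.
  rewrite (_ : (fun _ => _) = fun=> (point : tree j.+1) (inr (K', s))).
    exact: measurable_cst.
  by apply/funext => t; rewrite /graft (negbTE KK').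
rewrite (_ : (fun _ => _) = fun t : tree j => t s); last first.
  by apply/funext => t; rewrite /graft eqxx.
exact: (@measurable_coord _ _ (@site_space j) s).
Qed.

(** Subtrees are independent under the reference laws, so one of them may be
redrawn on its own. *)
Lemma ref_graft j K sigma K' (F : tree j.+1 -> R) : bmeas F ->
  \int[prod_probability (ref K sigma)]_x F x =
  \int[prod_probability (ref K sigma)]_x
    \int[prod_probability (@ref j K' (fun t => sigma (inr (K', t))))]_t F (graft K' x t).
Proof.
move=> bF; pose J := [set (inr (K', s) : site j.+1) | s in [set: site j]%SET]%SET.
rewrite (@prod_resample _ _ _ _ (ref K sigma) _ _
  (prod_probability (ref K' (fun t => sigma (inr (K', t))))) J
  (fun t => graft K' point t)
  (@measurable_unsub j K') _ F bF).
  apply: eq_ex => x; apply: eq_ex => t; congr F.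
  apply: functional_extensionality_dep => -[v|[K'' s]].
    by rewrite /mix; case: ifP => // /imsetP[].
  rewrite /mix; case: ifPn => [/imsetP[s' _ [-> ->]]|sJ]; first by rewrite /graft/= eqxx.
  rewrite /graft/=; case: eqVneq => // KK'; exfalso; move: sJ.
  by rewrite KK' => /imsetP; apply; exists s.
move=> A mA.
rewrite (_ : mkset _ = box (fun s : site j => A (inr (K', s)))).
  transitivity ((prod_probability (ref K' (fun t => sigma (inr (K', t)))) :
     probability _ R) (box (fun s => A (inr (K', s))))); first by [].
  rewrite prod_probability_box//; last by move=> s; exact: mA.
  rewrite big_imset/=; last by move=> s s' _ _ [].
  by apply: eq_big => // s; rewrite !inE.
apply/seteqP; split=> t /= H s.
  have : A (inr (K', s)) (graft K' point t (inr (K', s))).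
    by apply: H; apply/imsetP; exists s.
  by rewrite /graft/= eqxx.
by move=> /imsetP[s' _ ->]; rewrite /graft/= eqxx; exact: H.
Qed.

Lemma ref_top j K sigma (F : XX -> R) : bmeas F ->
  \int[prod_probability (@ref j.+1 K sigma)]_x F (top x) =
  \int[prod_probability (m j)]_z F z.
Proof.
move=> bF; pose J := [set (inl v : site j.+1) | v in [set: V]%SET]%SET.
pose f (z : XX) : tree j.+1 := fun s => match s return @site_space j.+1 s with
  | inl v => z v | inr Ks => point end.
have mf : measurable_fun setT f.
  apply: (@measurable_prod_spaceP _ _ (@site_space j.+1)) => -[v|Ks] /=.
    exact: measurable_coord.
  exact: measurable_cst.
rewrite (@prod_marginal _ _ _ _ (ref K sigma) _ _ (prod_probability (m j)) J f mf _
  (fun x => F (top x))) //.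
- move=> A mA; rewrite (_ : mkset _ = box (fun v => A (inl v : site j.+1))).
    transitivity ((prod_probability (m j) :
       probability _ R) (box (fun v => A (inl v : site j.+1)))); first by [].
    rewrite prod_probability_box//; last by move=> v; exact: mA.
    rewrite big_imset/=; last by move=> s s' _ _ [].
    by apply: eq_big => // s; rewrite !inE.
  apply/seteqP; split=> t /= H s; last by move=> /imsetP[v _ ->]; exact: H.
  by apply: (H (inl s)); apply/imsetP; exists s.
- by apply: bmeas_comp bF _; exact: measurable_top.
- move=> x x' xx'; congr F; apply: functional_extensionality_dep => v.
  by apply: (xx' (inl v)); apply/imsetP; exists v.
Qed.


Definition mass j K (b : bool) : R :=
  \int[prod_probability (@ref j K (fun=> b))]_x gibbs (tfactor K) x.

Let measurable_gibbs_subtree j K : bmeas (fun x : tree j.+1 => gibbs (tfactor K) (subtree K x)).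
Proof. exact: (bmeas_comp (@bgib j K) (@measurable_subtree j K)). Qed.

Let bmeas_pair j (Psi : XX * XX -> R) : bmeas Psi ->
  bmeas (fun x : tree j.+1 => Psi (top x, below x)).
Proof.
move=> bPsi; apply: bmeas_comp bPsi _; apply: measurable_fun_pair.
  exact: measurable_top.
exact: measurable_below.
Qed.

Let bmeas_row (K : blk) (P : probability XX R) (Psi : XX * XX -> R) : bmeas Psi ->
  bmeas (fun zx : XX * XX => \int[P]_y Psi (zx.1, mix (val K) zx.2 y)).
Proof.
move=> bPsi.
apply: (bmeas_ex2 P (F := fun zxy : (XX * XX) * XX => Psi (zxy.1.1, mix (val K) zxy.1.2 zxy.2))).
apply: bmeas_comp bPsi _; apply: measurable_fun_pair.
  exact: measurableT_comp measurable_fst measurable_fst.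
apply: measurable_mix_comp; last exact: measurable_snd.
exact: measurableT_comp measurable_snd measurable_fst.
Qed.

Section integrate_children.
Variables (j : nat) (b : bool).
Hypothesis child : forall K phi, bmeas phi ->
  \int[prod_probability (@ref j K (fun=> b))]_t (gibbs (tfactor K) t * phi (top t)) =
  mass j K b * \int[block_laws (lam b) j K]_z phi z.

(** Subtrees are integrated out one block at a time: each contributes its mass
and leaves behind the law of its block under the recursion. *)
Lemma integrate_children K0 s (Psi : XX * XX -> R) : uniq s -> bmeas Psi ->
  (forall z, blocks_dep KK_part s (fun xi => Psi (z, xi))) ->
  \int[prod_probability (@ref j.+1 K0 (fun=> b))]_x
    (Psi (top x, below x) * \prod_(K <- s) gibbs (tfactor K) (subtree K x)) =
  (\prod_(K <- s) mass j K b) *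
  \int[prod_probability (m j)]_z
    \int[bprod (block_laws (lam b) j)]_xi Psi (z, xi).
Proof.
elim: s Psi => [|K s IHs] Psi us bPsi Psis.
  rewrite big_nil mul1r.
  transitivity (\int[prod_probability (@ref j.+1 K0 (fun=> b))]_x Psi (top x, point)).
    by apply: eq_ex => x; rewrite big_nil mulr1; exact: Psis.
  rewrite (@ref_top j K0 (fun=> b) (fun z => Psi (z, point)) (bmeas_sec2 point bPsi)).
  apply: eq_ex => z; rewrite -[LHS](ex_cst (bprod (block_laws (lam b) j))).
  by apply: eq_ex => xi; exact: Psis.
case/andP: us => Ks us.
pose Psi' (zx : XX * XX) := \int[block_laws (lam b) j K]_y Psi (zx.1, mix (val K) zx.2 y).
have bPsi' : bmeas Psi' by exact: bmeas_row.
have Psi's z : blocks_dep KK_part s (fun xi => Psi' (z, xi)).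
  move=> x x' xx'; apply: eq_ex => y.
  exact: (blocks_dep_mix y (Psis z)).
pose rest (x : tree j.+1) := \prod_(K' <- s) gibbs (tfactor K') (subtree K' x) : R.
have brest : bmeas rest by apply: bmeas_prod => K' _.
pose G (x : tree j.+1) := Psi (top x, below x) * \prod_(K' <- K :: s) gibbs (tfactor K') (subtree K' x) : R.
have bG : bmeas G.
  apply: bmeasM; first exact: bmeas_pair.
  by apply: bmeas_prod => K' _.
rewrite -/(G _) (@ref_graft j K0 (fun=> b) K G bG).
transitivity (\int[prod_probability (@ref j.+1 K0 (fun=> b))]_x
    (mass j K b * (Psi' (top x, below x) * rest x))).
  apply: eq_ex => x.
  transitivity (\int[prod_probability (@ref j K (fun=> b))]_t
    (gibbs (tfactor K) t * (rest x * Psi (top x, mix (val K) (below x) (top t))))).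
    apply: eq_ex => t; rewrite /G below_graft big_cons subtree_graft.
    rewrite (_ : \prod_(K' <- s) gibbs (tfactor K') (subtree K' (graft K x t)) = rest x).
      rewrite (_ : top (graft K x t) = top x); last first.
        exact: functional_extensionality_dep.
      by rewrite mulrCA [rest x * _]mulrC.
    rewrite /rest !big_seq; apply: eq_bigr => K' K's; rewrite subtree_graft_neq//.
    by apply: contraNneq Ks => <-.
  have bin : bmeas (fun y => Psi (top x, mix (val K) (below x) y)).
    exact: (bmeas_mix2 K (below x) (bmeas_sec1 (top x) bPsi)).
  rewrite (@child K (fun y => rest x * Psi (top x, mix (val K) (below x) y))); last first.
    exact: bmeasZ.
  rewrite exZl//; congr (_ * _); rewrite mulrC; congr (_ * _).
rewrite exZl; last by apply: bmeasM => //; exact: bmeas_pair.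
rewrite (IHs Psi' us bPsi' Psi's) big_cons mulrA; congr (_ * _).
apply: eq_ex => z; symmetry.
exact: (@block_prod_resample _ _ _ _ _ KK_part (block_laws (lam b) j) K
  (fun xi => Psi (z, xi)) (bmeas_sec1 z bPsi)).
Qed.

End integrate_children.

(** The recursion for the block laws is the marginal at the root of a Gibbs
measure on the tree. *)
Lemma tree_root_law j K b phi : bmeas phi ->
  \int[prod_probability (@ref j K (fun=> b))]_t (gibbs (tfactor K) t * phi (top t)) =
  mass j K b * \int[block_laws (lam b) j K]_z phi z.
Proof.
elim: j K phi => [|j IHj] K phi bphi.
  have -> : mass 0 K b = 1.
    by rewrite /mass (eq_ex _ (g := fun=> 1)) ?ex_cst// => x; exact: gibbs_fac0.
  rewrite mul1r; transitivity (\int[prod_probability (@ref 0 K (fun=> b))]_t phi (top t)).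
    by apply: eq_ex => t; rewrite gibbs_fac0 mul1r.
  exact: (@prod_coord _ _ _ (@site_space 0) (@ref 0 K (fun=> b)) tt phi bphi).
have main psi : bmeas psi ->
    \int[prod_probability (@ref j.+1 K (fun=> b))]_t (gibbs (tfactor K) t * psi (top t)) =
    (\prod_(K' <- enum (nb_blocks K)) mass j K' b) *
    \int[prod_probability (m j)]_z
      (step_density (bprod (block_laws (lam b) j)) K z * psi z).
  move=> bpsi.
  pose Psi (zx : XX * XX) := block_factor K zx.2 zx.1 * psi zx.1.
  have bPsi : bmeas Psi.
    apply: bmeasM; last exact: bmeas_comp bpsi measurable_fst.
    apply: (bmeas_comp (bmeas_block_factor K) (g := fun zx : XX * XX => (zx.2, zx.1))).
    by apply: measurable_fun_pair; [exact: measurable_snd|exact: measurable_fst].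
  have Psis z : blocks_dep KK_part (enum (nb_blocks K)) (fun xi => Psi (z, xi)).
    by move=> x x' xx'; congr (_ * _); exact: block_factor_dep.
  transitivity (\int[prod_probability (@ref j.+1 K (fun=> b))]_x
    (Psi (top x, below x) *
     \prod_(K' <- enum (nb_blocks K)) gibbs (tfactor K') (subtree K' x))).
    by apply: eq_ex => x; rewrite gibbs_facS big_enum/= /Psi/= mulrAC.
  rewrite (integrate_children (j := j) (b := b) IHj K (enum_uniq _) bPsi Psis).
  congr (_ * _); apply: eq_ex => z; rewrite /Psi/= exZr//.
  exact: (bmeas_sec2 z (bmeas_block_factor K)).
have mE : mass j.+1 K b = (\prod_(K' <- enum (nb_blocks K)) mass j K' b) *
    \int[prod_probability (m j)]_z
      step_density (bprod (block_laws (lam b) j)) K z.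
  have := main (fun=> 1); move=> /(_ (bmeas_cst _ _)).
  rewrite (eq_ex _ (g := gibbs (tfactor K))) => [|x]; last by rewrite mulr1.
  move=> H; apply: (etrans H); congr (_ * _); apply: eq_ex => z; by rewrite mulr1.
rewrite (main phi bphi) mE -/block_laws ex_step// -mulrA; congr (_ * _).
rewrite mulrC divfK// gt_eqF//.
apply: (@lt_le_trans _ _ (a ^+ #|enl K|)); first exact: exprn_gt0.
apply: ex_ge; first exact: bmeas_step_density.
by move=> z; case/andP: (step_density_bounds
  (bprod (block_laws (lam b) j)) K z).
Qed.

Lemma tree_root_ex j K b phi : bmeas phi ->
  gibbs_ex (tfactor K) (@ref j K (fun=> b)) (fun t => phi (top t)) =
  \int[block_laws (lam b) j K]_z phi z.
Proof.
move=> bphi; rewrite /gibbs_ex tree_root_law// mulrC mulKf// gt_eqF//.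
apply: (ex_gibbs_gt0 (phi := tfactor (j := j) K) (a := a)) => //.
- exact: measurable_tfactor.
- exact: tfactor_bounds.
Qed.

End tree_laws.

Lemma step_mfam d0 (S : measurableType d0) m K (rho : S -> probability XX R) :
  mfam rho -> mfam (fun s => step m (K : blk) (rho s)).
Proof.
move=> hrho d' S' q F mq bF.
pose dens (sz : S' * XX) : R := step_density (rho (q sz.1)) K sz.2.
have bdens : bmeas dens.
  apply: (mfam_bmeas (F := fun szx : (S' * XX) * XX => block_factor K szx.2 szx.1.2)
    hrho (p := fun sz : S' * XX => q sz.1)).
    exact: measurableT_comp mq measurable_fst.
  apply: (bmeas_comp (bmeas_block_factor K)
    (g := fun szx : (S' * XX) * XX => (szx.2, szx.1.2))).
  apply: measurable_fun_pair; first exact: measurable_snd.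
  exact: measurableT_comp measurable_snd measurable_fst.
have bden : bmeas (fun s => \int[prod_probability m]_z dens (s, z)) by exact: bmeas_ex2.
have bnum : bmeas (fun s => \int[prod_probability m]_z (dens (s, z) * F (s, z))).
  by apply: (bmeas_ex2 _ (F := fun sz => dens sz * F sz)); exact: bmeasM.
have bq : bmeas (fun s => (\int[prod_probability m]_z (dens (s, z) * F (s, z))) *
    (\int[prod_probability m]_z dens (s, z))^-1).
  apply: bmeasM => //; apply: (bmeasV (c := a ^+ #|enl K|)) => //.
    exact: exprn_gt0.
  move=> s; apply: ex_ge; first exact: (bmeas_sec1 s bdens).
  by move=> z; case/andP: (step_density_bounds (rho (q s)) K z).
rewrite (_ : (fun _ => _) = (fun s => (\int[prod_probability m]_z (dens (s, z) * F (s, z))) *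
    (\int[prod_probability m]_z dens (s, z))^-1)); first by case: bq.
by apply/funext => s; rewrite ex_step//; exact: bmeas_sec1.
Qed.

Lemma block_laws_mfam d0 (S : measurableType d0) m
    (lam : S -> blk -> probability XX R) j K :
  (forall K, mfam (lam^~ K)) -> mfam (fun s => block_laws m (lam s) j K).
Proof.
move=> hlam; elim: j K => [//|j IHj] K /=.
by apply: step_mfam; exact: block_prod_mfam.
Qed.

Section counting.
Variables (kappa : R) (D n Db : nat) (r : R).
Hypotheses (kappa0 : 0 < kappa).
Hypotheses (nbrD : forall v, (#|nbr v| <= D)%N) (enln : forall K, (#|enl K| <= n)%N)
  (nbDb : forall K, (#|nb_blocks K| <= Db)%N).
Hypotheses (r01 : 0 <= r < 1)
  (ratio_r : (1 - a) * (D%:R / kappa + D%:R * kappa + D%:R ^+ 2) <= r).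

(** A potential that decays geometrically from the leaves to the root: the
comparison theorem then gains a factor [kappa] for each generation. *)
Fixpoint potential (j : nat) : site j -> R :=
  match j with
  | 0 => fun _ => 1
  | j'.+1 => fun s =>
      match s with inl _ => kappa ^+ j'.+1 | inr Ks => @potential j' Ks.2 end
  end.

Lemma potential_gt0 j (s : site j) : 0 < potential s.
Proof.
elim: j s => [//|j IHj] /= [v|Ks] => //; exact: exprn_gt0.
Qed.

Lemma potential_leaf j (s : site j) : is_leaf s -> potential s = 1.
Proof. by elim: j s => [//|j IHj] /= [//|Ks] /IHj. Qed.

Lemma potential_root j w : potential (root_site j w) = kappa ^+ j.
Proof. by case: j. Qed.

Lemma card_adm_leaf j K : (#|[pred s | @adm_leaf j K s]| <= Db ^ j)%N.
Proof.
elim: j K => [|j IHj] K.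
  by rewrite expn0 (leq_trans (max_card _))// card_unit.
rewrite -sum1_card big_mkcond/= big_sumType/= big1 ?add0n//.
rewrite -(pair_bigA _ (fun K' s => if (inr (K', s) : site j.+1) \in
  [pred s | @adm_leaf j.+1 K s] then 1 else 0)%N)/=.
rewrite (bigID (mem (nb_blocks K)))/= [X in (_ + X)%N]big1 ?addn0; last first.
  by move=> K' /negbTE KK'; rewrite big1// => s _; rewrite inE/= KK'.
apply: (@leq_trans (\sum_(K' in nb_blocks K) Db ^ j)).
  apply: leq_sum => K' KK'; rewrite (leq_trans _ (IHj K'))// -sum1_card [leqRHS]big_mkcond/=.
  by apply: leq_sum => s _; rewrite inE/= KK'.
by rewrite sum_nat_const expnS leq_mul2r nbDb orbT.
Qed.

(** A leaf is read only by the enlarged block right above it. *)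
Lemma card_leaf_factors j K l : is_leaf l ->
  (#|[pred c | l \in @tsupp j K c]| <= n)%N.
Proof.
elim: j K l => [|j IHj] K l ll.
  by rewrite eq_card0// => c; rewrite !inE.
case: l ll => [//|[K' s]] /= ls.
rewrite -sum1_card big_mkcond/= big_sumType/=.
have second : (\sum_(c : blk * site j) (if inr c \in [pred c | inr (K', s) \in @tsupp j.+1 K c] then 1 else 0)
    <= #|[pred c | s \in @tsupp j K' c]|)%N.
  rewrite -(pair_bigA _ (fun K'' t => if (inr (K'', t) : site j.+1) \in
    [pred c | inr (K', s) \in @tsupp j.+1 K c] then 1 else 0)%N)/=.
  rewrite (bigD1 K')//= [X in (_ + X <= _)%N]big1 ?addn0.
    rewrite -sum1_card [leqRHS]big_mkcond/=; apply: leq_sum => t _.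
    rewrite inE/=; case: ifP => // + ; case: ifP => [_ /imsetP[t' + [->]]|_]; last by rewrite inE.
    by rewrite inE => ->.
  move=> K'' K''K'; rewrite big1// => t _; rewrite inE/=.
  case: ifP => // +; case: ifP => [_ /imsetP[t' _ [e _]]|_]; last by rewrite inE.
  by rewrite e eqxx in K''K'.
have first_ : (\sum_(v : V) (if inl v \in [pred c | inr (K', s) \in @tsupp j.+1 K c] then 1 else 0) <=
    if j is 0 then n else 0)%N.
  case: j s ls {IHj second} => [|j] s ls.
    rewrite (leq_trans _ (enln K))// -sum1_card [leqRHS]big_mkcond/=.
    apply: leq_sum => v _; rewrite inE/=; case: ifP => // +.
    by case: ifP; rewrite ?inE.
  rewrite big1// => v _; rewrite inE/=; case: ifP => // +; case: ifP => _; last by rewrite inE.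
  rewrite !inE/= => /imsetP[w _ [_ e]].
  by rewrite e in ls.
apply: (leq_trans (leq_add first_ second)).
case: j s ls IHj {first_ second} => [|j] s ls IHj; last by rewrite add0n; exact: IHj.
by rewrite -[leqRHS]addn0 leq_add2l leqn0 eq_card0// => c; rewrite !inE.
Qed.

Let influence j K (i : site j) : R :=
  \sum_(c | i \in tsupp K c) \sum_(t in tsupp K c | t != i) potential t.

Lemma sum_imset_le (I J : finType) (h : I -> J) (B : {set I}) (F : J -> R) (Q : pred J) :
  (forall t, 0 <= F t) ->
  \sum_(t in (h @: B)%SET | Q t) F t <= \sum_(w in B | Q (h w)) F (h w).
Proof.
move=> F0; rewrite [leRHS](partition_big h (fun t => (t \in (h @: B)%SET) && Q t)).
  apply: ler_sum => t /andP[/imsetP[w wB te] Qt].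
  rewrite (bigD1 w)/=; last by rewrite wB te eqxx -te Qt.
  rewrite te lerDl; apply: sumr_ge0 => ? _; exact: F0.
by move=> w /andP[wB Qw]; rewrite imset_f.
Qed.

Lemma sum_setU1_le (J : finType) (x : J) (A : {set J}) (F : J -> R) (Q : pred J) :
  (forall t, 0 <= F t) ->
  \sum_(t in (x |: A)%SET | Q t) F t <= (Q x)%:R * F x + \sum_(t in A | Q t) F t.
Proof.
move=> F0; have -> : (Q x)%:R * F x = \sum_(t | (t == x) && Q t) F t.
  rewrite (eq_bigl (fun t => Q x && (t == x))) => [|t]; last first.
    by rewrite andbC; case: eqP => [->|]; rewrite ?andbT ?andbF.
  case: (Q x); first by rewrite mul1r big_pred1_eq.
  by rewrite mul0r big_pred0.
rewrite [leLHS]big_mkcond [X in _ <= X + _]big_mkcond [X in _ <= _ + X]big_mkcond.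
rewrite -big_split/=; apply: ler_sum => t _; rewrite !inE.
have := F0 t; case: (t == x); case: (t \in A); case: (Q t) => //= ?;
  by rewrite ?addr0 ?add0r// lerDl.
Qed.

Let pot0 j (t : site j) : 0 <= potential t. Proof. exact/ltW/potential_gt0. Qed.

Let root_factor j K v i : \sum_(t in @tsupp j.+1 K (inl v) | t != i) potential t <=
  (inl v != i)%:R * kappa ^+ j.+1 + D%:R * kappa ^+ j.
Proof.
have D0 : 0 <= D%:R * kappa ^+ j by rewrite mulr_ge0// exprn_ge0// ltW.
have D1 : 0 <= (inl v != i)%:R * kappa ^+ j.+1 by rewrite mulr_ge0// exprn_ge0// ltW.
have [vK|vK] := boolP (v \in enl K); last first.
  rewrite big_pred0 ?addr_ge0// => t.
  by rewrite /tsupp (negbTE vK) inE.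
rewrite (_ : tsupp K (inl v : site j.+1) = ((inl v : site j.+1) |:
    [set (inr (own w, root_site j w) : site j.+1) | w in nbr v])%SET); last first.
  by rewrite /tsupp vK.
apply: (le_trans (sum_setU1_le _ _ _ (@pot0 j.+1))).
rewrite lerD2l (le_trans (sum_imset_le _ _ _ (@pot0 j.+1)))//.
apply: (@le_trans _ _ (\sum_(w in nbr v) kappa ^+ j)).
  rewrite [leLHS]big_mkcondr/=; apply: ler_sum => w _; case: ifP => _.
    by rewrite potential_root.
  by rewrite exprn_ge0// ltW.
by rewrite sumr_const -[leLHS]mulr_natl ler_wpM2r ?exprn_ge0 ?(ltW kappa0)// ler_nat.
Qed.

Let ratio : R := D%:R / kappa + D%:R * kappa + D%:R ^+ 2.

Let influence_bound j K (i : site j) : ~~ is_leaf i ->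
  influence K i <= match j return site j -> R with
    | 0 => fun _ => 0
    | j'.+1 => fun i => match i with
                        | inl _ => D%:R * kappa ^+ j'
                        | inr Ks => ratio * potential Ks.2
                        end
    end i.
Proof.
have k0 n' : 0 <= kappa ^+ n' by rewrite exprn_ge0// ltW.
elim: j K i => [//|j IHj] K i ni.
rewrite /influence [leLHS]big_mkcond [leLHS]big_sumType.
pose F c := if i \in tsupp K c
  then \sum_(t in tsupp K c | t != i) potential t else 0.
rewrite -[leLHS]/(\sum_(v : V) F (inl v) + \sum_(Kc : blk * site j) F (inr Kc)).
case: i ni @F => [w|[K' s]] ni F.
  rewrite [X in _ + X]big1 ?addr0; last first.
    move=> Kc _; rewrite /F/=; case: ifP => //; case: ifP => _; last by rewrite inE.
    by move=> /imsetP[].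
  rewrite (bigD1 w)//= [X in _ + X]big1 ?addr0; last first.
    move=> v vw; rewrite /F; case: ifP => //.
    rewrite /tsupp; case: ifP => _; last by rewrite inE.
    rewrite !inE => /orP[/eqP[e]|/imsetP[]//].
    by rewrite e eqxx in vw.
  rewrite /F; case: ifP => _; last by rewrite mulr_ge0.
  by rewrite (le_trans (root_factor _ _ _))// eqxx mul0r add0r.
have second : \sum_(Kc : blk * site j) F (inr Kc) <= influence K' s.
  rewrite -(pair_bigA _ (fun K'' c => F (inr (K'', c))))/=.
  rewrite (bigD1 K')//= [X in _ + X]big1 ?addr0; last first.
    move=> K'' K''K'; rewrite big1// => c _; rewrite /F.
    case: ifP => //; rewrite /tsupp -/tsupp; case: ifP => _; last by rewrite inE.
    by move=> /imsetP[t _ [e _]]; rewrite e eqxx in K''K'.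
  rewrite [leRHS]big_mkcond/=; apply: ler_sum => c _; rewrite /F.
  rewrite (_ : tsupp K (inr (K', c) : site j.+1) = if K' \in nb_blocks K then
    [set (inr (K', t) : site j.+1) | t in tsupp K' c]%SET else finset.set0)//.
  have [_|_] := boolP (K' \in nb_blocks K); last first.
    by rewrite inE; case: ifP => // _; apply: sumr_ge0.
  case: ifP => [/imsetP[t ts [->]]|_]; last by case: ifP => // _; apply: sumr_ge0.
  rewrite ts (le_trans (sum_imset_le _ _ _ (@pot0 j.+1)))//.
  rewrite le_eqVlt; apply/orP; left; apply/eqP; apply: eq_bigl => t'.
  by congr (_ && ~~ _); apply/eqP/eqP => [[]|->].
have first_ v : F (inl v) <= if (v \in enl K) && [exists w in nbr v, root_site j w == s]
    then kappa ^+ j.+1 + D%:R * kappa ^+ j else 0.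
  have r0 : 0 <= kappa ^+ j.+1 + D%:R * kappa ^+ j by rewrite addr_ge0// mulr_ge0.
  rewrite /F; case: ifP => [|_]; last by case: ifP.
  rewrite {1}/tsupp; case: ifP => vK; last by rewrite inE.
  rewrite !inE/= => /imsetP[w wv [_ e]].
  have -> /= : [exists w in nbr v, root_site j w == s].
    by apply/existsP; exists w; rewrite wv e eqxx.
  by rewrite (le_trans (root_factor _ _ _))// lerD2r mul1r.
have first_sum : \sum_(v : V) F (inl v) <= \sum_(v : V)
    (if (v \in enl K) && [exists w in nbr v, root_site j w == s]
     then kappa ^+ j.+1 + D%:R * kappa ^+ j else 0).
  by apply: ler_sum => v _; exact: first_.
apply: (le_trans (lerD first_sum second)).
have IH := IHj K' s ni.
clear F second first_ first_sum.
case: j s ni IHj IH => [//|j] s ni IHj.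
case: s ni => [w|Ks] ni IH /=; last first.
  rewrite big1 ?add0r// => v _; case: ifP => // /andP[_ /existsP[w]].
  by rewrite andbC => /andP[/eqP].
have sw : \sum_v (if (v \in enl K) && [exists w0 in nbr v, (root_site j.+1 w0) == inl w]
      then kappa ^+ j.+2 + D%:R * kappa ^+ j.+1 else 0)
    <= D%:R * (kappa ^+ j.+2 + D%:R * kappa ^+ j.+1).
  have r0 : 0 <= kappa ^+ j.+2 + D%:R * kappa ^+ j.+1 by rewrite addr_ge0// mulr_ge0.
  apply: (@le_trans _ _ (\sum_(v in nbr w) (kappa ^+ j.+2 + D%:R * kappa ^+ j.+1))).
    rewrite [leRHS]big_mkcond/=; apply: ler_sum => v _.
    case: ifP => [/andP[_ /existsP[w' /andP[wv /eqP[e]]]]|_]; last by case: ifP.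
    by rewrite nbrC -e wv.
  by rewrite sumr_const -[leLHS]mulr_natl ler_wpM2r// ler_nat.
apply: (le_trans (lerD sw IH)).
rewrite le_eqVlt; apply/orP; left; apply/eqP; rewrite /ratio !exprS; field.
by rewrite gt_eqF.
Qed.

(** A site meets the other sites of its own generation, its children and its
parents; up to [1 - a] these contribute [D ^+ 2], [D / kappa] and [D * kappa]
times its own potential. *)
Lemma potential_superharmonic j K (i : site j) : ~~ is_leaf i ->
  (1 - a) * \sum_(c | i \in tsupp K c) \sum_(t in tsupp K c | t != i) potential t
    <= r * potential i.
Proof.
move=> ni; have a10 : 0 <= 1 - a by rewrite subr_ge0 ltW.
apply: (@le_trans _ _ ((1 - a) * (ratio * potential i))); last first.
  by rewrite mulrA ler_wpM2r.
rewrite ler_wpM2l// (le_trans (influence_bound K ni))//.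
case: j i ni => [//|j] [w|Ks] ni //=.
rewrite /ratio [kappa ^+ j.+1]exprS mulrA ler_wpM2r ?exprn_ge0 ?(ltW kappa0)//.
rewrite !mulrDl divfK ?gt_eqF// -addrA lerDl.
by rewrite addr_ge0// !mulr_ge0// ?exprn_ge0// ltW.
Qed.

Section leaf_laws.
Variable m : nat -> forall v, probability (X v) R.
Variables (lam : bool -> blk -> probability XX R) (Q : blk -> probability XX R)
  (dens : bool -> blk -> XX -> R) (b0 : R).
Hypotheses (b0_gt0 : 0 < b0) (bdens : forall b K, bmeas (dens b K))
  (dens_ge : forall b K z, b0 <= dens b K z)
  (ex_lam : forall b K h, bmeas h ->
    \int[lam b K]_z h z = (\int[Q K]_z (dens b K z * h z)) / \int[Q K]_z dens b K z).

Local Notation ref := (ref m lam).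

Definition density_gap K : R := \int[Q K]_z (dens true K z - dens false K z) ^+ 2.

Fixpoint leaf_block (j : nat) : blk -> site j -> blk :=
  match j return blk -> site j -> blk with
  | 0 => fun K _ => K
  | j'.+1 => fun K s =>
      match s with inl _ => K | inr Ks => @leaf_block j' Ks.1 Ks.2 end
  end.

(** The space at a leaf is the configuration space only after evaluation of the
recursion, hence the existential form. *)
Lemma leaf_density j K (s : site j) : is_leaf s ->
  exists (Q' : probability (site_space s) R) (w : bool -> site_space s -> R),
  [/\ forall b, bmeas (w b), forall b z, b0 <= w b z,
      forall sigma h, bmeas h -> \int[ref K sigma s]_z h z =
        (\int[Q']_z (w (sigma s) z * h z)) / \int[Q']_z w (sigma s) z &
      \int[Q']_z (w true z - w false z) ^+ 2 = density_gap (leaf_block K s)].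
Proof.
elim: j K s => [|j IHj] K s ls.
  exists (Q K), (dens^~ K); split=> //.
  by move=> sigma h bh; rewrite /= ex_lam.
case: s ls => [//|[K' s]] ls; have [Q' [w [bw wb wex wgap]]] := IHj K' s ls.
exists Q', w; split=> // sigma h bh.
exact: (wex (fun t => sigma (inr (K', t))) h bh).
Qed.

Let top_upd j (x : tree j) (s : site j) (t : site_space s) v :
  s != root_site j v -> top (dfwith x s t) v = top x v.
Proof.
case: j x s t => [|j] x s t vs; first by case: s t vs.
by rewrite /top dfwithout.
Qed.

Section root_observable.
Variables (j : nat) (K : blk) (I : {set V}) (f : XX -> R).
Hypotheses (bf : bmeas f) (f1 : forall x, `|f x| <= 1) (fI : depends_on I f).

Let F (t : tree j) := f (top t).

Let bF : bmeas F.
Proof. by apply: bmeas_comp bf _; exact: measurable_top. Qed.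

Let A : R := 2 * #|I|%:R * kappa ^+ j.

(** Dobrushin's comparison with the leaves as frozen sites: an observable of
[I] at the root has total oscillation [2 * #|I|], discounted by the potential at
the root. *)
Lemma root_observable_stable (l : site j) : is_leaf l ->
  forall P1 P2 : forall s : site j, probability (site_space s) R,
  (forall s, s != l -> P1 s = P2 s) ->
  `|gibbs_ex (tfactor K) P1 F - gibbs_ex (tfactor K) P2 F| <= A.
Proof.
move=> ll P1 P2 P12.
pose B := [set s : site j | is_leaf s]%SET.
pose roots := (root_site j @: I)%SET.
pose o (s : site j) : R := if s \in roots then 2 else 0.
apply: (@le_trans _ _ (\sum_s o s * potential s)).
  apply: (@dobrushin_comparison _ _ _ _ _ (tfactor K) (tsupp K) a a0 (ltW a1) _ _ _ B P1 P2
    (potential (j := j)) r o F) => //.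
  - exact: measurable_tfactor.
  - exact: tfactor_bounds.
  - exact: tfactor_supp.
  - by move=> s sB; apply: P12; apply: contraNneq sB => ->; rewrite inE.
  - by move=> s; exact: potential_gt0.
  - by move=> s; rewrite inE => ls; rewrite potential_leaf.
  - by move=> s; rewrite inE => ls; exact: potential_superharmonic.
  - by move=> s; rewrite /o; case: ifP.
  move=> s x t; rewrite /o; case: ifPn => [_|sI].
    rewrite (le_trans (ler_normB _ _))// -[2]/(1 + 1 : R).
    by rewrite lerD// f1.
  rewrite (_ : F _ = F x) ?subrr ?normr0//; apply: fI => v vI.
  have vs : s != root_site j v.
    by apply: contraNneq sI => ->; apply: imset_f.
  exact: top_upd.
rewrite /A mulrAC mulrC.
rewrite (eq_bigr (fun s => if s \in roots then 2 * potential s else 0)); last first.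
  by move=> s _; rewrite /o; case: ifP; rewrite ?mul0r.
rewrite -big_mkcond.
have p0 (s : site j) : 0 <= 2 * potential s.
  by rewrite mulr_ge0// ltW// potential_gt0.
have := @sum_imset_le _ _ (root_site j) I (fun s => 2 * potential s) predT p0.
rewrite big_mkcondr/= [X in _ <= X -> _]big_mkcondr/= => /le_trans; apply.
rewrite (eq_bigr (fun=> 2 * kappa ^+ j)) => [|w _]; last by rewrite potential_root.
by rewrite sumr_const -[leLHS]mulr_natl.
Qed.

Let gib_used : depends_on (used_sites j K) (gibbs (tfactor (j := j) K)).
Proof.
move=> x x' xx'; apply: eq_bigr => c _; apply: tfactor_supp => s sc.
by apply: xx'; apply: (fintype.subsetP (tsupp_used _ _)) sc.
Qed.

Lemma gibbs_ex_adm (sigma sigma' : site j -> bool) :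
  (forall s, adm_leaf K s -> sigma s = sigma' s) ->
  gibbs_ex (tfactor K) (ref K sigma) F = gibbs_ex (tfactor K) (ref K sigma') F.
Proof.
move=> ss'; rewrite /gibbs_ex.
have agree s : s \in used_sites j K -> meq (ref K sigma s) (ref K sigma' s).
  rewrite inE => sU B _; suff -> : ref K sigma s = ref K sigma' s by [].
    apply: ref_notin => ls.
  by apply: ss'; move: sU; rewrite ls.
have E (G : tree j -> R) : bmeas G -> depends_on (used_sites j K) G ->
    \int[prod_probability (ref K sigma)]_x G x = \int[prod_probability (ref K sigma')]_x G x.
  by move=> bG GU; exact: prod_agree agree bG GU.
apply: (congr2 (fun u v : R => u / v)); apply: E => //; first exact: bmeasM.
move=> x x' xx'; apply: (congr2 (fun u v : R => u * v)); first exact: gib_used.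
exact: (top_used fI xx').
Qed.

Let sqr_add_le (k : nat) (x y B S : R) : 0 <= S -> x ^+ 2 <= B -> y ^+ 2 <= k%:R * S ->
  (x + y) ^+ 2 <= k.+1%:R * (B + S).
Proof.
move=> S0 xB; case: k => [|k] yS.
  have y0 : y = 0.
    by apply/eqP; rewrite -sqrf_eq0 eq_le sqr_ge0 andbT; move: yS; rewrite mul0r.
  by rewrite y0 addr0 mul1r (le_trans xB)// lerDl.
rewrite -[k.+2]addn1 natrD; move: yS; set c : R := k.+1%:R => yS.
have c0 : 0 < c by rewrite ltr0n.
pose t := y / c; have yE : y = c * t by rewrite mulrC divfK// gt_eqF.
have tS : c * t ^+ 2 <= S.
  rewrite -(ler_pM2l c0) (le_trans _ yS)// yE.
  by rewrite (_ : c * (c * t ^+ 2) = (c * t) ^+ 2)//; ring.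
apply: (@le_trans _ _ ((c + 1) * (x ^+ 2 + c * t ^+ 2))); last first.
  by rewrite ler_wpM2l ?addr_ge0 ?(ltW c0)// lerD.
rewrite yE -subr_ge0 (_ : _ - _ = c * (x - t) ^+ 2); last by ring.
by rewrite mulr_ge0 ?sqr_ge0// ltW.
Qed.

Definition leaf_cost (s : site j) : R :=
  A ^+ 2 * a ^- n * b0 ^- 2 * density_gap (leaf_block K s).

Lemma leaf_cost_ge0 s : 0 <= leaf_cost s.
Proof.
apply: mulr_ge0; first apply: mulr_ge0; first apply: mulr_ge0; first exact: sqr_ge0.
- by rewrite invr_ge0 exprn_ge0// ltW.
- by rewrite invr_ge0 exprn_ge0// ltW.
- by apply: Rintegral_ge0 => z _; exact: sqr_ge0.
Qed.

(** The leaf laws are exchanged one leaf at a time, and the square of the sum of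
the changes is at most their number times the sum of their squares. *)
Lemma leaf_hybrid (l : seq (site j)) : uniq l -> {in l, forall s, is_leaf s} ->
  (gibbs_ex (tfactor K) (ref K (fun s => s \in l)) F -
   gibbs_ex (tfactor K) (ref K (fun=> false)) F) ^+ 2 <=
  (size l)%:R * \sum_(s <- l) leaf_cost s.
Proof.
elim: l => [|s l IHl] => [_ _|].
  by rewrite mul0r subrr expr0n.
move=> /andP[sl ul] leaf; rewrite big_cons.
pose g := gibbs_ex (tfactor K) (ref K (fun s => s \in l)) F.
rewrite -[X in X ^+ 2](subrKA g); apply: sqr_add_le; first by apply: sumr_ge0 => t _; exact: leaf_cost_ge0.
  2: by apply: IHl => // t tl; apply: leaf; rewrite inE tl orbT.
have ls : is_leaf s by apply: leaf; rewrite inE eqxx.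
have [Q' [w [bw wb wex wgap]]] := leaf_density K ls.
rewrite /leaf_cost -wgap.
apply: (@single_law_change _ _ _ _ _ (tfactor K) (tsupp K) a a0 (ltW a1) _ _ _ s
  (ref K (fun t => t \in s :: l)) (ref K (fun t => t \in l)) Q' (w true) (w false)) => //.
- exact: measurable_tfactor.
- exact: tfactor_bounds.
- exact: tfactor_supp.
- by move=> t ts; apply: ref_notin => _; rewrite inE (negbTE ts).
- by move=> h bh; rewrite (wex _ _ bh) inE eqxx.
- by move=> h bh; rewrite (wex _ _ bh) (negbTE sl).
- exact: card_leaf_factors.
- exact: root_observable_stable.
Qed.

(** Replacing all leaf laws at once costs one term for each leaf that the root
can reach through blocks within range of each other. *)
Lemma tree_comparison :
  (\int[block_laws m (lam true) j K]_z f z - \int[block_laws m (lam false) j K]_z f z) ^+ 2 <=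
  (Db ^ j)%:R * \sum_(s | adm_leaf K s) leaf_cost s.
Proof.
rewrite -!(tree_root_ex m lam j K _ bf).
rewrite (@gibbs_ex_adm _ (fun s => s \in enum [pred s | adm_leaf K s])); last first.
  by move=> s ss; rewrite mem_enum inE ss.
apply: (le_trans (leaf_hybrid (enum_uniq _) _)).
  by move=> s; rewrite mem_enum inE => /adm_is_leaf.
rewrite big_enum/= ler_wpM2r//; last by rewrite -cardE ler_nat; exact: card_adm_leaf.
by apply: sumr_ge0 => s _; exact: leaf_cost_ge0.
Qed.

End root_observable.

End leaf_laws.

Section sampling.
Variable DK : nat.
Hypothesis ownDK : forall v, (#|(own @: nbr v)%SET| <= DK)%N.
Variables (rho : probability XX R) (N : nat) (N_gt0 : (0 < N)%N).
Variables (g : blk -> XX -> R)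
  (mg : forall K, measurable_fun setT (g K)) (g0 : forall K x, 0 <= g K x).
Variables (c y : R) (c0 : 0 < c) (gc : forall K x, c <= g K x)
  (gy : forall K x x', g K x <= y * g K x').
Local Notation SN := (prod_space (fun _ : 'I_N => XX)).
Local Notation iid := (prod_probability (fun _ : 'I_N => rho)).
Local Notation mu := (bprod (law_blocks rho mg g0)).
Local Notation nu w := (bprod (sample_blocks N_gt0 mg g0 (w : SN))).
Local Notation q := (4 * y / Num.sqrt N%:R).
Variables (m : nat -> forall v, probability (X v) R) (m0 : forall v, probability (X v) R).

Local Notation density_error K := (fun wz : SN * XX =>
  (step_density (nu wz.1) K wz.2 - step_density mu K wz.2) ^+ 2).

Let bmeas_density_error (K : blk) : bmeas (density_error K).
Proof.
apply: (bmeasX 2 (f := fun wz : SN * XX =>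
  step_density (nu wz.1) K wz.2 - step_density mu K wz.2)).
apply: bmeasB; last first.
  exact: (bmeas_comp (f := step_density mu K) (g := snd)
    (bmeas_step_density mu K) (@measurable_snd _ _ SN XX)).
apply: (mfam_bmeas (F := fun szx : (SN * XX) * XX => block_factor K szx.2 szx.1.2)
  (block_prod_mfam KK_part (sample_blocks_mfam N_gt0 mg g0 c0 gc gy))
  (p := fun sz : SN * XX => sz.1)); first exact: measurable_fst.
apply: (bmeas_comp (bmeas_block_factor K)
  (g := fun szx : (SN * XX) * XX => (szx.2, szx.1.2))).
apply: measurable_fun_pair; first exact: measurable_snd.
exact: measurableT_comp measurable_snd measurable_fst.
Qed.

(** The density of the next step is an expectation of a product of local factors
under the sampled law, so the product structure limits the sampling error to the
total influence of the sites of one enlarged block. *)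
Lemma step_density_error K : 0 <= y ->
  \int[iid]_w \int[prod_probability m0]_z
    (step_density (nu w) K z - step_density mu K z) ^+ 2 <=
  (q * (DK%:R * ((1 - a) * n%:R))) ^+ 2.
Proof.
move=> y_ge0; have q0 : 0 <= q by rewrite mulr_ge0 ?mulr_ge0 ?invr_ge0 ?sqrtr_ge0.
have bH := bmeas_density_error K.
rewrite (ex_fubini _ _ bH); apply: ex_le; first exact: (bmeas_ex1 _ bH).
move=> z.
pose pz v (x : XX) : R := p v x (z v).
have mpz v : measurable_fun setT (pz v).
  exact: (measurableT_comp (@mp v) (measurable_fun_pair (@measurable_id _ _ setT) (measurable_cst (z v)))).
pose bl v := enum (own @: nbr v)%SET.
have pzbl v : blocks_dep KK_part (bl v) (pz v).
  move=> x x' xx'; apply: p_local => w wv; apply: xx'.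
  by rewrite mem_enum imset_f.
have blDK v : (size (bl v) <= DK)%N by rewrite -cardE.
have a01 : 0 <= a < 1 by rewrite (ltW a0).
have one_dep : blocks_dep KK_part [::] ((fun=> 1) : XX -> R) by [].
have := sampling_factors rho N_gt0 mg g0 c0 gc gy a01 mpz (fun v x => pa1 v x (z v))
  pzbl blDK (enum (enl K)) (erefl q) q0 (bmeas_cst _ 1) _ one_dep.
move=> /(_ (fun x => _)) le_.
apply: (le_trans (le_trans _ (le_ _))); last first.
- have a1' : 0 <= 1 - a by rewrite subr_ge0 ltW.
  have d0 k : 0 <= DK%:R * ((1 - a) * k%:R) by rewrite mulr_ge0// mulr_ge0.
  rewrite add0r -cardE; apply: lerXn2r; rewrite ?nnegrE ?mulr_ge0//.
  by rewrite ler_wpM2l// ler_wpM2l// ler_wpM2l// ler_nat enln.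
- by rewrite normr1.
have bf0 : (fun x => 1 * \prod_(i <- enum (enl K)) pz i x) = block_factor K ^~ z.
  by apply/funext => x; rewrite mul1r big_enum.
by rewrite le_eqVlt; apply/orP; left; apply/eqP; apply: eq_ex => w; rewrite bf0.
Qed.

Variables (j : nat) (K : blk) (I : {set V}) (f : XX -> R).
Hypotheses (bf : bmeas f) (f1 : forall x, `|f x| <= 1) (fI : depends_on I f).

Local Notation after rho' := (block_laws m (fun K' => step m0 K' rho') j K).

(** After one more step the sampled and the exact law have densities close in
mean square, and these sit at the leaves of a tree of height [j]. Averaging over
the sample leaf by leaf costs one factor [Db ^ j] for the number of leaves, which
competes with the decay [kappa ^+ j]. *)
Lemma sampled_forgetting (al : R) : 0 <= al -> a ^- n = al ^+ 2 ->
  \int[iid]_w (\int[after (nu w)]_z f z - \int[after mu]_z f z) ^+ 2 <=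
  ((Db ^ j)%:R * (2 * #|I|%:R * kappa ^+ j) * al ^+ 3 *
    (q * (DK%:R * ((1 - a) * n%:R)))) ^+ 2.
Proof.
move=> al0 alE.
have y_ge0 : 0 <= y.
  have := gy K point point; rewrite -ler_pdivrMr ?divff ?gt_eqF// ?(lt_le_trans c0)//.
  exact: le_trans.
pose lam (w : SN) (b : bool) K' := step m0 K' (if b then nu w else mu).
pose dens (w : SN) (b : bool) K' := step_density (if b then nu w else mu) K'.
pose Q (_ : blk) : probability XX R := prod_probability m0.
pose A : R := 2 * #|I|%:R * kappa ^+ j.
pose gap w K' : R := density_gap Q (dens w) K'.
have b0_gt0 : 0 < a ^+ n by exact: exprn_gt0.
have perw w : (\int[after (nu w)]_z f z - \int[after mu]_z f z) ^+ 2 <=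
    (Db ^ j)%:R * \sum_(s | adm_leaf K s)
      (A ^+ 2 * a ^- n * (a ^+ n) ^- 2) * gap w (leaf_block K (s : site j)).
  apply: (tree_comparison m
    (lam := lam w) (Q := Q) (dens := dens w) b0_gt0) => //.
  - by move=> b K'; exact: (bmeas_step_density _ K').
  - move=> b K' z.
    case/andP: (step_density_bounds (if b then nu w else mu) K' z) => + _.
    apply: le_trans; exact: (ler_wiXn2l (ltW a0) (ltW a1) (enln K')).
  - by move=> b K' h bh; exact: ex_step.
have bgap K' : bmeas (gap ^~ K').
  exact: (bmeas_ex2 (prod_probability m0) (F := density_error K') (bmeas_density_error K')).
have bleft : bmeas (fun w => (\int[after (nu w)]_z f z - \int[after mu]_z f z) ^+ 2).
  apply: (bmeasX 2 (f := fun w => \int[after (nu w)]_z f z - \int[after mu]_z f z)).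
  apply: bmeasB; last exact: bmeas_cst.
  have hnu := block_prod_mfam KK_part (sample_blocks_mfam N_gt0 mg g0 c0 gc gy).
  have hafter := block_laws_mfam m (lam := fun w K' => step m0 K' (nu w)) j K
    (fun K' => step_mfam m0 K' hnu).
  exact: (mfam_bmeas (F := fun wz : SN * XX => f wz.2) (p := id) hafter
    (@measurable_id _ _ setT) (bmeas_comp bf (@measurable_snd _ _ SN XX))).
have cE : A ^+ 2 * a ^- n * (a ^+ n) ^- 2 = (A * al ^+ 3) ^+ 2.
  by rewrite -[(a ^+ n) ^- 2]exprVn alE; ring.
apply: (le_trans (ler_ex _ _ _ perw)) => //.
  by apply: bmeasZ; apply: bmeas_sum => s _; apply: bmeasZ.
rewrite exZl; last by apply: bmeas_sum => s _; apply: bmeasZ.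
rewrite ex_sum; last by move=> s _; apply: bmeasZ.
apply: (@le_trans _ _ ((Db ^ j)%:R * \sum_(s | adm_leaf K (s : site j))
    ((A * al ^+ 3) ^+ 2 * (q * (DK%:R * ((1 - a) * n%:R))) ^+ 2))).
  rewrite ler_wpM2l//; apply: ler_sum => s _; rewrite exZl// cE ler_wpM2l ?sqr_ge0//.
  exact: step_density_error.
rewrite sumr_const; set C := (_ ^+ 2 * _ ^+ 2 : R); rewrite -[C *+ _]mulr_natl mulrA.
apply: (@le_trans _ _ ((Db ^ j)%:R * (Db ^ j)%:R * C)).
  apply: ler_wpM2r; first by rewrite /C mulr_ge0 ?sqr_ge0.
  by rewrite ler_wpM2l// ler_nat; exact: card_adm_leaf.
by rewrite le_eqVlt; apply/orP; left; apply/eqP; rewrite /C /A; ring.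
Qed.

End sampling.
End counting.
End computation_tree.

(** * Tilting product measures *)

Section product_tilting.
Context (R : realType) (I : finType) (d : I -> measure_display)
  (T : forall i, measurableType (d i)).
Variables (P : forall i, probability (T i) R) (h : forall i, T i -> R).
Arguments h : clear implicits.
Hypotheses (bh : forall i, bmeas (h i)) (h0 : forall i t, 0 <= h i t)
  (Eh : forall i, 0 < \int[P i]_t h i t).
Arguments h0 : clear implicits.
Local Notation XX := (prod_space T).

Lemma ex_prod_factors (f : forall i, T i -> R) : (forall i, bmeas (f i)) ->
  (forall i t, 0 <= f i t) ->
  \int[prod_probability P]_x \prod_i f i (x i) = \prod_i \int[P i]_t f i t.
Proof.
move=> bf f0.
have bprod : bmeas (fun x : XX => \prod_i f i (x i)).
  by apply: bmeas_prod => i _; apply: bmeas_comp (bf i) _; exact: measurable_coord.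
apply: EFin_inj; rewrite EFin_ex// -prodEFin.
under eq_integral do rewrite -prodEFin.
rewrite (@prod_measure_integral _ _ _ _ (fun i => P i) (fun i t => (f i t)%:E)).
- by apply: eq_bigr => i _; rewrite EFin_ex.
- by move=> i; apply/measurable_EFinP; case: (bf i).
- by move=> i t; rewrite lee_fin.
Qed.

Definition tilted i : probability (T i) R :=
  reweight (P i) (bmeas_measurable (bh i)) (h0 i).

Lemma ex_tilted i f : bmeas f ->
  \int[tilted i]_t f t = (\int[P i]_t (f t * h i t)) / \int[P i]_t h i t.
Proof. by move=> bf; rewrite ex_reweight. Qed.

(** A density that is a product of functions of single coordinates keeps the
coordinates independent. *)
Lemma ex_prod_tilted (f : XX -> R) : bmeas f ->
  \int[prod_probability P]_x (f x * \prod_i h i (x i)) =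
  (\prod_i \int[P i]_t h i t) * \int[prod_probability tilted]_x f x.
Proof.
move=> bf; pose H (x : XX) := \prod_i h i (x i).
have bH : bmeas H.
  by apply: bmeas_prod => i _; apply: bmeas_comp (bh i) _; exact: measurable_coord.
have H0 x : 0 <= H x by apply: prodr_ge0 => i _.
have EH : \int[prod_probability P]_x H x = \prod_i \int[P i]_t h i t.
  exact: ex_prod_factors.
have EH0 : 0 < \int[prod_probability P]_x H x by rewrite EH; apply: prodr_gt0 => i _.
have same : meq (reweight (prod_probability P) (bmeas_measurable bH) H0)
    (prod_probability tilted).
  move=> B; apply: box_unique => [|A mA].
    by rewrite (le_lt_trans (probability_le1 _ _)) ?ltry.
  have bA i : bmeas (fun t => \1_(A i) t * h i t) by apply: bmeasM => //; exact: bmeas_indic.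
  rewrite -[LHS]/(reweight (prod_probability P) (bmeas_measurable bH) H0 (box A)).
  rewrite reweightE//; last exact: measurable_box.
  transitivity ((prod_probability tilted : probability _ R) (box A)); last by [].
  rewrite prod_probability_box//.
  have tA i : tilted i (A i) = ((\int[P i]_t (\1_(A i) t * h i t)) / \int[P i]_t h i t)%:E.
    by rewrite /tilted reweightE.
  rewrite (eq_bigr _ (fun i _ => tA i)) prodEFin; congr EFin.
  rewrite EH big_split/= prodfV; congr (_ / _).
  rewrite -ex_prod_factors//; last by move=> i t; rewrite mulr_ge0.
  apply: eq_ex => x; rewrite big_split/= /H; congr (_ * _).
  rewrite indicE; have [xA|xA] := boolP (x \in box A).
    rewrite big1// => i _; rewrite indicE mem_set//.
    by move: xA; rewrite inE; apply.
  have /existsNP[i Ai] : ~ box A x by move=> xA'; move/negP: xA; apply; rewrite inE.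
  by rewrite (bigD1 i)//= indicE memNset// mul0r.
have := meq_ex f same.
rewrite ex_reweight// => H1; rewrite -H1 EH mulrC divfK//.
by rewrite -EH gt_eqF.
Qed.

End product_tilting.

(** Coordinates on which the observable does not depend are integrated out. *)
Lemma ex_prod_tilted_on (R : realType) (I : finType) (d : I -> measure_display)
    (T : forall i, measurableType (d i)) (P P' : forall i, probability (T i) R)
    (h : forall i, T i -> R) (J K : {set I}) (f : prod_space T -> R) :
  (forall i, bmeas (h i)) -> (forall i t, 0 <= h i t) ->
  (forall i, 0 < \int[P i]_t h i t) ->
  (forall i, i \in K -> forall f, bmeas f -> \int[P' i]_t f t =
    if i \in J then (\int[P i]_t (f t * h i t)) / \int[P i]_t h i t else \int[P i]_t f t) ->
  bmeas f -> depends_on K f ->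
  \int[prod_probability P]_x (f x * \prod_(i in J) h i (x i)) =
  (\prod_(i in J) \int[P i]_t h i t) * \int[prod_probability P']_x f x.
Proof.
move=> bh h0 Eh P'E bf fK.
pose h' i (t : T i) : R := if i \in J then h i t else 1.
have bh' i : bmeas (h' i).
  by rewrite /h'; case: (i \in J) => //; exact: bmeas_cst.
have h'0 i t : 0 <= h' i t by rewrite /h'; case: ifP.
have Eh'E i : \int[P i]_t h' i t = if i \in J then \int[P i]_t h i t else 1.
  by rewrite /h'; case: ifP => // _; rewrite ex_cst.
have Eh' i : 0 < \int[P i]_t h' i t by rewrite Eh'E; case: ifP.
have := ex_prod_tilted bh' h'0 Eh' bf.
rewrite (eq_bigr _ (fun i _ => Eh'E i)) -big_mkcond/= => H.
transitivity (\int[prod_probability P]_x (f x * \prod_i h' i (x i))).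
  by apply: eq_ex => x; rewrite big_mkcond.
rewrite H; congr (_ * _); apply: (prod_agree (J := K)) => // i iK.
apply: ex_meq => g bg; rewrite ex_tilted// P'E// Eh'E /h'; case: ifP => // _.
by rewrite divr1; apply: eq_ex => t; rewrite mulr1.
Qed.

(** * One step of the hidden Markov model *)

Section model_steps.
Context (R : realType) (V : finType) (dX dY : V -> measure_display)
  (X : forall v, measurableType (dX v)) (Y : forall v, measurableType (dY v))
  (psi : forall v, {sigma_finite_measure set (X v) -> \bar R})
  (phi : forall v, {sigma_finite_measure set (Y v) -> \bar R}).
Variables (M : hmm psi phi) (e : rel V) (b : {nonneg R}).
Context (KK : {set {set V}}) (KK_part : finset.partition KK [set: V]%SET).
Local Notation XX := (prod_space X).
Local Notation blk := (block KK).
Variables (eps kappa : R) (eps0 : 0 < eps) (eps1 : eps < 1)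
  (kappa0 : 0 < kappa) (kappa1 : kappa < 1).
Hypotheses (trans_bound : forall v x z, eps < trans M v x z < eps^-1)
  (obs_bound : forall v x y, kappa < obs M v x y < kappa^-1).
Arguments trans_bound : clear implicits.
Arguments obs_bound : clear implicits.

Definition site_factor v (x : XX) (z : X v) : R := eps * trans M v x z.
Local Notation p := site_factor.
Definition hood (K : blk) : {set V} := enlarge e b (val K).

Lemma site_factor_bounds v x (z : X v) : eps ^+ 2 <= p x z <= 1.
Proof.
have /andP[t1 t2] := trans_bound v x z; rewrite /p expr2 ler_wpM2l ?(ltW eps0) ?(ltW t1)//=.
by rewrite -(mulfV (lt0r_neq0 eps0)) ler_wpM2l ?(ltW eps0) ?(ltW t2).
Qed.

Lemma measurable_site_factor v : measurable_fun setT (fun xz : XX * X v => p xz.1 xz.2).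
Proof. by apply: measurable_funM => //; exact: measurable_trans. Qed.

Let bmeas_trans v : bmeas (fun xz : XX * X v => trans M v xz.1 xz.2).
Proof.
apply: (@bmeasP _ _ _ _ eps^-1); first exact: measurable_trans.
by move=> xz; case/andP: (trans_bound v xz.1 xz.2) => _ ?; rewrite ger0_norm ?trans_ge0 ?ltW.
Qed.

Let bmeas_trans1 v x : bmeas (trans M v x).
Proof. exact: (bmeas_sec1 x (bmeas_trans v)). Qed.

Lemma bmeas_obs v (y : Y v) : bmeas (fun x => obs M v x y).
Proof.
apply: (@bmeasP _ _ _ _ kappa^-1).
  exact: (measurableT_comp (measurable_obs M v)
    (measurable_fun_pair (@measurable_id _ _ setT) (measurable_cst y))).
by move=> x; case/andP: (obs_bound v x y) => _ ?; rewrite ger0_norm ?obs_ge0 ?ltW.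
Qed.

Lemma ex_obs_gt0 v (y : Y v) (P : probability (X v) R) : 0 < \int[P]_x obs M v x y.
Proof.
apply: (lt_le_trans kappa0); apply: ex_ge; first exact: bmeas_obs.
by move=> x; case/andP: (obs_bound v x y) => /ltW.
Qed.

(** The transition densities are bounded above and below, so the reference
measures are finite and nonzero and can be normalised. *)
Lemma psi_fin v : exists2 c : R, 0 < c & psi v setT = c%:E.
Proof.
have mt : measurable_fun [set: X v] (fun z => (trans M v point z)%:E).
  by apply/measurable_EFinP; case: (bmeas_trans1 v point).
have t0 z : (0 <= (trans M v point z)%:E)%E by rewrite lee_fin trans_ge0.
have up : (eps%:E * psi v setT <= 1)%E.
  rewrite -(trans_density M v point) -integral_cst//.
  apply: ge0_le_integral => //.
    by move=> z _; rewrite lee_fin ltW.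
  by move=> z _; rewrite lee_fin ltW//; case/andP: (trans_bound v point z).
have lo : (1 <= eps^-1%:E * psi v setT)%E.
  rewrite -(trans_density M v point) -integral_cst//.
  apply: ge0_le_integral => //.
  by move=> z _; rewrite lee_fin ltW//; case/andP: (trans_bound v point z).
have p0 : (0 <= psi v setT)%E by exact: measure_ge0.
move: up lo p0; case: (psi v setT) => [c| |] //=.
  move=> _ + _; rewrite lee_fin => ce; exists c => //.
  by rewrite -(pmulr_rgt0 (x := eps^-1)) ?invr_gt0// (lt_le_trans ltr01).
by rewrite mulry gtr0_sg// mul1e.
Qed.

Definition base v : probability (X v) R := mnormalize (psi v) (\d_point).

Let c v : R := fine (psi v setT).

Let c0 v : 0 < c v.
Proof. by rewrite /c; have [k k0 ->] := psi_fin v. Qed.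

Let psiE v (A : set (X v)) : psi v A = ((c v)%:E * base v A)%E.
Proof.
have [k k0 kE] := psi_fin v.
have -> : base v A = (psi v A * (c v)^-1%:E)%E.
  rewrite /base /= /mnormalize; case: ifPn => [/orP[]/eqP H|_ //].
    by have [k_0] := etrans (esym kE) H; rewrite k_0 ltxx in k0.
  by have := etrans (esym kE) H.
by rewrite muleCA -EFinM mulfV ?mule1// gt_eqF.
Qed.

Let prod_psiE (A : set XX) : measurable A ->
  prod_measure psi A = ((\prod_v c v)%:E * (prod_probability base : probability _ R) A)%E.
Proof.
have C0 : 0 <= \prod_v c v by apply: prodr_ge0 => v _; exact: ltW.
move=> mA; transitivity (mscale (NngNum C0) (prod_probability base) A); last by [].
have mbox A' : (forall v, measurable (A' v)) ->
    prod_measure psi (box A') = mscale (NngNum C0) (prod_probability base) (box A').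
  move=> mA'; rewrite prod_measure_box//.
  transitivity ((\prod_v c v)%:E * (prod_probability base : probability _ R) (box A'))%E; last by [].
  rewrite prod_probability_box// -prodEFin -big_split/=.
  by apply: eq_bigr => v _; exact: psiE.
apply: box_unique => //.
have TE : [set: XX] = box (fun v => [set: X v]) by exact/seteqP.
rewrite -[X in (X < _)%E]/(prod_measure psi [set: XX]) TE.
rewrite prod_measure_box//.
rewrite (eq_bigr (fun v => (c v)%:E)) ?prodEFin ?ltry// => v _.
by rewrite psiE probability_setT mule1.
Qed.

Let psi_ex v (f : X v -> R) : bmeas f -> (forall z, 0 <= f z) ->
  (\int[psi v]_z (f z)%:E = (c v * \int[base v]_z f z)%:E)%E.
Proof.
move=> bf f0; rewrite EFinM EFin_ex//.
rewrite -[(c v)%:E]/((NngNum (ltW (c0 v)))%:num%:E) -ge0_integral_mscale//.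
- by apply: eq_measure_integral => A mA _; exact: psiE.
- by apply/measurable_EFinP; case: bf.
- by move=> z _; rewrite lee_fin.
Qed.

Let C0 : 0 <= \prod_v c v.
Proof. by apply: prodr_ge0 => v _; exact: ltW. Qed.

Let prod_psi_ex (f : XX -> R) : bmeas f -> (forall z, 0 <= f z) ->
  (\int[prod_measure psi]_z (f z)%:E =
   (\prod_v c v * \int[prod_probability base]_z f z)%:E)%E.
Proof.
move=> bf f0; rewrite EFinM EFin_ex//.
rewrite -[(\prod_v c v)%:E]/((NngNum C0)%:num%:E) -ge0_integral_mscale//.
- by apply: eq_measure_integral => A mA _; exact: prod_psiE.
- by apply/measurable_EFinP; case: bf.
- by move=> z _; rewrite lee_fin.
Qed.

(** This average does not depend on the previous state, which is what allows
unobserved sites to be integrated out. *)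
Lemma ex_base_trans v x : \int[base v]_z trans M v x z = (c v)^-1.
Proof.
have := psi_ex (bmeas_trans1 v x) (trans_ge0 M v x).
rewrite trans_density => -[] /esym; rewrite mulrC => H.
by rewrite -[RHS]mul1r -H mulfK// gt_eqF.
Qed.

Lemma bmeas_joint_trans : bmeas (fun xz : XX * XX => joint_trans M xz.1 xz.2).
Proof.
apply: bmeas_prod => v _.
apply: (bmeas_comp (bmeas_trans v) (g := fun xz : XX * XX => (xz.1, xz.2 v))).
apply: measurable_fun_pair; first exact: measurable_fst.
exact: measurableT_comp (@measurable_coord _ _ X v) measurable_snd.
Qed.

Lemma ex_predict (rho : probability XX R) f : bmeas f ->
  \int[predict M rho]_z f z =
  (\int[rho]_x \int[prod_probability base]_z (f z * joint_trans M x z)) /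
  \int[rho]_x \int[prod_probability base]_z joint_trans M x z.
Proof.
move=> bf; set Z := (X in _ / X).
pose P := (rho \x prod_probability base)%E.
pose h (xz : XX * XX) : R := joint_trans M xz.1 xz.2.
have bh : bmeas h by exact: bmeas_joint_trans.
have h0 xz : 0 <= h xz by exact: joint_trans_ge0.
have bindic A : measurable A -> bmeas (fun xz : XX * XX => \1_A xz.2 * h xz).
  move=> mA; apply: bmeasM => //.
  exact: (bmeas_comp (bmeas_indic R mA) (@measurable_snd _ _ XX XX)).
have predictE A : measurable A -> predict M rho A =
    (\prod_v c v * \int[rho]_x \int[prod_probability base]_z (\1_A z * h (x, z)))%:E.
  move=> mA; have bA := bindic A mA.
  have bin : bmeas (fun x => \int[prod_probability base]_z (\1_A z * h (x, z))).
    exact: (bmeas_ex2 (prod_probability base) bA).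
  rewrite -exZl// EFin_ex; last exact: bmeasZ.
  apply: eq_integral => x _; rewrite -prod_psi_ex//.
  - exact: (bmeas_sec1 x bA).
  - by move=> z; rewrite mulr_ge0.
have ZE : Z = \int[P]_xz h xz by rewrite ex_fubini1.
have CZ : \prod_v c v * Z = 1.
  have := predictE setT measurableT; rewrite probability_setT => -[] H.
  apply: (etrans _ (esym H)); rewrite -[Z]/(\int[rho]_x \int[prod_probability base]_z h (x, z)).
  apply: (f_equal (fun w : R => \prod_v c v * w)).
  by apply: eq_ex => x; apply: eq_ex => z; rewrite indicT mul1r.
have Z0 : 0 < Z.
  rewrite lt_neqAle eq_sym; apply/andP; split.
    by apply: contra_eq_neq CZ => ->; rewrite mulr0 eq_sym oner_neq0.
  by apply: Rintegral_ge0 => x _; apply: Rintegral_ge0 => z _; exact: joint_trans_ge0.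
have hP : 0 < \int[P]_xz h xz by rewrite -ZE.
have := @ex_distribution_set _ _ _ _ _ (reweight P (bmeas_measurable bh) h0) snd
  (@measurable_snd _ _ XX XX) (predict M rho).
move=> /(_ _ f bf) ->.
  have bf2 : bmeas (fun xz : XX * XX => f xz.2) by exact: bmeas_comp bf measurable_snd.
  rewrite ex_reweight// -ZE; congr (_ / _); rewrite ex_fubini1//.
  by apply: bmeasM.
move=> A mA; apply: (etrans (predictE A mA)).
have msA : measurable (snd @^-1` A : set (XX * XX)).
  by rewrite -[X in measurable X]setTI; exact: measurable_snd.
rewrite reweightE// -ZE; congr EFin.
rewrite ex_fubini1; last exact: (bindic A mA).
have lin (u w : R) : u * Z = 1 -> u * w = w / Z.
  by move=> uZ; apply: (mulIf (lt0r_neq0 Z0)); rewrite divfK ?lt0r_neq0// mulrAC uZ mul1r.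
exact: (lin _ _ CZ).
Qed.


Definition joint_mass : R := \prod_v (c v)^-1.

Lemma joint_mass_gt0 : 0 < joint_mass.
Proof. by apply: prodr_gt0 => v _; rewrite invr_gt0. Qed.

Lemma ex_joint_trans x : \int[prod_probability base]_z joint_trans M x z = joint_mass.
Proof.
rewrite (@ex_prod_factors _ _ _ _ base (fun v => trans M v x)) => [||v z]; last exact: trans_ge0.
  by apply: eq_bigr => v _; exact: ex_base_trans.
by move=> v; exact: bmeas_trans1.
Qed.

Lemma ex_predict_density (rho : probability XX R) f : bmeas f ->
  \int[predict M rho]_z f z =
  (\int[prod_probability base]_z (f z * \int[rho]_x joint_trans M x z)) / joint_mass.
Proof.
move=> bf; rewrite ex_predict//; congr (_ / _); last first.
  by rewrite (eq_ex _ ex_joint_trans) ex_cst.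
rewrite (ex_fubini _ _ (F := fun xz : XX * XX => f xz.2 * joint_trans M xz.1 xz.2)).
  by apply: eq_ex => z /=; rewrite exZl//; exact: (bmeas_sec2 z bmeas_joint_trans).
apply: bmeasM bmeas_joint_trans; exact: bmeas_comp bf measurable_snd.
Qed.

Lemma joint_density_mass (rho : probability XX R) :
  \int[prod_probability base]_z \int[rho]_x joint_trans M x z = joint_mass.
Proof.
rewrite -(ex_fubini rho (prod_probability base) bmeas_joint_trans).
by rewrite (eq_ex _ ex_joint_trans) ex_cst.
Qed.

Variable yt : prod_space Y.

Definition hood_likelihood (K : blk) (x : XX) : R := \prod_(v in hood K) obs M v (x v) (yt v).

Lemma bmeas_hood_likelihood K : bmeas (hood_likelihood K).
Proof.
apply: bmeas_prod => v _.
apply: (bmeas_comp (bmeas_obs (yt v)) (g := fun x : XX => x v)).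
exact: measurable_coord.
Qed.

Lemma hood_likelihood_ge0 K x : 0 <= hood_likelihood K x.
Proof. by apply: prodr_ge0 => v _; exact: obs_ge0. Qed.

Lemma hood_likelihood_ge K x : kappa ^+ #|hood K| <= hood_likelihood K x.
Proof.
rewrite -prodr_const; apply: ler_prod => v _; rewrite (ltW kappa0)/=.
by case/andP: (obs_bound v (x v) (yt v)) => /ltW.
Qed.

Lemma hood_likelihood_le K x : hood_likelihood K x <= kappa ^- #|hood K|.
Proof.
rewrite -exprVn -prodr_const; apply: ler_prod => v _; rewrite obs_ge0/=.
by case/andP: (obs_bound v (x v) (yt v)) => _ /ltW.
Qed.

Lemma ex_hood_likelihood_gt0 K (P : probability XX R) : 0 < \int[P]_x hood_likelihood K x.
Proof.
apply: (@lt_le_trans _ _ (kappa ^+ #|hood K|)); first exact: exprn_gt0.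
by apply: ex_ge; [exact: bmeas_hood_likelihood|exact: hood_likelihood_ge].
Qed.

Let mL K := bmeas_measurable (bmeas_hood_likelihood K).
Let L0 K := hood_likelihood_ge0 K.

Definition posterior v : probability (X v) R :=
  reweight (base v) (bmeas_measurable (bmeas_obs (yt v))) (fun z => obs_ge0 M v z (yt v)).

Let ex_posterior v f : bmeas f -> \int[posterior v]_z f z =
  (\int[base v]_z (f z * obs M v z (yt v))) / \int[base v]_z obs M v z (yt v).
Proof. by move=> bf; rewrite ex_reweight//; [exact: bmeas_obs|exact: ex_obs_gt0]. Qed.

(** The sites outside the neighbourhood are integrated out, and their
contribution does not depend on the previous state since transition densities
integrate to one. *)
Lemma ex_predict_hood (rho : probability XX R) K :
  exists2 k : R, 0 < k & forall f, bmeas f -> depends_on (hood K) f ->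
  \int[predict M rho]_z (f z * hood_likelihood K z) =
  k * \int[prod_probability posterior]_z (step_density hood p rho K z * f z).
Proof.
set Z := \int[rho]_x \int[prod_probability base]_z joint_trans M x z.
pose k1 : R := \prod_(v in ~: hood K) (c v)^-1.
pose k2 : R := \prod_(v in hood K) \int[base v]_z obs M v z (yt v).
have Z0 : 0 < Z.
  apply: (@lt_le_trans _ _ (eps ^+ #|V|)); first exact: exprn_gt0.
  apply: ex_ge; first exact: (bmeas_ex2 (prod_probability base) bmeas_joint_trans).
  move=> x; apply: ex_ge; first exact: (bmeas_sec1 x bmeas_joint_trans).
  move=> z; rewrite -prodr_const; apply: ler_prod => v _; rewrite (ltW eps0)/=.
  by case/andP: (trans_bound v x (z v)) => /ltW.
pose k3 : R := eps ^- #|hood K|.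
exists (k1 * k2 * k3 / Z).
  rewrite divr_gt0// mulr_gt0 ?invr_gt0 ?exprn_gt0// mulr_gt0//; apply: prodr_gt0 => v _.
    by rewrite invr_gt0.
  exact: ex_obs_gt0.
move=> f bf fK; rewrite ex_predict; last first.
  by apply: bmeasM => //; exact: bmeas_hood_likelihood.
rewrite -/Z mulrAC; congr (_ / _).
pose T x z : R := \prod_(v in hood K) trans M v x (z v).
have bT : bmeas (fun xz : XX * XX => T xz.1 xz.2).
  apply: bmeas_prod => v _.
  apply: (bmeas_comp (bmeas_trans v) (g := fun xz : XX * XX => (xz.1, xz.2 v))).
  apply: measurable_fun_pair; first exact: measurable_fst.
  exact: measurableT_comp (@measurable_coord _ _ X v) measurable_snd.
have bfT x : bmeas (fun z => f z * T x z) by apply: bmeasM => //; exact: (bmeas_sec1 x bT).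
have fTK x : depends_on (hood K) (fun z => f z * T x z).
  move=> z z' zz'; rewrite (fK z z' zz'); congr (_ * _).
  by apply: eq_bigr => v vK; rewrite zz'.
have LK : depends_on (hood K) (hood_likelihood K).
  by move=> z z' zz'; apply: eq_bigr => v vK; rewrite zz'.
have FE x z : f z * T x z = k3 * (block_factor hood p K x z * f z).
  rewrite /block_factor big_split/= prodr_const mulrA [k3 * _]mulrA.
  by rewrite /k3 mulVf ?mul1r 1?mulrC// lt0r_neq0// exprn_gt0.
have inner x : \int[prod_probability base]_z (f z * hood_likelihood K z * joint_trans M x z) =
    k1 * k2 * k3 * \int[prod_probability posterior]_z (block_factor hood p K x z * f z).
  have bbf : bmeas (fun z => block_factor hood p K x z * f z).
    apply: bmeasM => //; exact: (bmeas_sec1 x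
      (bmeas_block_factor hood (exprn_gt0 2 eps0) measurable_site_factor site_factor_bounds K)).
  rewrite -[RHS]mulrA -exZl// -[RHS]mulrA.
  rewrite -[in RHS](eq_ex _ (FE x)).
  pose G z := f z * T x z * hood_likelihood K z.
  have bG : bmeas G by apply: bmeasM => //; exact: bmeas_hood_likelihood.
  have GK : depends_on (hood K) G.
    move=> z z' zz'; rewrite /G (LK z z' zz'); congr (_ * _); exact: fTK.
  transitivity (\int[prod_probability base]_z (G z * \prod_(v in ~: hood K) trans M v x (z v))).
    apply: eq_ex => z; rewrite /G /joint_trans (bigID (mem (hood K)))/= mulrA.
    rewrite -[RHS]mulrA [in RHS](eq_bigl (fun v => v \notin hood K)) => [|v]; last by rewrite inE.
    rewrite mulrA; congr (_ * _); exact: mulrAC.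
  rewrite (ex_prod_tilted_on (P' := base) (K := hood K) (h := fun v => trans M v x)) //.
  - congr (_ * _); first by apply: eq_bigr => v _; exact: ex_base_trans.
    rewrite (ex_prod_tilted_on (P' := posterior) (K := hood K)
      (h := fun v z => obs M v z (yt v))) //.
    - by move=> v; exact: bmeas_obs.
    - by move=> v t; exact: obs_ge0.
    - by move=> v; exact: ex_obs_gt0.
    - by move=> v vK g bg; rewrite vK; exact: ex_posterior.
  - by move=> v t; exact: trans_ge0.
  - by move=> v; rewrite ex_base_trans invr_gt0.
  - by move=> v vK g bg; rewrite inE vK.
rewrite (eq_ex _ inner) exZl.
  congr (_ * _).
  have bbf : bmeas (fun xz : XX * XX => block_factor hood p K xz.1 xz.2 * f xz.2).
    apply: bmeasM; last exact: bmeas_comp bf measurable_snd.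
    exact: (bmeas_block_factor hood (exprn_gt0 2 eps0) measurable_site_factor site_factor_bounds K).
  rewrite (ex_fubini _ _ bbf); apply: eq_ex => z /=.
  rewrite exZr//; exact: (bmeas_sec2 z
    (bmeas_block_factor hood (exprn_gt0 2 eps0) measurable_site_factor site_factor_bounds K)).
apply: (bmeas_ex2 (prod_probability posterior) (F := fun xz : XX * XX =>
  block_factor hood p K xz.1 xz.2 * f xz.2)).
apply: bmeasM; last exact: bmeas_comp bf measurable_snd.
exact: (bmeas_block_factor hood (exprn_gt0 2 eps0) measurable_site_factor site_factor_bounds K).
Qed.

(** Prediction followed by reweighting with the observations of one enlarged
block, in the form in which the tree unrolls it. *)
Lemma posterior_step (rho : probability XX R) K f : bmeas f -> depends_on (hood K) f ->
  \int[reweight (predict M rho) (mL K) (L0 K)]_z f z =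
  \int[step hood (exprn_gt0 2 eps0) measurable_site_factor site_factor_bounds posterior K rho]_z f z.
Proof.
move=> bf fK; have [k k0 kE] := ex_predict_hood rho K.
rewrite ex_reweight//; last 2 first.
- exact: bmeas_hood_likelihood.
- exact: ex_hood_likelihood_gt0.
rewrite ex_step// kE//.
have := kE (fun=> 1) (bmeas_cst _ _) (fun _ _ _ => erefl).
rewrite (eq_ex _ (g := hood_likelihood K)) => [|z]; last by rewrite mul1r.
move=> H; rewrite [X in _ / X]H -mulf_div divff ?gt_eqF// mul1r.
by congr (_ / _); apply: eq_ex => z; rewrite mulr1.
Qed.

End model_steps.

(** * The blocked update as a block product *)

Section blocked_update.
Context (R : realType) (V : finType) (dX dY : V -> measure_display)
  (X : forall v, measurableType (dX v)) (Y : forall v, measurableType (dY v))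
  (psi : forall v, {sigma_finite_measure set (X v) -> \bar R})
  (phi : forall v, {sigma_finite_measure set (Y v) -> \bar R}).
Variables (M : hmm psi phi) (e : rel V) (b : {nonneg R}).
Context (KK : {set {set V}}) (KK_part : finset.partition KK [set: V]%SET).
Local Notation XX := (prod_space X).
Local Notation blk := (block KK).
Variables (kappa : R) (kappa0 : 0 < kappa).
Hypotheses (obs_bound : forall v x y, kappa < obs M v x y < kappa^-1).
Arguments obs_bound : clear implicits.
Variable yt : prod_space Y.
Local Notation L := (hood_likelihood M e b yt).
Local Notation mL := (fun K : blk => bmeas_measurable (bmeas_hood_likelihood e b obs_bound yt K)).
Local Notation L0 := (fun K : blk => hood_likelihood_ge0 M e b yt K).

(** Restricting to a block after correcting the enlarged product only sees the
correction of the copy attached to that block. *)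
Lemma ex_block_update (rho : probability XX R) F : bmeas F ->
  \int[block_update M e b KK_part yt rho]_x F x =
  \int[block_prod KK_part (fun K => reweight rho (mL K) (L0 K))]_x F x.
Proof.
move=> bF.
pose nu := block_correct M yt (block_enlarge e b KK rho).
pose enl (K : blk) := enlarge e b (val K).
pose like (K : blk) (t : sub_space X (enl K)) : R :=
  \prod_(u : {v | v \in enl K}) obs M (val u) (t u) (yt (val u)).
pose P (K : blk) : probability (sub_space X (enl K)) R := marginal (enl K) rho.
have blike K : bmeas (@like K).
  apply: bmeas_prod => u _.
  apply: (bmeas_comp (bmeas_obs obs_bound (yt (val u))) (g := fun t : sub_space X (enl K) => t u)).
  exact: measurable_coord.
have like0 K t : 0 <= @like K t by apply: prodr_ge0 => u _; exact: obs_ge0.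
have likeE K x : @like K (@Defs.restrict _ _ X (enl K) x) = L K x.
  rewrite /L /hood_likelihood /like.
  exact: (esym (big_sub _ (fun v => obs M v (x v) (yt v)))).
have Elike K : \int[P K]_t @like K t = \int[rho]_x L K x.
  by rewrite ex_distribution//; apply: eq_ex => x; exact: likeE.
have Elike0 K : 0 < \int[P K]_t @like K t.
  by rewrite Elike; exact: (ex_hood_likelihood_gt0 e b kappa0 obs_bound).
have bEL : bmeas (enlarged_likelihood M (e := e) (b := b) (KK := KK) yt).
  apply: bmeas_prod => K _.
  apply: (bmeas_comp (blike K) (g := fun x : enlarged_space X e b KK => x K)).
  exact: measurable_coord.
have mg : measurable_fun setT (Defs.glue (X := X) KK_part KK_part) by exact: measurable_glue.
transitivity (\int[prod_probability (fun K : blk => distribution nu (@core R V dX X e b KK K))]_z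
    F (Defs.glue KK_part KK_part z)).
  exact: (ex_distribution _ _ bF).
transitivity (\int[prod_probability (fun K : blk =>
      marginal (val K) (reweight rho (mL K) (L0 K)))]_z F (Defs.glue KK_part KK_part z)); last first.
  by symmetry; exact: (ex_distribution _ _ bF).
apply: (prod_agree (J := [set: blk]%SET)) => [K _||].
2: exact: bmeas_comp bF mg.
2: by move=> x x' xx'; congr (F (Defs.glue KK_part KK_part _));
  apply: functional_extensionality_dep => K; apply: xx'; rewrite inE.
apply: ex_meq => f bf.
transitivity (\int[nu]_x f (core x)); first exact: (ex_distribution _ _ bf).
transitivity (\int[reweight rho (mL K) (L0 K)]_x f (@Defs.restrict _ _ X (val K) x)); last first.
  by symmetry; exact: (ex_distribution _ _ bf).
pose core1 (t : sub_space X (enl K)) : sub_space X (val K) :=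
  fun u => t (exist _ (val u) (sub_enlarge e b (valP u))).
have mcore1 : measurable_fun setT core1.
  apply: (@measurable_prod_spaceP _ _ (fun u : {v | v \in val K} => X (val u))) => u.
  exact: (@measurable_coord _ _ (fun u : {v | v \in enl K} => X (val u))
    (exist _ (val u) (sub_enlarge e b (valP u)))).
have bf1 := bmeas_comp bf mcore1.
have mxK : measurable_fun setT (fun x : enlarged_space X e b KK => x K).
  exact: measurable_coord.
have mres : measurable_fun setT (@Defs.restrict _ _ X (val K)) by exact: Defs.measurable_restrict.
have bfr := bmeas_comp bf mres.
have bfcore := bmeas_comp bf1 mxK.
rewrite ex_reweight//; last first.
- exact: (ex_hood_likelihood_gt0 e b kappa0 obs_bound).
- exact: bmeas_hood_likelihood obs_bound _ _.
have tiltE := ex_prod_tilted blike like0 Elike0.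
have E1 : \int[prod_probability P]_x \prod_K' @like K' (x K') = \prod_K' \int[P K']_t @like K' t.
  exact: ex_prod_factors.
transitivity (\int[tilted P blike like0 K]_t f (core1 t)).
  rewrite -(prod_coord (tilted P blike like0) bf1).
  rewrite /nu ex_reweight//.
    rewrite -[X in _ / X]/(\int[prod_probability P]_x \prod_K' @like K' (x K')) E1.
    rewrite -[X in X / _]/(\int[prod_probability P]_x (f (core1 (x K)) * \prod_K' @like K' (x K'))).
    rewrite tiltE// mulrC mulKf// gt_eqF//; apply: prodr_gt0 => K' _; exact: Elike0.
  rewrite -[X in _ < X]/(\int[prod_probability P]_x \prod_K' @like K' (x K')) E1.
  by apply: prodr_gt0 => K' _; exact: Elike0.
apply: (etrans (ex_tilted blike like0 Elike0 bf1)); rewrite Elike.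
apply: (f_equal (fun u : R => u / _)).
have bfl : bmeas (fun t => f (core1 t) * @like K t) by exact: bmeasM.
apply: (etrans (ex_distribution _ _ bfl)); apply: eq_ex => x.
by apply: (f_equal (fun u : R => _ * u)); exact: likeE.
Qed.

End blocked_update.

(** * Neighbourhoods in the graph *)

Section graph_distance.
Context (R : realType) (V : finType) (e : rel V) (r : nat) (b : {nonneg R}).
Hypothesis e_sym : symmetric e.
Local Notation dist := (graph_dist R e).

Let dist_le v w : (dist v w <= dist w v)%E.
Proof.
apply: le_ereal_inf_tmp => _ [p [pp pl] <-]; apply: ereal_inf_lbound.
exists (rev (belast w p)); last by rewrite size_rev size_belast.
split.
  by rewrite -pl rev_path (eq_path (e' := e)).
by case: p pl {pp} => [|x p] //= <-; rewrite rev_cons last_rcons.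
Qed.

Lemma mem_nbhdC v w : (w \in nbhd R e r v) = (v \in nbhd R e r w).
Proof. by rewrite !inE; congr (_ <= _)%E; apply/eqP; rewrite eq_le !dist_le. Qed.

Context (KK : {set {set V}}) (KK_part : finset.partition KK [set: V]%SET).
Local Notation own := (own_block KK_part).

Let set_dist_le (A B : {set V}) v w : v \in A -> w \in B -> w \in nbhd R e r v ->
  (set_dist R e A B <= r%:R%:E)%E.
Proof.
move=> vA wB; rewrite inE; apply: le_trans.
by apply: ereal_inf_lbound; exists v => //; exists w.
Qed.

Lemma card_own_nbhd v : (#|(own @: nbhd R e r v)%SET| <= block_degree R e r KK)%N.
Proof.
apply: (@leq_trans #|[set K' in KK | (set_dist R e (val (own v)) K' <= r%:R%:E)%E]%SET|).
  rewrite -(card_imset _ val_inj); apply/subset_leq_card/fintype.subsetP => _ /imsetP[_ /imsetP[w wv ->] ->].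
  rewrite inE (valP (own w))/=; apply: set_dist_le wv; exact: mem_own_block.
exact: (@leq_bigmax_cond _ (mem KK) (fun K => #|[set K' in KK | (set_dist R e K K' <= r%:R%:E)%E]%SET|)
  (val (own v)) (valP (own v))).
Qed.

Lemma card_nb_blocks K :
  (#|nb_blocks KK_part (nbhd R e r) (hood e b (KK := KK)) K| <= enlarged_degree e r b KK)%N.
Proof.
apply: (@leq_trans #|[set K' in KK | (set_dist R e K' (enlarge e b (val K)) <= r%:R%:E)%E]%SET|).
  rewrite -(card_imset _ val_inj); apply/subset_leq_card/fintype.subsetP => _ /imsetP[K' + ->].
  rewrite inE => /existsP[v /andP[vK /existsP[w /andP[wv /eqP <-]]]].
  rewrite inE (valP (own w))/=; apply: (set_dist_le (v := w) (w := v)) => //.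
    exact: mem_own_block.
  by rewrite -mem_nbhdC.
exact: (@leq_bigmax_cond _ (mem KK)
  (fun K => #|[set K' in KK | (set_dist R e K' (enlarge e b K) <= r%:R%:E)%E]%SET|)
  (val K) (valP K)).
Qed.

Lemma nbhd_refl v : v \in nbhd R e r v.
Proof.
rewrite inE; apply: (@le_trans _ _ 0%E); last by rewrite lee_fin.
by apply: ereal_inf_lbound; exists [::].
Qed.

Lemma max_nbhd_gt0 (v : V) : (0 < max_nbhd R e r)%N.
Proof.
apply: leq_trans (@leq_bigmax_cond _ predT (fun v => #|nbhd R e r v|) v isT).
by apply/card_gt0P; exists v; exact: nbhd_refl.
Qed.

Lemma block_degree_gt0 (v : V) : (0 < block_degree R e r KK)%N.
Proof.
apply: leq_trans (card_own_nbhd v).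
by apply/card_gt0P; exists (own v); rewrite imset_f// nbhd_refl.
Qed.

Lemma enlarged_degree_gt0 (v : V) : (0 < enlarged_degree e r b KK)%N.
Proof.
apply: leq_trans (card_nb_blocks (own v)).
apply/card_gt0P; exists (own v); rewrite inE; apply/existsP; exists v.
rewrite sub_enlarge ?mem_own_block//=.
by apply/existsP; exists v; rewrite nbhd_refl/=.
Qed.

Lemma card_hood (K : block KK) : (#|hood e b K| <= max_enlarged e b KK)%N.
Proof.
exact: (@leq_bigmax_cond _ (mem KK) (fun K => #|enlarge e b K|) (val K) (valP K)).
Qed.

Lemma card_nbhd v : (#|nbhd R e r v| <= max_nbhd R e r)%N.
Proof. by rewrite /max_nbhd; exact: (@leq_bigmax_cond _ predT (fun v => #|nbhd R e r v|) v isT). Qed.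

End graph_distance.

(** * The conditional law of new particles *)

Section conditional_sampling.
Context (R : realType) (dO : measure_display) (Omega : measurableType dO)
  (Pr : probability Omega R) (dT : measure_display) (T : measurableType dT) (N : nat).
Local Notation SN := (prod_space (fun _ : 'I_N => T)).
Local Notation iid rho := (prod_probability (fun _ : 'I_N => rho)).
Variables (theta : Omega -> SN) (xi : Omega -> SN).
Hypotheses (mtheta : measurable_fun setT theta) (mxi : measurable_fun setT xi).
(** The conditional law of the new particles is [rho], given through a density
[q] with respect to a fixed law [P]; [z] is the common normalising constant. *)
Variables (rho : Omega -> probability T R) (P : probability T R)
  (q : Omega * T -> R) (z : R).
Hypotheses (z0 : 0 < z) (bq : bmeas q) (q0 : forall wt, 0 <= q wt)
  (qz : forall w, \int[P]_t q (w, t) = z)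
  (ex_rho : forall w f, bmeas f -> \int[rho w]_t f t = (\int[P]_t (f t * q (w, t))) / z).
Hypothesis sampled : forall A B : 'I_N -> set T,
  (forall i, measurable (A i)) -> (forall i, measurable (B i)) ->
  Pr ([set w | forall i, A i (theta w i)] `&` [set w | forall i, B i (xi w i)]) =
  (\int[Pr]_(w in [set w | forall i, A i (theta w i)]) \prod_(i < N) rho w (B i))%E.

Let h w (i : 'I_N) (t : T) : R := q (w, t).
Let bh w i : bmeas (h w i) := bmeas_sec1 w bq.
Let h0 w (i : 'I_N) t : 0 <= h w i t := q0 (w, t).
Let Eh w (i : 'I_N) : 0 < \int[P]_t h w i t.
Proof. by rewrite qz. Qed.

Let D (wx : Omega * SN) : R := \prod_i q (wx.1, wx.2 i).

Let bD : bmeas D.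
Proof.
apply: bmeas_prod => i _.
apply: (bmeas_comp bq (g := fun wx : Omega * SN => (wx.1, wx.2 i))).
apply: measurable_fun_pair; first exact: measurable_fst.
exact: measurableT_comp (@measurable_coord _ _ (fun _ : 'I_N => T) i) measurable_snd.
Qed.

Let D0 wx : 0 <= D wx. Proof. by apply: prodr_ge0 => i _. Qed.

(** The new particles are independent given the past, so their joint law also
has a density with respect to a fixed product law. *)
Lemma ex_iid_density w f : bmeas f ->
  \int[iid P]_x (f x * D (w, x)) = z ^+ N * \int[iid (rho w)]_x f x.
Proof.
move=> bf; have := @ex_prod_tilted R _ _ (fun _ : 'I_N => T) (fun _ => P) (h w)
  (bh w) (h0 w) (Eh w) f bf.
rewrite [X in _ = X * _ -> _](_ : _ = z ^+ N) => [->|]; last first.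
  by rewrite (eq_bigr (fun=> z)) ?prodr_const ?card_ord// => i _; exact: qz.
congr (_ * _); apply: (prod_agree (J := [set: 'I_N]%SET)) => // [i _|x x' xx'].
  apply: ex_meq => g bg; rewrite ex_rho//.
  by rewrite (ex_tilted (P := fun _ : 'I_N => P) (bh w) (h0 w) (Eh w) (i := i) bg) /h qz.
by congr f; apply: functional_extensionality_dep => i; apply: xx'; rewrite inE.
Qed.

Let zN0 : 0 < z ^+ N. Proof. exact: exprn_gt0. Qed.

Let PP := (Pr \x iid P)%E.

Let bmeas_iid H : bmeas H -> bmeas (fun w => \int[iid (rho w)]_x H (w, x)).
Proof.
move=> bH; apply: (@eq_bmeas _ _ _ (fun w => (z ^+ N)^-1 *
  \int[iid P]_x (H (w, x) * D (w, x)))) => [w|].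
  by rewrite (ex_iid_density w (bmeas_sec1 w bH)) mulKf// gt_eqF.
apply: bmeasZ; apply: (bmeas_ex2 _ (F := fun wx => H wx * D wx)); exact: bmeasM.
Qed.

Let ex_density H : bmeas H ->
  \int[PP]_wx (H wx * D wx) = z ^+ N * \int[Pr]_w \int[iid (rho w)]_x H (w, x).
Proof.
move=> bH; rewrite ex_fubini1; last exact: bmeasM.
have E w : \int[iid P]_x (H (w, x) * D (w, x)) = z ^+ N * \int[iid (rho w)]_x H (w, x).
  exact: (ex_iid_density w (bmeas_sec1 w bH)).
apply: (etrans (eq_ex _ E)); exact: exZl (bmeas_iid bH).
Qed.

Let ED : \int[PP]_wx D wx = z ^+ N.
Proof.
have := ex_density (bmeas_cst _ 1).
rewrite (eq_ex _ (g := D)) => [|wx]; last by rewrite mul1r.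
move=> ->; rewrite -[RHS]mulr1; congr (_ * _).
by rewrite (eq_ex _ (g := fun=> 1)) ?ex_cst// => w; rewrite ex_cst.
Qed.

Let PD : 0 < \int[PP]_wx D wx. Proof. by rewrite ED. Qed.

Let Q : probability (Omega * SN)%type R := reweight PP (bmeas_measurable bD) D0.

Let ex_Q H : bmeas H -> \int[Q]_wx H wx = \int[Pr]_w \int[iid (rho w)]_x H (w, x).
Proof.
move=> bH; rewrite ex_reweight// ex_density// ED mulrC mulKf// gt_eqF//.
Qed.

Local Notation SN2 := (prod_space (fun _ : ('I_N + 'I_N)%type => T)).

Let join (x x' : SN) : SN2 := fun s => match s with inl i => x i | inr i => x' i end.

Let join1 w := join (theta w) (xi w).
Let join2 (wx : Omega * SN) := join (theta wx.1) wx.2.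

Let mcoord d1 (S : measurableType d1) (f : S -> SN) i :
  measurable_fun setT f -> measurable_fun setT (fun s => f s i).
Proof. by move=> mf; exact: measurableT_comp (@measurable_coord _ _ (fun _ : 'I_N => T) i) mf. Qed.

Let mjoin1 : measurable_fun setT join1.
Proof. by apply: measurable_prod_spaceP => -[i|i]; exact: mcoord. Qed.

Let mjoin2 : measurable_fun setT join2.
Proof.
apply: measurable_prod_spaceP => -[i|i]; last first.
  by apply: (mcoord (f := snd)); exact: measurable_snd.
by apply: (mcoord (f := theta \o fst)); exact: measurableT_comp.
Qed.

Let join_box (A : 'I_N + 'I_N -> set T) : (forall s, measurable (A s)) ->
  Pr (join1 @^-1` (box A : set SN2)) = Q (join2 @^-1` (box A : set SN2)).
Proof.
move=> mA; pose A1 (i : 'I_N) := A (inl i); pose A2 (i : 'I_N) := A (inr i).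
have -> : join1 @^-1` (box A : set SN2) =
    [set w | forall i, A1 i (theta w i)] `&` [set w | forall i, A2 i (xi w i)].
  apply/seteqP; split=> w /=; first by move=> H; split=> i; [exact: (H (inl i))|exact: (H (inr i))].
  by case=> H1 H2 [i|i]; [exact: H1|exact: H2].
have mA1 i : measurable (A1 i) by exact: mA.
have mA2 i : measurable (A2 i) by exact: mA.
rewrite sampled//; pose E1 := [set w | forall i, A1 i (theta w i)].
have mE1 : measurable E1.
  by have := mtheta measurableT (measurable_box mA1); rewrite setTI.
have mE2 : measurable (box A2 : set SN) by exact: measurable_box.
have mB : measurable (join2 @^-1` (box A : set SN2)).
  by have := mjoin2 measurableT (measurable_box mA); rewrite setTI.
pose g w : R := \int[iid (rho w)]_x \1_(box A2) x.
have bg : bmeas g.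
  apply: (bmeas_iid (H := fun wx => \1_(box A2) wx.2)).
  exact: (bmeas_comp (bmeas_indic R mE2) (@measurable_snd _ _ Omega SN)).
have gE w : (\prod_(i < N) rho w (A2 i))%E = (g w)%:E.
  rewrite /g ex_indic// fineK; last exact: fin_num_measure.
  exact: (esym (prod_probability_box (fun _ : 'I_N => rho w) mA2)).
transitivity (\int[Pr]_w (\1_E1 w * g w)%:E)%E.
  rewrite integral_mkcond -/E1; apply: eq_integral => w _; rewrite patchE gE indicE.
  by case: ifP => _; rewrite ?mul1r ?mul0r.
rewrite -EFin_ex; last by apply: bmeasM => //; exact: bmeas_indic.
rewrite -[RHS]fineK; last exact: fin_num_measure.
rewrite -ex_indic// ex_Q; last exact: bmeas_indic.
congr EFin; apply: eq_ex => w; rewrite /g -exZl; last exact: bmeas_indic.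
apply: eq_ex => x; rewrite !indicE.
have -> : ((w, x) \in join2 @^-1` (box A : set SN2)) = (w \in E1) && (x \in box A2).
  apply/idP/andP; rewrite !inE.
    by move=> H; split; move=> i; [exact: (H (inl i))|exact: (H (inr i))].
  by move=> [H1 H2] [i|i]; [exact: H1|exact: H2].
by case: (w \in E1); rewrite ?mul1r ?mul0r.
Qed.

(** The hypothesis only speaks of rectangles. Old and new particles together form
one product space, indexed by a disjoint sum, on which the two sides are laws
that agree on boxes; the density turns the right-hand side into such a law. *)
Lemma ex_sampled (H : SN * SN -> R) : bmeas H ->
  \int[Pr]_w H (theta w, xi w) =
  \int[Pr]_w \int[iid (rho w)]_x H (theta w, x).
Proof.
move=> bH.
pose G (x : SN2) : R := H (fun i => x (inl i), fun i => x (inr i)).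
have bG : bmeas G.
  apply: bmeas_comp bH _; apply: measurable_fun_pair; apply: measurable_prod_spaceP => i.
    exact: (@measurable_coord _ _ (fun _ : ('I_N + 'I_N)%type => T) (inl i)).
  exact: (@measurable_coord _ _ (fun _ : ('I_N + 'I_N)%type => T) (inr i)).
pose join1' : {mfun _ >-> _} := HB.pack join1 (isMeasurableFun.Build _ _ _ _ join1 mjoin1).
pose join2' : {mfun _ >-> _} := HB.pack join2 (isMeasurableFun.Build _ _ _ _ join2 mjoin2).
have same : meq (distribution Pr join1') (distribution Q join2').
  move=> B mB; apply: box_unique => //.
    by rewrite (le_lt_trans (probability_le1 _ _)) ?ltry.
transitivity (\int[distribution Pr join1']_x G x).
  by rewrite ex_distribution//; apply: eq_ex.
rewrite (meq_ex G same) ex_distribution// ex_Q//.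
exact: bmeas_comp bG mjoin2.
Qed.

Lemma ex_sampled_le (H : SN * SN -> R) (C : R) : bmeas H ->
  (forall w, \int[iid (rho w)]_x H (theta w, x) <= C) ->
  \int[Pr]_w H (theta w, xi w) <= C.
Proof.
move=> bH HC; rewrite ex_sampled//; apply: ex_le => //.
apply: (bmeas_iid (H := fun wx => H (theta wx.1, wx.2))).
apply: (bmeas_comp bH (g := fun wx : Omega * SN => (theta wx.1, wx.2))).
apply: measurable_fun_pair; last exact: measurable_snd.
exact: measurableT_comp mtheta measurable_fst.
Qed.

End conditional_sampling.

(** * Error of the particle filter *)

Section filter_error.
Context (R : realType) (V : finType) (dX dY : V -> measure_display)
  (X : forall v, measurableType (dX v)) (Y : forall v, measurableType (dY v))
  (psi : forall v, {sigma_finite_measure set (X v) -> \bar R})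
  (phi : forall v, {sigma_finite_measure set (Y v) -> \bar R}).
Variables (M : hmm psi phi) (e : rel V) (r : nat) (b : {nonneg R}).
Context (KK : {set {set V}}) (KK_part : finset.partition KK [set: V]%SET).
Hypothesis e_sym : symmetric e.
Hypothesis M_local : forall (v : V) (x1 x2 : prod_space X) (z : X v),
  (forall u, u \in nbhd R e r v -> x1 u = x2 u) -> trans M v x1 z = trans M v x2 z.
Local Notation XX := (prod_space X).
Local Notation blk := (block KK).
Variables (eps kappa : R).
Hypotheses (eps0 : 0 < eps) (eps1 : eps < 1) (kappa0 : 0 < kappa) (kappa1 : kappa < 1).
Hypotheses (trans_bound : forall v x z, eps < trans M v x z < eps^-1)
  (obs_bound : forall v x y, kappa < obs M v x y < kappa^-1).
Variables (y : nat -> prod_space Y) (mu : probability XX R).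
Variables (dO : measure_display) (Omega : measurableType dO) (Pr : probability Omega R).
Variables (N : nat) (N_gt0 : (0 < N)%N) (xi : nat -> 'I_N -> {mfun Omega >-> XX}).
Hypothesis sampled : conditionally_sampled M e b KK_part y mu Pr N_gt0 xi.
Local Notation SN := (prod_space (fun _ : 'I_N => XX)).
Local Notation iid rho := (prod_probability (fun _ : 'I_N => rho)).
Local Notation enl := (@hood R V e b KK).
Local Notation bprod := (block_prod KK_part).
Local Notation p := (@site_factor R V dX dY X Y psi phi M eps).
Local Notation mp := (@measurable_site_factor R V dX dY X Y psi phi M eps).
Local Notation pa := (site_factor_bounds eps0 trans_bound).
Local Notation pstep := (step enl (exprn_gt0 2 eps0) mp pa).
Local Notation laws := (block_laws KK_part enl (exprn_gt0 2 eps0) mp pa).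
Local Notation post t := (posterior obs_bound (y t)).
Local Notation L t := (hood_likelihood M e b (y t)).
Local Notation mL t := (fun K : blk => bmeas_measurable (bmeas_hood_likelihood e b obs_bound (y t) K)).
Local Notation L0 t := (fun K : blk => hood_likelihood_ge0 M e b (y t) K).
Local Notation upd t rho := (block_update M e b KK_part (y t) (predict M rho)).
Local Notation resampled t x := (block_update M e b KK_part (y t) (empirical_measure R (x : SN) N_gt0)).

Definition same_ex (rho rho' : probability XX R) := forall f, bmeas f ->
  \int[rho]_x f x = \int[rho']_x f x.

Lemma ex_upd t rho F : bmeas F ->
  \int[upd t rho]_x F x = \int[bprod (fun K => pstep (post t) K rho)]_x F x.
Proof.
move=> bF.
apply: (etrans (ex_block_update e b KK_part kappa0 obs_bound (y t) (predict M rho) bF)).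
apply: (block_prod_congr KK_part _ bF) => K f bf fK.
apply: (posterior_step eps0 kappa0 trans_bound obs_bound (y t) rho bf).
by move=> x x' xx'; apply: fK => v vK; apply: xx'; exact: sub_enlarge.
Qed.

Lemma ex_pstep_congr m K rho rho' F : same_ex rho rho' -> bmeas F ->
  \int[pstep m K rho]_x F x = \int[pstep m K rho']_x F x.
Proof.
move=> rr bF; rewrite !ex_step//.
have E z : step_density enl p rho K z =
    step_density enl p rho' K z.
  exact: (rr _ (bmeas_sec2 z (bmeas_block_factor enl (exprn_gt0 2 eps0) mp pa K))).
congr (_ / _); last exact: eq_ex.
by apply: eq_ex => z; rewrite E.
Qed.

(** [k] steps of the ideal filter, started at time [s]. *)
Fixpoint flow (s k : nat) (rho : probability XX R) : probability XX R :=
  if k is k'.+1 then upd (s + k) (flow s k' rho) else rho.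

Lemma flow_ideal n : ideal_filter M e b KK_part y mu n = flow 0 n mu.
Proof.
elim: n => [//|n IHn].
rewrite -[RHS]/(upd (0 + n.+1) (flow 0 n mu)) -IHn add0n; reflexivity.
Qed.

Lemma flowS s k rho : flow s k.+1 rho = flow s.+1 k (upd s.+1 rho).
Proof.
elim: k rho => [|k IHk] rho; first by rewrite -[LHS]/(upd (s + 1) rho) addn1.
rewrite -[LHS]/(upd (s + k.+2) (flow s k.+1 rho)) IHk.
by rewrite -[RHS]/(upd (s.+1 + k.+1) (flow s.+1 k (upd s.+1 rho))) addSnnS.
Qed.

Lemma upd_congr t rho rho' F : same_ex rho rho' -> bmeas F ->
  \int[upd t rho]_x F x = \int[upd t rho']_x F x.
Proof.
move=> rr bF.
apply: (etrans (ex_upd t rho bF)); apply: (etrans _ (esym (ex_upd t rho' bF))).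
by apply: (block_prod_congr KK_part _ bF) => K f bf _; exact: ex_pstep_congr.
Qed.

Lemma flow_congr s k rho rho' : same_ex rho rho' -> same_ex (flow s k rho) (flow s k rho').
Proof.
move=> rr; elim: k => [//|k IHk] F bF; exact: upd_congr.
Qed.

(** After the first step the ideal filter is a product over the blocks, and the
block laws obey the recursion that the tree unrolls. *)
Lemma ex_flow_laws s k rho F : bmeas F ->
  \int[flow s k.+1 rho]_x F x =
  \int[bprod (laws (fun i => post (s + i.+2)) (fun K => pstep (post (s + 1)) K rho) k)]_x F x.
Proof.
elim: k F => [|k IHk] F bF; first exact: (ex_upd (s + 1) rho bF).
apply: (etrans (ex_upd (s + k.+2) (flow s k.+1 rho) bF)).
by apply: (block_prod_congr KK_part _ bF) => K f bf _; exact: ex_pstep_congr.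
Qed.

Lemma upd_mfam d0 (S : measurableType d0) t (rho : S -> probability XX R) :
  mfam rho -> mfam (fun s => upd t (rho s)).
Proof.
move=> hrho; apply: (@mfam_ext _ _ _ _ _ (fun s => bprod (fun K => pstep (post t) K (rho s)))).
  by move=> s f bf; exact: (esym (ex_upd t (rho s) bf)).
by apply: block_prod_mfam => K; exact: step_mfam.
Qed.

Lemma flow_mfam d0 (S : measurableType d0) s k (rho : S -> probability XX R) :
  mfam rho -> mfam (fun w => flow s k (rho w)).
Proof. by move=> hrho; elim: k => //= k IHk; exact: upd_mfam. Qed.

Local Notation n := (max_enlarged e b KK).
Let c : R := kappa ^+ n.
Let ratio : R := kappa ^- (2 * n).

Let c0 : 0 < c. Proof. exact: exprn_gt0. Qed.

Let Lc t (K : blk) x : c <= L t K x.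
Proof.
apply: le_trans (hood_likelihood_ge e b kappa0 obs_bound (y t) K x).
exact: (ler_wiXn2l (ltW kappa0) (ltW kappa1) (card_hood e b K)).
Qed.

Let Lratio t (K : blk) x x' : L t K x <= ratio * L t K x'.
Proof.
apply: (le_trans (hood_likelihood_le e b obs_bound (y t) K x)).
apply: (@le_trans _ _ (ratio * c)); last first.
  by rewrite ler_wpM2l// invr_ge0 exprn_ge0// ltW.
rewrite /ratio /c mul2n -addnn exprD invfM -mulrA mulVf ?mulr1 ?gt_eqF ?exprn_gt0//.
rewrite lef_pV2 ?posrE ?exprn_gt0//.
exact: (ler_wiXn2l (ltW kappa0) (ltW kappa1) (card_hood e b K)).
Qed.

Local Notation sampleb t x := (sample_blocks N_gt0 (mL t) (L0 t) (x : SN)).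
Local Notation lawb t rho := (law_blocks rho (mL t) (L0 t)).

Lemma ex_resampled t (x : SN) : same_ex (resampled t x) (bprod (sampleb t x)).
Proof. move=> F bF; exact: (ex_block_update e b KK_part kappa0 obs_bound (y t) _ bF). Qed.

Lemma ex_upd_law t rho : same_ex (upd t rho) (bprod (lawb t (predict M rho))).
Proof. move=> F bF; exact: (ex_block_update e b KK_part kappa0 obs_bound (y t) _ bF). Qed.

Lemma resampled_mfam t : mfam (fun x : SN => resampled t x).
Proof.
apply: (@mfam_ext _ _ _ _ _ (fun x : SN => bprod (sampleb t x))).
  by move=> x f bf; exact: (esym (ex_resampled t x bf)).
apply: block_prod_mfam => K.
exact: (sample_blocks_mfam N_gt0 (mL t) (L0 t) c0 (Lc t) (Lratio t)).
Qed.

Definition particles (s : nat) (w : Omega) : SN := fun i => xi s i w.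

(** The initial filter is deterministic; with a constant configuration in place
of the missing particles, the filter is at every time a function of particles. *)
Definition past_particles (s : nat) (w : Omega) : SN :=
  if s is _.+1 then particles s w else point.

Definition filter_of (s : nat) (x : SN) : probability XX R :=
  if s is _.+1 then resampled s x else mu.

Lemma particle_filterE s w :
  particle_filter M e b KK_part y mu N_gt0 xi s w = filter_of s (past_particles s w).
Proof. by case: s. Qed.

Lemma filter_of_mfam s : mfam (filter_of s).
Proof. by case: s => [|s]; [exact: mfam_cst|exact: resampled_mfam]. Qed.

Lemma measurable_particles s : measurable_fun setT (particles s).
Proof. by apply: measurable_prod_spaceP => i; exact: measurable_funPT. Qed.

Lemma measurable_past_particles s : measurable_fun setT (past_particles s).
Proof. by case: s => [|s]; [exact: measurable_cst|exact: measurable_particles]. Qed.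

Let past_event s (A : 'I_N -> set XX) : (forall i, measurable (A i)) ->
  past xi s [set w | forall i, A i (past_particles s w i)].
Proof.
move=> mA; rewrite /past; set G := (X in <<s X >>).
rewrite -[X in X _]/(@measurable _ (g_sigma_algebraType G)).
case: s @G => [|s] G.
  have [H|H] := pselect (forall i, A i ((point : SN) i)).
    rewrite (_ : mkset _ = setT); first exact: measurableT.
    by apply/seteqP; split.
  rewrite (_ : mkset _ = set0); first exact: measurable0.
  by apply/seteqP; split.
rewrite (_ : mkset _ = \bigcap_(i in [set: 'I_N]) (xi s.+1 i @^-1` A i)); last first.
  by apply/seteqP; split=> w /= H i; [move=> _; exact: H|exact: (H i I)].
apply: fin_bigcap_measurable; first exact: finite_finset.
move=> i _; apply: sub_sigma_algebra; exists s.+1, i, (A i); split=> //.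
by rewrite leqnn.
Qed.

(** Bounds on the error of a fresh sample may be proved for fixed old particles. *)
Lemma ex_new_particles_le s (H : SN * SN -> R) (C : R) : bmeas H ->
  (forall th, \int[iid (predict M (filter_of s th))]_x H (th, x) <= C) ->
  \int[Pr]_w H (past_particles s w, particles s.+1 w) <= C.
Proof.
move=> bH HC.
pose q (wt : Omega * XX) : R :=
  \int[filter_of s (past_particles s wt.1)]_x joint_trans M x wt.2.
have bq : bmeas q.
  apply: (mfam_bmeas (F := fun wtx : (Omega * XX) * XX => joint_trans M wtx.2 wtx.1.2)
    (p := fun wt : Omega * XX => past_particles s wt.1) (filter_of_mfam s)).
    exact: measurableT_comp (measurable_past_particles s) measurable_fst.
  apply: (bmeas_comp (bmeas_joint_trans trans_bound)
    (g := fun wtx : (Omega * XX) * XX => (wtx.2, wtx.1.2))).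
  apply: measurable_fun_pair; first exact: measurable_snd.
  exact: measurableT_comp measurable_snd measurable_fst.
have q0 wt : 0 <= q wt by apply: Rintegral_ge0 => x _; exact: joint_trans_ge0.
apply: (ex_sampled_le (P := prod_probability (base psi)) (q := q)
  (measurable_past_particles s) (measurable_particles s.+1)
  (rho := fun w => predict M (filter_of s (past_particles s w)))
  (joint_mass_gt0 eps0 trans_bound) bq q0) => //.
- by move=> w; exact: (joint_density_mass eps0 trans_bound (filter_of s (past_particles s w))).
- by move=> w f bf; exact: (ex_predict_density eps0 trans_bound (filter_of s (past_particles s w)) bf).
move=> A B mA mB.
have pA : past xi s [set w | forall i, A i (past_particles s w i)].
  exact: past_event.
apply: (etrans (sampled pA mB)).
by apply: eq_integral => w _; apply: eq_bigr => i _; rewrite particle_filterE.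
Qed.



Local Notation a := (eps ^+ 2).
Local Notation Delta := (max_nbhd R e r).
Local Notation DK := (block_degree R e r KK).
Local Notation Db := (enlarged_degree e r b KK).
Hypotheses (Delta_gt0 : (0 < Delta)%N) (small : Delta%:R ^+ 2 * (1 - a) <= 6^-1).

Let decay : R := 2 * (Delta%:R ^+ 2 * (1 - a)).
Let q : R := 4 * ratio / Num.sqrt N%:R.

Let a1 : a < 1. Proof. by rewrite expr_lt1// ltW. Qed.

Let Delta0 : 0 < Delta%:R :> R. Proof. by rewrite ltr0n. Qed.

Let decay0 : 0 < decay.
Proof. by rewrite /decay mulr_gt0// mulr_gt0 ?exprn_gt0// subr_gt0. Qed.

(** The decay is twice the total influence [Delta ^+ 2 * (1 - a)] of a site on its
own generation: the children then account for at most [1/2], the parents for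
[1/18] and the generation itself for [1/6]. *)
Let influence_small :
  (1 - a) * (Delta%:R / decay + Delta%:R * decay + Delta%:R ^+ 2) <= 13 / 18.
Proof.
have D1 : 1 <= Delta%:R :> R by rewrite ler1n.
move: small Delta0 decay0 D1; rewrite /decay; set D : R := Delta%:R; set h : R := 1 - a.
move=> sm D0 de0 D1; have h0 : 0 < h by rewrite /h subr_gt0.
have -> : h * (D / (2 * (D ^+ 2 * h)) + D * (2 * (D ^+ 2 * h)) + D ^+ 2) =
    2^-1 * D^-1 + 2 * D^-1 * (D ^+ 2 * h) ^+ 2 + D ^+ 2 * h.
  by field; rewrite !gt_eqF.
have Di : D^-1 <= 1 by rewrite invf_le1.
have Di0 : 0 <= D^-1 by rewrite invr_ge0 ltW.
have t0 : 0 <= D ^+ 2 * h by rewrite mulr_ge0 ?exprn_ge0 ?ltW.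
have t2 : (D ^+ 2 * h) ^+ 2 <= 36^-1.
  by rewrite (_ : 36^-1 = (6^-1) ^+ 2 :> R); [apply: lerXn2r; rewrite ?nnegrE ?invr_ge0|field].
have p1 : D^-1 * (D ^+ 2 * h) ^+ 2 <= 36^-1.
  by rewrite -[leRHS]mul1r ler_pM// sqr_ge0.
move: p1; rewrite -!mulrA; set u := D^-1 * _ => p1.
lra.
Qed.

Section observable.
Variables (K : blk) (I : {set V}) (f : XX -> R).
Hypotheses (bf : bmeas f) (f1 : forall x, `|f x| <= 1) (fI : depends_on I f)
  (IK : I \subset val K).

Let fK : depends_on (val K) f.
Proof. by move=> x x' xx'; apply: fI => v vI; apply: xx'; exact: (fintype.subsetP IK). Qed.

(** Error made by sampling at time [s + 1], seen [k] steps later. *)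
Definition step_error s k (tx : SN * SN) : R :=
  \int[flow s.+1 k (resampled s.+1 tx.2)]_z f z -
  \int[flow s k.+1 (filter_of s tx.1)]_z f z.

Lemma bmeas_step_error s k : bmeas (step_error s k).
Proof.
apply: bmeasB.
  apply: (mfam_bmeas (F := fun txz : (SN * SN) * XX => f txz.2)
    (p := fun tx : SN * SN => tx.2) (flow_mfam s.+1 k (resampled_mfam s.+1))).
    exact: measurable_snd.
  exact: (bmeas_comp bf (@measurable_snd _ _ (SN * SN)%type XX)).
apply: (mfam_bmeas (F := fun txz : (SN * SN) * XX => f txz.2)
  (p := fun tx : SN * SN => tx.1) (flow_mfam s k.+1 (filter_of_mfam s))).
  exact: measurable_fst.
exact: (bmeas_comp bf (@measurable_snd _ _ (SN * SN)%type XX)).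
Qed.

Definition step_bound (k : nat) : R :=
  if k is j.+1 then (Db ^ j)%:R * (2 * #|I|%:R * decay ^+ j) * eps ^- n ^+ 3 *
    (q * (DK%:R * ((1 - a) * n%:R)))
  else q.

Lemma step_bound_ge0 k : 0 <= step_bound k.
Proof.
have ratio0 : 0 <= ratio by rewrite invr_ge0 exprn_ge0// ltW.
have q0 : 0 <= q by rewrite /q divr_ge0 ?mulr_ge0 ?sqrtr_ge0.
have h0 : 0 <= 1 - a by rewrite subr_ge0 ltW.
case: k => [//|j]; rewrite /step_bound mulr_ge0//; last by rewrite mulr_ge0// mulr_ge0// mulr_ge0.
rewrite mulr_ge0//; last by rewrite exprn_ge0// invr_ge0 exprn_ge0// ltW.
by rewrite mulr_ge0// mulr_ge0// exprn_ge0// ltW.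
Qed.

(** An error made in the last step is a plain sampling error on one block; older
errors are damped by the dynamics. *)
Lemma step_error_bound s k th :
  \int[iid (predict M (filter_of s th))]_x step_error s k (th, x) ^+ 2 <= step_bound k ^+ 2.
Proof.
pose rho : probability XX R := predict M (filter_of s th).
rewrite -[leLHS]/(\int[iid rho]_x step_error s k (th, x) ^+ 2).
case: k => [|j].
  have E x : step_error s 0 (th, x) = sampling_error KK_part rho N_gt0 (mL s.+1) (L0 s.+1) f x.
    apply: (f_equal2 (fun u w : R => u - w)); first exact: (ex_resampled s.+1 x bf).
    apply: (etrans (f_equal (fun P : probability XX R => \int[P]_z f z) (flowS s 0 (filter_of s th)))).
    exact: (ex_upd_law s.+1 (filter_of s th) bf).
  under eq_ex do rewrite E.
  have Kf : blocks_dep KK_part [:: K] f.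
    by move=> x x' xx'; apply: fK => v; rewrite mem_own => /eqP vK; apply: xx'; rewrite vK inE.
  have := sampling_second_moment rho N_gt0 (mL s.+1) (L0 s.+1) c0 (Lc s.+1) (Lratio s.+1) bf f1 Kf.
  by rewrite mulr1.
pose m i := post (s.+1 + i.+2).
pose m0 := post (s.+1 + 1).
pose after rho' := laws m (fun K' => pstep m0 K' rho') j K.
have flowE rho1 rho2 : same_ex rho1 rho2 ->
    \int[flow s.+1 j.+1 rho1]_z f z = \int[after rho2]_z f z.
  move=> rr; apply: (etrans (flow_congr s.+1 j.+1 rr bf)).
  apply: (etrans (ex_flow_laws s.+1 j rho2 bf)).
  exact: block_prod_block.
have E x : step_error s j.+1 (th, x) =
    \int[after (bprod (sampleb s.+1 x))]_z f z - \int[after (bprod (lawb s.+1 rho))]_z f z.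
  apply: (f_equal2 (fun u w : R => u - w)).
    exact: (flowE _ _ (ex_resampled s.+1 x)).
  apply: (etrans (f_equal (fun P : probability XX R => \int[P]_z f z) (flowS s j.+1 (filter_of s th)))).
  exact: (flowE _ _ (ex_upd_law s.+1 (filter_of s th))).
have local v (x x' : XX) (z : X v) : (forall w, w \in nbhd R e r v -> x w = x' w) ->
    @site_factor R V dX dY X Y psi phi M eps v x z = @site_factor R V dX dY X Y psi phi M eps v x' z.
  by move=> xx'; rewrite /site_factor (M_local z xx').
have r01 : 0 <= (13 / 18 : R) < 1 by apply/andP; split; lra.
have al0 : 0 <= eps ^- n by rewrite invr_ge0 exprn_ge0// ltW.
have alE : a ^- n = (eps ^- n) ^+ 2 by rewrite -exprM mulnC exprM exprVn.
have H := @sampled_forgetting R V dX X KK KK_part (nbhd R e r) enl a p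
  (mem_nbhdC R r e_sym) (exprn_gt0 2 eps0) a1 mp pa local decay Delta n Db (13 / 18) decay0
  (card_nbhd R e r) (card_hood e b (KK := KK)) (card_nb_blocks r b e_sym KK_part) r01
  influence_small DK (card_own_nbhd R e r KK_part) rho N N_gt0 _ (mL s.+1) (L0 s.+1) _ _
  c0 (Lc s.+1) (Lratio s.+1) m m0 j K I f bf f1 fI (eps ^- n) al0 alE.
apply: (le_trans _ H).
by rewrite le_eqVlt; apply/orP; left; apply/eqP; apply: eq_ex => x; rewrite E.
Qed.

Local Notation D n' w := (\int[ideal_filter M e b KK_part y mu n']_z f z -
  \int[particle_filter M e b KK_part y mu N_gt0 xi n' w]_z f z : R).

(** The exact dynamics is restarted from the particle filter at every time; two
consecutive restarts differ by one sampling step. *)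
Lemma filter_error_telescopes n' w :
  D n' w = - \sum_(s < n') step_error s (n' - s.+1) (past_particles s w, particles s.+1 w).
Proof.
pose g s := \int[flow s (n' - s) (filter_of s (past_particles s w))]_z f z.
have gE (s : 'I_n') : g s.+1 - g s =
    step_error s (n' - s.+1) (past_particles s w, particles s.+1 w).
  have nE : (n' - s = (n' - s.+1).+1)%N by rewrite subnSK.
  by rewrite /g nE.
have -> : \sum_(s < n') step_error s (n' - s.+1) (past_particles s w, particles s.+1 w) =
    g n' - g 0%N.
  rewrite -(eq_bigr _ (fun s _ => gE s)) -(big_mkord xpredT (fun s => g s.+1 - g s)).
  exact: telescope_sumr.
rewrite opprB; apply: (f_equal2 (fun u w : R => u - w)).
  rewrite /g subn0.
  exact: (f_equal (fun P : probability XX R => \int[P]_z f z) (flow_ideal n')).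
rewrite /g subnn.
exact: (f_equal (fun P : probability XX R => \int[P]_z f z) (particle_filterE n' w)).
Qed.

Lemma bmeas_filter_error n' : bmeas (fun w => D n' w).
Proof.
apply: (@eq_bmeas _ _ _ (fun w => - \sum_(s < n')
  step_error s (n' - s.+1) (past_particles s w, particles s.+1 w))) => [w|].
  by rewrite filter_error_telescopes.
apply: bmeasN; apply: bmeas_sum => s _.
apply: (bmeas_comp (bmeas_step_error s (n' - s.+1))
  (g := fun w => (past_particles s w, particles s.+1 w))).
by apply: measurable_fun_pair; [exact: measurable_past_particles|exact: measurable_particles].
Qed.

Lemma filter_error_bound n' :
  \int[Pr]_w (D n' w) ^+ 2 <= (\sum_(k < n') step_bound k) ^+ 2.
Proof.
pose G (s : 'I_n') w := step_error s (n' - s.+1) (past_particles s w, particles s.+1 w).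
have mpair s : measurable_fun setT (fun w => (past_particles s w, particles s.+1 w)).
  by apply: measurable_fun_pair; [exact: measurable_past_particles|exact: measurable_particles].
have bG s : bmeas (G s).
  exact: (bmeas_comp (bmeas_step_error s (n' - s.+1)) (mpair s)).
have G2 s : \int[Pr]_w G s w ^+ 2 <= step_bound (n' - s.+1) ^+ 2.
  have bH := bmeasX 2 (bmeas_step_error s (n' - s.+1)).
  by apply: (ex_new_particles_le bH) => th; exact: step_error_bound.
rewrite (eq_ex _ (g := fun w => (\sum_s G s w) ^+ 2)) => [|w]; last first.
  by rewrite filter_error_telescopes sqrrN.
rewrite (reindex_inj rev_ord_inj)/=.
apply: (@ex_sqr_sum _ _ _ Pr _ _ G (fun s : 'I_n' => step_bound (n' - s.+1))) => // s.
exact: step_bound_ge0.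
Qed.

End observable.
End filter_error.

(** * Summing the errors *)

Lemma geometric_sum_le (R : realFieldType) (x t : R) m : 0 <= x -> x <= t -> t < 1 ->
  \sum_(i < m) x ^+ i <= (1 - t)^-1.
Proof.
move=> x0 xt t1; have x1 := le_lt_trans xt t1.
have h0 : 0 < 1 - t by rewrite subr_gt0.
rewrite -[leRHS]mul1r ler_pdivlMr// mulrC.
apply: (@le_trans _ _ ((1 - x) * \sum_(i < m) x ^+ i)).
  by rewrite ler_wpM2r ?sumr_ge0// => [i _|]; [rewrite exprn_ge0|rewrite lerD2l lerN2].
have := subrX1 x m; rewrite -[in (1 - x)]opprB mulNr => <-.
by rewrite opprB lerBlDr lerDl exprn_ge0.
Qed.

(** By Bernoulli's inequality the total influence of [n] sites is absorbed by
one more factor [eps ^- n]. *)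
Lemma site_influence_le (R : realFieldType) (eps : R) n : 0 < eps -> eps < 1 ->
  (1 - eps ^+ 2) * n%:R <= 2 * eps ^- n.
Proof.
move=> e0 e1; have ei0 : 0 < eps^-1 by rewrite invr_gt0.
have ei1 : 1 <= eps^-1 by rewrite invf_ge1// ltW.
have h : 1 - eps ^+ 2 <= 2 * (eps^-1 - 1).
  have -> : 1 - eps ^+ 2 = (1 + eps) * eps * (eps^-1 - 1) by field; rewrite gt_eqF.
  rewrite ler_wpM2r ?subr_ge0//; nra.
have bernoulli : n%:R * (eps^-1 - 1) <= eps^-1 ^+ n - 1.
  elim: n => [|n IHn]; first by rewrite mul0r expr0 subrr.
  have : 1 <= eps^-1 ^+ n by rewrite exprn_ege1.
  rewrite exprS -natr1; set z := eps^-1 ^+ n in IHn *.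
  by set u := eps^-1 in ei1 IHn *; set k : R := n%:R in IHn * => z1; nra.
rewrite -exprVn.
apply: (@le_trans _ _ (2 * (eps^-1 - 1) * n%:R)); first by rewrite ler_wpM2r.
by rewrite -mulrA ler_wpM2l// mulrC (le_trans bernoulli)// gerBl.
Qed.

(** The sampling step at time [n] contributes a constant 4; the older ones form
a geometric series whose ratio, [Db] times the decay, is at most [t], and
contribute a constant 16. Their sum 20 is below 64. *)
Lemma error_sum_le (R : rcfType) (eps kappa t : R) (D Db DK n N i m : nat) :
  0 < eps -> eps < 1 -> 0 < kappa -> kappa < 1 -> (0 < N)%N ->
  (0 < DK)%N -> (0 < i)%N -> t < 1 ->
  Db%:R * (2 * (D%:R ^+ 2 * (1 - eps ^+ 2))) <= t ->
  \sum_(k < m) (if (k : nat) is j.+1 then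
     (Db ^ j)%:R * (2 * i%:R * (2 * (D%:R ^+ 2 * (1 - eps ^+ 2))) ^+ j) * eps ^- n ^+ 3 *
       (4 * kappa ^- (2 * n) / Num.sqrt N%:R * (DK%:R * ((1 - eps ^+ 2) * n%:R)))
   else 4 * kappa ^- (2 * n) / Num.sqrt N%:R) <=
  i%:R * (64 * DK%:R / (1 - t)) *
    (eps ^- (4 * n) * kappa ^- (4 * n * DK) / Num.sqrt N%:R).
Proof.
move=> e0 e1 k0 k1 N0 DK0 i0 t1 rt.
set q : R := 4 * kappa ^- (2 * n) / Num.sqrt N%:R.
pose x : R := Db%:R * (2 * (D%:R ^+ 2 * (1 - eps ^+ 2))).
pose al : R := eps ^- n.
have h0 : 0 <= 1 - eps ^+ 2 by rewrite subr_ge0 exprn_ile1// ltW.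
have x0 : 0 <= x by rewrite mulr_ge0// mulr_ge0// mulr_ge0// exprn_ge0.
have sN : 0 < Num.sqrt N%:R :> R by rewrite sqrtr_gt0 ltr0n.
have kn j : 0 < kappa ^- j by rewrite invr_gt0 exprn_gt0.
have q0 : 0 <= q by rewrite /q divr_ge0 ?mulr_ge0 ?ltW.
have al1 : 1 <= al by rewrite /al invf_ge1 ?exprn_gt0// exprn_ile1// ltW.
have al0 : 0 <= al by exact: le_trans al1.
have tt0 : 0 < 1 - t by rewrite subr_gt0.
have t0 : 0 <= t by exact: le_trans rt.
have s1 : 1 <= (1 - t)^-1 by rewrite invf_ge1// gerBl.
have i1 : 1 <= i%:R :> R by rewrite ler1n.
have DK1 : 1 <= DK%:R :> R by rewrite ler1n.
have iDK1 : 1 <= i%:R * DK%:R * al ^+ 4 * (1 - t)^-1.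
  by rewrite !mulr_ege1// exprn_ege1.
apply: (@le_trans _ _ (q * (5 * (i%:R * DK%:R * al ^+ 4 * (1 - t)^-1)))); last first.
  have kk : kappa ^- (2 * n) <= kappa ^- (4 * n * DK).
    rewrite lef_pV2 ?posrE ?exprn_gt0//; apply: ler_wiXn2l; rewrite ?ltW//.
    by rewrite -mulnA leq_mul// leq_pmulr.
  have -> : i%:R * (64 * DK%:R / (1 - t)) *
      (eps ^- (4 * n) * kappa ^- (4 * n * DK) / Num.sqrt N%:R) =
    64 * (i%:R * DK%:R * al ^+ 4 * (1 - t)^-1) * (kappa ^- (4 * n * DK) / Num.sqrt N%:R).
    have -> : eps ^- (4 * n) = al ^+ 4 by rewrite /al mulnC exprM exprVn.
    by ring.
  have -> : q * (5 * (i%:R * DK%:R * al ^+ 4 * (1 - t)^-1)) =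
    20 * (i%:R * DK%:R * al ^+ 4 * (1 - t)^-1) * (kappa ^- (2 * n) / Num.sqrt N%:R).
    by rewrite /q; ring.
  set w := i%:R * DK%:R * al ^+ 4 * (1 - t)^-1 in iDK1 *.
  have w0 : 0 <= w by exact: le_trans iDK1.
  have sNi : 0 <= (Num.sqrt N%:R)^-1 :> R by rewrite invr_ge0 ltW.
  apply: ler_pM; [exact: mulr_ge0|exact: mulr_ge0 (ltW (kn _)) sNi| |exact: ler_wpM2r].
  by rewrite ler_wpM2r// ler_nat.
case: m => [|m]; first by rewrite big_ord0 mulr_ge0// mulr_ge0// (le_trans _ iDK1).
rewrite big_ord_recl.
pose B : R := 4 * (i%:R * DK%:R * al ^+ 4).
apply: (@le_trans _ _ (q + q * B * \sum_(j < m) x ^+ j)).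
  rewrite lerD2l mulr_sumr; apply: ler_sum => j _.
  rewrite -/al natrX.
  have -> : Db%:R ^+ j * (2 * i%:R * (2 * (D%:R ^+ 2 * (1 - eps ^+ 2))) ^+ j) * al ^+ 3 *
      (q * (DK%:R * ((1 - eps ^+ 2) * n%:R))) =
     q * (2 * i%:R * DK%:R * al ^+ 3 * ((1 - eps ^+ 2) * n%:R)) * x ^+ j.
    by rewrite /x [in RHS]exprMn; ring.
  rewrite ler_wpM2r ?exprn_ge0// ler_wpM2l//.
  have -> : B = 2 * i%:R * DK%:R * al ^+ 3 * (2 * al) by rewrite /B; ring.
  by rewrite ler_wpM2l ?mulr_ge0 ?exprn_ge0//; exact: site_influence_le.
have -> : q * (5 * (i%:R * DK%:R * al ^+ 4 * (1 - t)^-1)) =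
    q * (i%:R * DK%:R * al ^+ 4 * (1 - t)^-1) + q * B * (1 - t)^-1.
  by rewrite /B; ring.
apply: lerD; first by rewrite -[leLHS]mulr1 ler_wpM2l.
rewrite ler_wpM2l//; last exact: geometric_sum_le x0 rt t1.
by rewrite mulr_ge0// /B mulr_ge0// mulr_ge0 ?exprn_ge0// mulr_ge0.
Qed.

(** * The error bound *)

(** The threshold on [eps] says that [t < 1]; since [eps ^+ (2 * D) <= eps ^+ 2],
the influence of a single site is then small as well. *)
Lemma contraction_factor (R : realType) (eps : R) (D Db : nat) :
  0 < eps -> eps < 1 -> (0 < D)%N -> (0 < Db)%N ->
  (1 - (6 * Db%:R * D%:R ^+ 2)^-1) `^ (2 * D%:R)^-1 < eps ->
  let t := 6 * Db%:R * D%:R ^+ 2 * (1 - eps ^+ (2 * D)) in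
  [/\ 0 < t, t < 1, D%:R ^+ 2 * (1 - eps ^+ 2) <= 6^-1 &
      Db%:R * (2 * (D%:R ^+ 2 * (1 - eps ^+ 2))) <= t].
Proof.
move=> e0 e1 D0 Db0 le_eps t.
have D1 : 1 <= D%:R :> R by rewrite ler1n.
have Db1 : 1 <= Db%:R :> R by rewrite ler1n.
have D2 : 1 <= D%:R ^+ 2 :> R by rewrite exprn_ege1.
set C : R := 6 * Db%:R * D%:R ^+ 2 in le_eps t *.
have C1 : 1 <= C by rewrite /C !mulr_ege1// ler1n.
have C0 : 0 < C by exact: lt_le_trans C1.
have eD1 : eps ^+ (2 * D) < 1 by rewrite exprn_ilt1 ?muln_eq0 -?lt0n//= ?ltW//; case: (D) D0.
have t0 : 0 < t by rewrite mulr_gt0// subr_gt0.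
have base0 : 0 <= 1 - C^-1 by rewrite subr_ge0 invf_le1.
have p0 : 0 < 2 * D%:R :> R by rewrite mulr_gt0// ltr0n.
have lt_pow : 1 - C^-1 < eps ^+ (2 * D).
  have -> : 1 - C^-1 = ((1 - C^-1) `^ (2 * D%:R)^-1) ^+ (2 * D).
    rewrite -powR_mulrn ?powR_ge0// -powRrM natrM mulVf ?powRr1//.
    by rewrite gt_eqF.
  rewrite ltr_pXn2r ?nnegrE ?powR_ge0 ?ltW//.
  by rewrite muln_gt0/= D0.
have t1 : t < 1.
  by rewrite -[ltRHS](mulfV (lt0r_neq0 C0)) /t ltr_pM2l// ltrBlDr -ltrBlDl.
have e2 : eps ^+ (2 * D) <= eps ^+ 2.
  by apply: ler_wiXn2l; rewrite ?ltW// -[X in (X <= _)%N]muln1 leq_mul.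
have h0 : 0 <= 1 - eps ^+ 2 by rewrite subr_ge0 exprn_ile1// ltW.
have h1 : 1 - eps ^+ 2 <= 1 - eps ^+ (2 * D) by rewrite lerD2l lerN2.
have le6 : 6 * Db%:R * (D%:R ^+ 2 * (1 - eps ^+ 2)) <= t.
  by rewrite mulrA ler_wpM2l// ltW.
have u0 : 0 <= D%:R ^+ 2 * (1 - eps ^+ 2) by rewrite mulr_ge0// exprn_ge0.
split=> //; move: le6 u0; set u := D%:R ^+ 2 * (1 - eps ^+ 2) => le6 u0; nra.
Qed.

Theorem theorem5 (R : realType) (V : finType) (e : rel V)
    (e_sym : symmetric e) (r : nat) (r_gt0 : (0 < r)%N)
    (X Y : V -> ptopologicalType)
    (X_polish : forall v, polish R (X v)) (Y_polish : forall v, polish R (Y v))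
    (psi : forall v, {sigma_finite_measure set (borel (X v)) -> \bar R})
    (phi : forall v, {sigma_finite_measure set (borel (Y v)) -> \bar R})
    (M : hmm psi phi)
    (M_local : forall (v : V) (x1 x2 : prod_space (fun v => borel (X v)))
        (z : borel (X v)),
      (forall u, u \in nbhd R e r v -> x1 u = x2 u) ->
      trans M v x1 z = trans M v x2 z)
    (b : {nonneg R}) (KK : {set {set V}})
    (KK_part : finset.partition KK [set: V]%SET)
    (y : nat -> prod_space (fun v => borel (Y v)))
    (dO : measure_display) (Omega : measurableType dO)
    (Pr : probability Omega R) (N : nat) (N_gt0 : (0 < N)%N)
    (eps kappa : R) (eps_01 : 0 < eps < 1) (kappa_01 : 0 < kappa < 1)
    (trans_bound : forall (v : V) (x z : prod_space (fun v => borel (X v))),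
      eps < trans M v x (z v) < eps^-1)
    (obs_bound : forall (v : V) (x : prod_space (fun v => borel (X v)))
        (y' : prod_space (fun v => borel (Y v))),
      kappa < obs M v (x v) (y' v) < kappa^-1) :
  let Delta := max_nbhd R e r in
  let Kinf := max_enlarged e b KK in
  let DeltaK := block_degree R e r KK in
  let DeltaKbar := enlarged_degree e r b KK in
  (1 - (6 * DeltaKbar%:R * Delta%:R ^+ 2)^-1) `^ (2 * Delta%:R)^-1 < eps ->
  let beta :=
    - ln (6 * DeltaKbar%:R * Delta%:R ^+ 2 * (1 - eps ^+ (2 * Delta))) in
  forall (mu : probability (prod_space (fun v => borel (X v))) R)
    (xi : nat -> 'I_N -> {mfun Omega >-> prod_space (fun v => borel (X v))}),
  conditionally_sampled M e b KK_part y mu Pr N_gt0 xi ->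
  forall (n : nat) (K I : {set V}), K \in KK -> I \subset K ->
    0 < beta /\
    (local_dist Pr I
       (fun=> ideal_filter M e b KK_part y mu n)
       (particle_filter M e b KK_part y mu N_gt0 xi n)
     <= (#|I|%:R * (64 * DeltaK%:R / (1 - expR (- beta)))
         * (eps ^- (4 * Kinf) * kappa ^- (4 * Kinf * DeltaK)
            / Num.sqrt N%:R))%:E)%E.
Proof.
move=> Delta Kinf DeltaK DeltaKbar le_eps beta mu xi sampled n K I KKK IK.
case/andP: eps_01 => e0 e1; case/andP: kappa_01 => k0 k1.
have [v0 v0K] : exists v, v \in K.
  apply/finset.set0Pn; apply: contraTneq KKK => ->.
  by have /and3P[] := KK_part.
have D0 : (0 < Delta)%N by exact: max_nbhd_gt0.
have DK0 : (0 < DeltaK)%N by exact: block_degree_gt0.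
have Db0 : (0 < DeltaKbar)%N by exact: enlarged_degree_gt0.
have [] := contraction_factor e0 e1 D0 Db0 le_eps.
rewrite -[X in - ln X]/(6 * DeltaKbar%:R * Delta%:R ^+ 2 * (1 - eps ^+ (2 * Delta))) in beta *.
set t : R := 6 * _ * _ * _ in beta * => t0 t1 small le_t.
have -> : expR (- beta) = t by rewrite opprK lnK.
split; first by rewrite oppr_gt0 ln_lt0// t0 t1.
(* The bounds are given along configurations; every value of a coordinate
   occurs in one. *)
have tb v (x : prod_space (fun v => borel (X v))) (z : borel (X v)) :
    eps < trans M v x z < eps^-1.
  have := trans_bound v x (dfwith point v z : prod_space (fun v => borel (X v))).
  by rewrite dfwithin.
have ob v (x : borel (X v)) (y' : borel (Y v)) : kappa < obs M v x y' < kappa^-1.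
  have := obs_bound v (dfwith point v x : prod_space (fun v => borel (X v)))
    (dfwith point v y' : prod_space (fun v => borel (Y v))).
  by rewrite !dfwithin.
apply: ge_ereal_sup => _ [f [mf f1 fI] <-].
have bf : bmeas f by exact: bmeasP mf f1.
pose D w := \int[ideal_filter M e b KK_part y mu n]_z f z -
  \int[particle_filter M e b KK_part y mu N_gt0 xi n w]_z f z.
set B := (X in (_ <= X%:E)%E).
have tt0 : 0 < 1 - t by rewrite subr_gt0.
have B0 : 0 <= B.
  rewrite /B mulr_ge0// ?mulr_ge0// ?mulr_ge0 ?invr_ge0 ?sqrtr_ge0 ?exprn_ge0 ?(ltW e0) ?(ltW k0) ?(ltW tt0)//.
pose K0 : block KK := exist _ K KKK.
have bD : bmeas D.
  exact: (bmeas_filter_error e b KK_part e0 k0 k1 tb ob y mu N_gt0 xi bf n).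
have DB : \int[Pr]_w D w ^+ 2 <= B ^+ 2.
  have [I0|I0] := posnP #|I|.
    (* The bound vanishes, but an observable of no coordinate is constant. *)
    have fc x : f x = f point.
      by apply: fI => v; move/eqP: I0; rewrite cards_eq0 => /eqP ->; rewrite inE.
    have D_0 w : D w ^+ 2 = 0.
      rewrite /D (eq_ex _ fc) (eq_ex _ fc) !ex_cst subrr expr0n//.
    by rewrite (eq_ex _ D_0) ex_cst sqr_ge0.
  apply: (le_trans (filter_error_bound (K := K0) e_sym M_local e0 e1 k0 k1 tb ob sampled D0 small
    bf f1 fI IK n)).
  rewrite ler_sqr ?nnegrE//; last first.
    by apply: sumr_ge0 => k _; exact: step_bound_ge0.
  exact: (error_sum_le Kinf n e0 e1 k0 k1 N_gt0 DK0 I0 t1 le_t).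
have -> : (\int[Pr]_w (`|D w| ^+ 2)%:E)%E = (\int[Pr]_w D w ^+ 2)%:E.
  rewrite EFin_ex; last exact: bmeasX.
  by apply: eq_integral => w _; rewrite real_normK// num_real.
rewrite poweR_EFin lee_fin powR12_sqrt; last by apply: Rintegral_ge0 => w _; exact: sqr_ge0.
by rewrite -[leRHS](ger0_norm B0) -sqrtr_sqr ler_wsqrtr.
Qed.
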